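(* Let $n \ge 2$ and let $L(D)$ be a homogeneous linear differential operator on $\mathbf{R}^n$ from $E$ to $F$. The following conditions are equivalent: (i) there exists $C>0$ such that for every $f \in L^1(\mathbf{R}^n;E)$ with $L(D)f=0$ and every $\varphi \in C^\infty_c(\mathbf{R}^n;E)$, \[ \int_{\mathbf{R}^n} f\cdot\varphi \le C \|f\|_{L^1}\|D\varphi\|_{L^n}; \] (ii) for every $f\in L^1(\mathbf{R}^n;E)$ with $L(D)f=0$, one has $\int_{\mathbf{R}^n} f=0$; (iii) $L(D)$ is cocanceling.
   Context: $E$ and $F$ are finite-dimensional real vector spaces, endowed with Euclidean structures (inner product denoted by $\cdot$). A homogeneous linear differential operator $L(D)$ of order $k$ on $\mathbf{R}^n$ from $E$ to $F$ is $L(D)f=\sum_{|\alpha|=k}L_\alpha(\partial^\alpha f)$ with $L_\alpha$ linear maps from $E$ to $F$, $\alpha \in \mathbf{N}^n$; its symbol is $L(\xi)=\sum_{|\alpha|=k}\xi^\alpha L_\alpha$. For $f\in L^1$, $L(D)f$ is understood in the sense of distributions. $L(D)$ is cocanceling if $\bigcap_{\xi\in\mathbf{R}^n\setminus\{0\}}\ker L(\xi)=\{0\}$. *)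

(* Defs.v *)
From HB Require Import structures.
From mathcomp Require Import all_boot all_order all_algebra.
From mathcomp Require Import all_classical all_reals all_analysis.

Set Implicit Arguments.
Unset Strict Implicit.
Unset Printing Implicit Defensive.

Import Order.TTheory GRing.Theory Num.Theory.
Import numFieldNormedType.Exports.

Local Open Scope classical_set_scope.
Local Open Scope ring_scope.

(* The product sigma-algebra on row vectors; for T = R : realType it is the
   Borel sigma-algebra of R^n. *)
Section measurable_rV.
Context {d} {T : measurableType d} {n : nat}.

Let rV_coor (i : 'I_n) (x : 'rV[T]_n) : T := x ord0 i.

HB.instance Definition _ := @isMeasurable.Build (measure_tuple_display d)
  'rV[T]_n (g_sigma_preimage rV_coor) (@sigma_algebra0 _ _ _)
  (@sigma_algebraC _ _) (@sigma_algebra_bigcup _ _ _).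

End measurable_rV.

Lemma measurable_fun_rVP d1 d2 (T1 : measurableType d1)
    (T2 : measurableType d2) n (f : T1 -> 'rV[T2]_n) :
  measurable_fun [set: T1] f <->
  forall i, measurable_fun [set: T1] (fun x => f x ord0 i).
Proof.
apply: (@iff_trans _ (g_sigma_preimage
    (fun i => (fun x : 'rV[T2]_n => x ord0 i) \o f) `<=` measurable)).
  rewrite g_sigma_preimage_comp; split=> [mf A [/= C preC <-]|prefS].
    exact: mf.
  by move=> _ A mA; apply: prefS; exists A.
split=> [fS i|mf].
- move=> _ A mA; apply: fS; apply: sub_sigma_algebra.
  case: n i => [[] []//|n i] in f *.
  rewrite -bigcup_mkord_ord; exists i; first exact: ltn_ord.
  by exists A => //; rewrite inord_val.
- apply: smallest_sub; first exact: sigma_algebra_measurable.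
  case: n => [|n] in f mf *; first by rewrite big_ord0.
  rewrite -bigcup_mkord_ord; apply: bigcup_sub => i Ii.
  by move=> A [B mB <-]; exact: mf.
Qed.

Lemma sigma_finite_product d1 d2 (T1 : measurableType d1)
    (T2 : measurableType d2) (R : realType)
    (m1 : {sigma_finite_measure set T1 -> \bar R})
    (m2 : {sigma_finite_measure set T2 -> \bar R}) :
  sigma_finite setT (m1 \x m2)%E.
Proof.
have /sigma_finiteP[F [TF ndF Foo]] := sigma_finiteT m1.
have /sigma_finiteP[G [TG ndG Goo]] := sigma_finiteT m2.
exists (fun n => F n `*` G n).
  rewrite -setXTT TF TG predeqE => -[x y]; split.
    move=> [/= [n _ Fnx] [k _ Gky]]; exists (maxn n k) => //; split.
    - by move: x Fnx; exact/subsetPset/ndF/leq_maxl.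
    - by move: y Gky; exact/subsetPset/ndG/leq_maxr.
  by move=> [n _ []/= ? ?]; split; exists n.
move=> k; have [? ?] := Foo k; have [? ?] := Goo k.
split; first exact: measurableX.
by rewrite product_measure1E// lte_mul_pinfty// ge0_fin_numE.
Qed.

Section lebesgue_measure_rV.
Variable R : realType.

Definition rV_cons (n : nat) (p : measurableTypeR R * 'rV[R]_n) : 'rV[R]_n.+1 :=
  row_mx (p.1 : R)%:M p.2.

Lemma measurable_rV_coord n (i : 'I_n) :
  measurable_fun [set: 'rV[R]_n] (fun x : 'rV[R]_n => x ord0 i).
Proof. by move: i; apply/(measurable_fun_rVP (id : 'rV[R]_n -> 'rV[R]_n)); exact: measurable_id. Qed.

Lemma rV_cons0 n (p : measurableTypeR R * 'rV[R]_n) : rV_cons p ord0 ord0 = p.1.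
Proof.
rewrite [X in rV_cons p _ X](_ : _ = lshift n (ord0 : 'I_1)); last exact/val_inj.
by rewrite [LHS]row_mxEl mxE eqxx.
Qed.

Lemma rV_consS n (p : measurableTypeR R * 'rV[R]_n) i :
  rV_cons p ord0 (lift ord0 i) = p.2 ord0 i.
Proof.
rewrite [X in rV_cons p _ X](_ : _ = rshift 1 i); last exact/val_inj.
by rewrite [LHS]row_mxEr.
 Qed.

Lemma measurable_rV_cons n : measurable_fun setT (@rV_cons n).
Proof.
apply/measurable_fun_rVP => i; case: (unliftP ord0 i) => [j|] ->.
  under eq_fun do rewrite rV_consS.
  apply: (measurableT_comp (measurable_rV_coord j)); exact: measurable_snd.
by under eq_fun do rewrite rV_cons0; exact: measurable_fst.
Qed.

Lemma rV_cons_inj n : injective (@rV_cons n).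
Proof.
move=> [a x] [b y] E; congr (_, _).
  by rewrite -[a]/((a, x).1) -rV_cons0 E rV_cons0.
by apply/rowP => i; rewrite -[x]/((a, x).2) -rV_consS E rV_consS.
Qed.

Lemma rV_cons_surj n (x : 'rV[R]_n.+1) : exists p, rV_cons p = x.
Proof.
exists ((lsubmx (x : 'rV_(1 + n))) ord0 ord0, rsubmx (x : 'rV_(1 + n))).
by rewrite /rV_cons /= -mx11_scalar hsubmxK.
Qed.

Lemma measurable_rV_cons_image n (A : set (measurableTypeR R * 'rV[R]_n)) :
  measurable A -> measurable (@rV_cons n @` A).
Proof.
pose u (x : 'rV[R]_n.+1) : measurableTypeR R * 'rV[R]_n :=
  (x ord0 ord0, rsubmx (x : 'rV_(1 + n))).
have uK p : u (rV_cons p) = p.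
  by rewrite /u rV_cons0 [rsubmx _]row_mxKr -surjective_pairing.
have mu : measurable_fun setT u.
  apply/measurable_fun_pairP; split => /=; first exact: measurable_rV_coord.
  apply/measurable_fun_rVP => i.
  rewrite (_ : (fun _ => _) = (fun x : 'rV[R]_n.+1 => x ord0 (rshift 1 i))).
    exact: measurable_rV_coord.
  by apply/funext => x /=; rewrite mxE.
move=> mA; rewrite (_ : _ @` _ = u @^-1` A).
  by rewrite -[X in measurable X]setTI; exact: mu.
apply/seteqP; split=> [_ [p Ap <-]|x] /=; first by rewrite uK.
by have [p <-] := rV_cons_surj x; rewrite uK => Ap; exists p.
Qed.

(* See lebesgue_rV_box for the characterization on boxes. *)
Fixpoint lebesgue_rV (n : nat) : set 'rV[R]_n -> \bar R :=
  match n with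
  | 0 => dirac (0 : 'rV[R]_0)
  | n'.+1 => pushforward (@lebesgue_measure R \x @lebesgue_rV n')%E (@rV_cons n')
  end.

Section pushforward_rV_cons.
Variables (n : nat) (mu : {sigma_finite_measure set 'rV[R]_n -> \bar R}).
Let mf := @measurable_rV_cons n.
Let nu := pushforward (@lebesgue_measure R \x mu)%E (@rV_cons n).

Let nu0 : nu set0 = 0%E. Proof. exact: measure0. Qed.

Let nu_ge0 A : (0 <= nu A)%E. Proof. exact: measure_ge0. Qed.

Let nu_sigma_additive : semi_sigma_additive nu.
Proof. exact: measure_semi_sigma_additive. Qed.

#[local]
HB.instance Definition _ := isMeasure.Build _ _ _ nu
  nu0 nu_ge0 nu_sigma_additive.

Let nu_sigma_finite : sigma_finite setT nu.
Proof.
have [F FT Foo] := sigma_finite_product (@lebesgue_measure R) mu.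
exists (fun k => @rV_cons n @` F k).
  apply/esym/seteqP; split=> // x _; have [p <-] := rV_cons_surj x.
  by have : setT p by []; rewrite FT => -[k _ Fkp]; exists k => //; exists p.
move=> k; have [mFk Fkoo] := Foo k; split.
  exact: measurable_rV_cons_image.
rewrite /nu /pushforward (_ : _ @^-1` _ = F k)//.
apply/seteqP; split=> [p [q Fq /rV_cons_inj <-]//|p Fp]; by exists p.
Qed.

#[local]
HB.instance Definition _ := Measure_isSigmaFinite.Build _ _ _ nu
  nu_sigma_finite.

Lemma pushforward_rV_cons_measure :
  exists m : {sigma_finite_measure set 'rV[R]_n.+1 -> \bar R},
    m = pushforward (@lebesgue_measure R \x mu)%E (@rV_cons n) :> (set _ -> \bar R).
Proof. by exists nu. Qed.

End pushforward_rV_cons.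

Lemma lebesgue_rV_measure n :
  exists m : {sigma_finite_measure set 'rV[R]_n -> \bar R},
    m = @lebesgue_rV n :> (set _ -> \bar R).
Proof.
elim: n => [|n [m mE]]; first by exists (\d_(0 : 'rV[R]_0)).
have [m' m'E] := pushforward_rV_cons_measure m.
by exists m'; rewrite m'E mE.
Qed.

Section lebesgue_rV_instance.
Variable n : nat.

Let lebesgue_rV_set0 : lebesgue_rV (@set0 'rV[R]_n) = 0%E.
Proof. by have [m <-] := lebesgue_rV_measure n; exact: measure0. Qed.

Let lebesgue_rV_ge0 (A : set 'rV[R]_n) : (0 <= lebesgue_rV A)%E.
Proof. by have [m <-] := lebesgue_rV_measure n; exact: measure_ge0. Qed.

Let lebesgue_rV_sigma_additive : semi_sigma_additive (@lebesgue_rV n).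
Proof.
by have [m <-] := lebesgue_rV_measure n; exact: measure_semi_sigma_additive.
Qed.

HB.instance Definition _ := isMeasure.Build _ _ _ (@lebesgue_rV n)
  lebesgue_rV_set0 lebesgue_rV_ge0 lebesgue_rV_sigma_additive.

Let lebesgue_rV_sigma_finite : sigma_finite setT (@lebesgue_rV n).
Proof. by have [m <-] := lebesgue_rV_measure n; exact: sigma_finiteT. Qed.

HB.instance Definition _ := Measure_isSigmaFinite.Build _ _ _ (@lebesgue_rV n)
  lebesgue_rV_sigma_finite.

End lebesgue_rV_instance.

Lemma lebesgue_rV_box n (A : 'I_n -> set (measurableTypeR R)) :
  (forall i, measurable (A i)) ->
  lebesgue_rV [set x : 'rV[R]_n | forall i, A i (x ord0 i)] =
  (\prod_(i < n) lebesgue_measure (A i))%E.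
Proof.
elim: n A => [|n IH] A mA.
  rewrite big_ord0 /= diracE mem_set//; by case.
rewrite big_ord_recl -IH; last by move=> i; exact: mA.
rewrite -product_measure1E//; last first.
  rewrite (_ : mkset _ = \bigcap_(i in [set: 'I_n])
     ((fun x : 'rV[R]_n => x ord0 i) @^-1` A (lift ord0 i))); last first.
    by apply/seteqP; split=> [x Ax i _|x Ax i]; [exact: Ax|exact: (Ax i)].
  apply: fin_bigcap_measurable => // i _.
  rewrite -[X in measurable X]setTI.
  exact: (measurable_rV_coord i _ (mA _)).
rewrite /= /pushforward; congr (_ _).
apply/seteqP; split=> [p /= Ap|p /= [A1 A2] i].
  split=> [|i]; first by have := Ap ord0; rewrite rV_cons0.
  by have := Ap (lift ord0 i); rewrite rV_consS.
by case: (unliftP ord0 i) => [j|] ->; rewrite ?rV_cons0// rV_consS; exact: A2.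
Qed.

End lebesgue_measure_rV.
Arguments lebesgue_rV R n A : clear implicits.

Section scalar_functions.
Variables (R : realType) (n : nat).
Implicit Types g : 'rV[R]_n -> R.

Definition partial (i : 'I_n) g : 'rV[R]_n -> R :=
  fun x => 'D_(delta_mx ord0 i) g x.

(* [:: i1; ...; im] stands for the iterated derivative d_i1 (... (d_im g)) *)
Definition iter_partial (s : seq 'I_n) g : 'rV[R]_n -> R := foldr partial g s.

Definition smooth g := forall s : seq 'I_n,
  continuous (iter_partial s g) /\
  forall (i : 'I_n) (x : 'rV[R]_n),
    derivable (iter_partial s g) x (delta_mx ord0 i).

Definition test_function g := smooth g /\ compact (closure [set x | g x != 0]).

End scalar_functions.

(* Exponents alpha in N^n with |alpha| = k; their entries are at most k. *)
Notation multiindex n k :=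
  {a : {ffun 'I_n -> 'I_k.+1} | (\sum_(i < n) a i)%N == k}
  (n in scope nat_scope, k in scope nat_scope).

Definition multi_partial (R : realType) (n k : nat) (a : multiindex n k)
    (g : 'rV[R]_n -> R) : 'rV[R]_n -> R :=
  foldr (fun i h => iter (val a i) (partial i) h) g (enum 'I_n).

(* A vectType carries no topology and no sigma-algebra: analytic notions for
   E-valued functions are taken coordinatewise in a basis of E, and do not
   depend on the basis. *)
Section vector_functions.
Variables (R : realType) (n : nat) (E : vectType R).
Implicit Types f phi : 'rV[R]_n -> E.

Definition coordf f (j : 'I_(\dim {:E})) : 'rV[R]_n -> R :=
  fun x => coord (vbasis {:E}) j (f x).

Definition vint f : E :=
  \sum_(j < \dim {:E})
    (\int[lebesgue_rV R n]_x coordf f j x) *: (vbasis {:E})`_j.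

Definition vpartial (i : 'I_n) phi : 'rV[R]_n -> E := fun x =>
  \sum_(j < \dim {:E}) partial i (coordf phi j) x *: (vbasis {:E})`_j.

Definition vtest_function phi :=
  (forall j, smooth (coordf phi j)) /\ compact (closure [set x | phi x != 0]).

Variable dotE : {dot E for idfun}.

Definition enorm (v : E) : R := Num.sqrt (dotE v v).

Definition L1norm f : \bar R :=
  ('N[lebesgue_rV R n]_1 [EFin \o (enorm \o f)])%E.

Definition in_L1 f :=
  (forall j, measurable_fun [set: 'rV[R]_n] (coordf f j)) /\
  (L1norm f < +oo)%E.

(* |D phi(x)| is the Euclidean (Hilbert-Schmidt) norm of D phi(x) : R^n -> E *)
Definition Dnorm phi (x : 'rV[R]_n) : R :=
  Num.sqrt (\sum_(i < n) enorm (vpartial i phi x) ^+ 2).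

Definition LnormD phi : \bar R :=
  ('N[lebesgue_rV R n]_(n%:R%:E) [EFin \o Dnorm phi])%E.

End vector_functions.

Section differential_operators.
Variables (R : realType) (n k : nat) (E F : vectType R).

Definition hom_diffop := multiindex n k -> 'Hom(E, F).

Implicit Types L : hom_diffop.

Definition symbol L (xi : 'rV[R]_n) : 'Hom(E, F) :=
  \sum_(a : multiindex n k) (\prod_(i < n) xi ord0 i ^+ val a i) *: L a.

Definition cocanceling L :=
  \bigcap_(xi in [set xi : 'rV[R]_n | xi != 0])
    [set e : E | e \in lker (symbol L xi)] = [set 0].

(* The value at the test function psi of the F-valued distribution L(D) f,
   namely the sum over alpha of L_alpha ((-1)^|alpha| int f d^alpha psi). *)
Definition diffop_distribution L (f : 'rV[R]_n -> E) (psi : 'rV[R]_n -> R) : F :=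
  \sum_(a : multiindex n k)
    L a ((-1) ^+ k *: vint (fun x => multi_partial a psi x *: f x)).

Definition diffop_eq0 L (f : 'rV[R]_n -> E) :=
  forall psi, test_function psi -> diffop_distribution L f psi = 0.

End differential_operators.

(* Main.v *)
Require Import Defs.
From HB Require Import structures.
From mathcomp Require Import all_boot all_order all_algebra.
From mathcomp Require Import all_classical all_reals all_analysis.
From mathcomp Require Import measurable_realfun.
From mathcomp Require Import ring lra zify.

Set Implicit Arguments.
Unset Strict Implicit.
Unset Printing Implicit Defensive.

Import Order.TTheory GRing.Theory Num.Theory.
Import numFieldNormedType.Exports.

Local Open Scope classical_set_scope.
Local Open Scope ring_scope.

(** Write n = m + 1.

    The substance is that cocancellation implies the estimate. Let
    (g_a), with |a| = k, be integrable functions with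
    sum_a D^a g_a = 0 as distributions, let xi = (1, tau) be a covector and
    let g_xi = sum_a xi^a g_a. Then [scalar_estimate] bounds the integral of
    g_xi phi by the L^1 norm of (g_a) times the L^n norm of those derivatives
    of phi that are tangent to the hyperplanes xi . x = t. If phi depended
    on xi . x alone, its k-fold primitive P in the direction of xi would
    formally satisfy D^a P = xi^a phi, and the equation tested with P would say that
    the integral of g_xi phi is 0.
    In general, for k >= 1, P is replaced by a potential: the integral over the depth s in
    [0, La] of s^(k-1) (1 - s/La)^k A_s phi, where A_s phi (x) is an average of
    phi over a disc of radius comparable to eps + s in the hyperplane at depth s
    below x. A derivative in direction i acts on A_s as - xi_i d/ds, plus 1/(eps + s)
    times the average against the divergence of a modified kernel
    ([avg_partial_divergence]). Integrating by parts in s therefore turns D^a of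
    the potential into (k-1)! xi^a A_0 phi, plus terms carrying a
    negative power of La, which disappear as La grows, plus terms in which one
    tangential derivative has reached phi ([wavg_bound]).

    The hyperplanes have dimension m < n, so both remaining errors are
    controlled by the L^n norm nu of the tangential derivatives on the slices.
    With eps = om^n, an average of such a derivative is at most
    C om^-m nu ([avg_le_energy], a form of the Hoelder inequality), and A_0 phi
    differs from phi by at most C om nu ([avg0_approx], the Morrey
    inequality on slices). On a slab cut out by a function th of xi . x
    this gives ([local_estimate])
      | int g_xi th phi | <=
          C (om nu int |g_xi| th + |g|_1 om^-m nu int th).
    Cut phi by a fine partition into slabs, and take om = t / nu_j on the j-th
    slab, where t is the global L^n norm of the tangential derivatives. The
    first terms add up to at most C t |g|_1. The second ones add up to C t^-m |g|_1
    times a Riemann sum for the integral of the slice energies, and this sum is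
    at most 2 t^n.

    For a cocanceling operator, finitely many covectors of the form (1, tau)
    suffice to separate the points of E: along the Kronecker curve
    r |-> (1, r, r^(k+1), r^((k+1)^2), ...) distinct multi-indices give distinct
    powers of r, so that a vector killed by the symbol at enough points
    of the curve is killed by every coefficient of the operator
    ([symbol_kronecker_eq0]). A left inverse of the resulting injective map
    writes each coordinate of f as a combination of functions g_xi, where the
    g_a are the coordinates of L_a f ([coordf_pairing_estimate]).

    The estimate forces the integral v of f to vanish because R^n is
    n-parabolic for n >= 2: there are cutoffs that tend to 1 everywhere and whose
    gradients tend to 0 in L^n ([exists_slow_cutoffs]). Testing with them
    times v gives |v|^2 <= 0. Finally, if e is killed by all symbols then e is
    killed by all coefficients, and the indicator of a cube times e is a solution
    whose integral is a nonzero multiple of e. *)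

(** * Integration on row vectors *)

(** The integrands below have the form EFin composed with a real function;
    these forms of the closure properties keep the operations under EFin, where
    real-valued integrals produce them. *)
Section integrable_EFin.
Context d {T : measurableType d} {R : realType}.
Variables (mu : {measure set T -> \bar R}) (D : set T) (mD : measurable D).
Implicit Types f g : T -> R.

Lemma integrable_EFinZl c f : mu.-integrable D (EFin \o f) ->
  mu.-integrable D (EFin \o (fun x => c * f x)).
Proof. exact: integrableZl. Qed.

Lemma integrable_EFinZr c f : mu.-integrable D (EFin \o f) ->
  mu.-integrable D (EFin \o (fun x => f x * c)).
Proof. exact: integrableZr. Qed.

Lemma integrable_EFinD f g : mu.-integrable D (EFin \o f) ->
  mu.-integrable D (EFin \o g) -> mu.-integrable D (EFin \o (fun x => f x + g x)).
Proof. exact: integrableD. Qed.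

Lemma integrable_EFinB f g : mu.-integrable D (EFin \o f) ->
  mu.-integrable D (EFin \o g) -> mu.-integrable D (EFin \o (fun x => f x - g x)).
Proof. exact: integrableB. Qed.

Lemma integrable_EFin_sum (I : Type) (r : seq I) (f_ : I -> T -> R) :
  (forall i, mu.-integrable D (EFin \o f_ i)) ->
  mu.-integrable D (EFin \o (fun x => \sum_(i <- r) f_ i x)).
Proof.
move=> fi; rewrite (_ : _ \o _ = fun x => \sum_(i <- r) (f_ i x)%:E)%E.
  by apply: integrable_sum => // i _; exact: fi.
by apply/funext => x /=; rewrite sumEFin.
Qed.

Lemma Rintegral_sum (I : Type) (r : seq I) (f_ : I -> T -> R) :
  (forall i, mu.-integrable D (EFin \o f_ i)) ->
  \int[mu]_(x in D) (\sum_(i <- r) f_ i x) = \sum_(i <- r) \int[mu]_(x in D) f_ i x.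
Proof.
move=> fi; elim: r => [|i r IH].
  rewrite big_nil; under eq_Rintegral do rewrite big_nil.
  by rewrite Rintegral_cst// mul0r.
rewrite big_cons -IH -RintegralD//; last exact: integrable_EFin_sum.
by apply: eq_Rintegral => x _; rewrite big_cons.
Qed.

End integrable_EFin.

Lemma rV_norm_leP (R : realType) n (x : 'rV[R]_n) (B : R) : 0 <= B ->
  `|x| <= B <-> forall i, `|x ord0 i| <= B.
Proof.
move=> B0; rewrite [X in X <= _]/Num.norm/= mx_normrE; split=> [/bigmax_leP[_ +] i|xB].
  by move=> /(_ (ord0, i)); exact.
by apply/bigmax_leP; split=> // -[i j] _ /=; rewrite (ord1 i).
Qed.

Lemma rV_norm_coord (R : realType) n (x : 'rV[R]_n) i : `|x ord0 i| <= `|x|.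
Proof. by move: i; apply/rV_norm_leP. Qed.

Lemma measurable_rV_bigcap (R : realType) n (A : 'I_n -> set (measurableTypeR R)) :
  (forall i, measurable (A i)) ->
  measurable [set x : 'rV[R]_n | forall i, A i (x ord0 i)].
Proof.
move=> mA.
rewrite (_ : mkset _ = \bigcap_(i in [set: 'I_n])
   ((fun x : 'rV[R]_n => x ord0 i) @^-1` A i)); last first.
  by apply/seteqP; split=> [x Ax i _|x Ax i]; [exact: Ax|exact: (Ax i)].
apply: fin_bigcap_measurable => // i _.
rewrite -[X in measurable X]setTI.
exact: (measurable_rV_coord i _ (mA _)).
Qed.

(** The boxes with rational vertices are a countable base of the topology. *)
Lemma open_measurable_rV (R : realType) n (U : set 'rV[R]_n) :
  open U -> measurable U.
Proof.
move=> oU.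
pose box (ab : 'rV[rat]_n * 'rV[rat]_n) := [set x : 'rV[R]_n | forall i,
  (`]ratr (ab.1 ord0 i), ratr (ab.2 ord0 i)[%classic : set R) (x ord0 i)].
rewrite (_ : U = \bigcup_ab (if `[<box ab `<=` U>] then box ab else set0)).
  apply: countable_bigcupT_measurable; first exact: countableP.
  move=> ab; case: ifPn => // _.
  apply: (@measurable_rV_bigcap _ _ (fun i =>
    `]ratr (ab.1 ord0 i), ratr (ab.2 ord0 i)[%classic)) => i.
  exact: measurable_itv.
apply/seteqP; split=> [x Ux|x [ab _]]; last first.
  by case: ifPn => // /asboolP; exact.
have /nbhs_ballP[e /= e0 xeU] : nbhs x U by exact: open_nbhs_nbhs.
have ha i : exists q : rat, ratr q \in `](x ord0 i - e), (x ord0 i)[.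
  by apply: rat_in_itvoo; rewrite gtrBl.
have hb i : exists q : rat, ratr q \in `](x ord0 i), (x ord0 i + e)[.
  by apply: rat_in_itvoo; rewrite ltrDl.
have [a aP] := choice ha; have [b bP] := choice hb.
exists (\row_i a i, \row_i b i) => //.
case: ifPn => [_ i|/asboolP[]]/=.
  rewrite !mxE; move: (aP i) (bP i); rewrite !in_itv/= => /andP[_ ->].
  by move=> /andP[->].
move=> y yb; apply: xeU; rewrite mx_norm_ball /ball_/=.
rewrite (@le_lt_trans _ _ (\big[Order.max/0]_i `|x ord0 i - y ord0 i|))//.
  rewrite /Num.norm/= mx_normrE; apply/bigmax_leP; split=> //=.
    by apply/bigmax_geP; left.
  by move=> [i j] _; rewrite ord1/= !mxE; exact: le_bigmax.
apply/bigmax_ltP; split=> //= i _.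
have := yb i; rewrite /= !mxE !in_itv/=.
move: (aP i) (bP i); rewrite !in_itv/= ltr_norml.
by move=> /andP[a1 a2] /andP[b1 b2] /andP[y1 y2]; apply/andP; split; lra.
Qed.

Lemma continuous_measurable_rV (R : realType) n (g : 'rV[R]_n -> R) :
  continuous g -> measurable_fun [set: 'rV[R]_n] g.
Proof.
move=> /continuousP cg; apply: (measurability _ (RGenOInfty.measurableE R)).
move=> _ [_ [a ->] <-]; rewrite setTI; apply: open_measurable_rV.
by apply: cg; exact: interval_open.
Qed.

Lemma ge0_integral_affine1 (R : realType) (a c : R) (h : measurableTypeR R -> \bar R) : c != 0 ->
  measurable_fun [set: R] h -> (forall x, 0 <= h x)%E ->
  (\int[lebesgue_measure]_x h (a + c * x)%R =
   (`|c|^-1)%:E * \int[lebesgue_measure]_x h x)%E.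
Proof.
move=> c0 mh h0.
pose phi (x : measurableTypeR R) : measurableTypeR R := (a + c * (x : R))%R.
have mphi : measurable_fun [set: measurableTypeR R] phi.
  by apply: measurable_funD => //; exact: mulrl_measurable.
have -> : (\int[lebesgue_measure]_x h (a + c * x)%R =
    \int[pushforward (@lebesgue_measure R) phi]_x h x)%E.
  by rewrite ge0_integral_pushforward.
have c0' : 0 <= `|c| by [].
have E A : measurable A -> lebesgue_measure A =
    mscale (NngNum c0') (pushforward (@lebesgue_measure R) phi) A.
  apply: lebesgue_measure_unique => _ [[u v] _ <-].
  rewrite [RHS](_ : _ =
    (`|c|%:E * lebesgue_measure (phi @^-1` `]u, v]%classic))%E)//.
  rewrite lebesgue_measure_itv/= lte_fin.
  have [cp|cn] := ltP 0 c.
    rewrite (_ : _ @^-1` _ = `](u - a) / c, (v - a) / c]%classic); last first.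
      apply/seteqP; split=> x /=; rewrite !in_itv/= /phi.
        by rewrite ltr_pdivrMr// ler_pdivlMr// ltrBlDl lerBrDl mulrC.
      by rewrite ltr_pdivrMr// ler_pdivlMr// ltrBlDl lerBrDl mulrC.
    rewrite lebesgue_measure_itv/= lte_fin ltr_pM2r ?invr_gt0// ltrD2r.
    case: ifPn => _; last by rewrite mule0.
    by rewrite gtr0_norm// -EFinB -EFinM; congr (_%:E); field.
  have {}cn : c < 0 by rewrite lt_neqAle c0.
  rewrite (_ : _ @^-1` _ = `[(v - a) / c, (u - a) / c[%classic); last first.
    apply/seteqP; split=> x /=; rewrite !in_itv/= /phi.
      by rewrite ltr_ndivlMr// ler_ndivrMr// ltrBlDl lerBrDl mulrC andbC.
    by rewrite ltr_ndivlMr// ler_ndivrMr// ltrBlDl lerBrDl mulrC andbC.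
  rewrite lebesgue_measure_itv/= lte_fin ltr_nM2r ?invr_lt0// ltrD2r.
  case: ifPn => _; last by rewrite mule0.
  by rewrite ltr0_norm// -EFinB -EFinM; congr (_%:E); field.
rewrite -[in RHS](_ : (\int[mscale (NngNum c0') (pushforward (@lebesgue_measure R) phi)]_x h x)%E = (\int[lebesgue_measure]_x h x)%E); last first.
  by apply: eq_measure_integral => A mA _; exact/esym/(E mphi).
rewrite ge0_integral_mscale//= muleA -EFinM mulVf ?normr_eq0// mul1e.
by [].
Qed.

Section lebesgue_rV_fubini.
Variable R : realType.
Local Notation mu n := (lebesgue_rV R n).

Lemma ge0_integral_rV_cons n (h : 'rV[R]_n.+1 -> \bar R) :
  measurable_fun [set: 'rV[R]_n.+1] h -> (forall x, 0 <= h x)%E ->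
  (\int[mu n.+1]_x h x =
   \int[lebesgue_measure]_t \int[mu n]_y h (rV_cons (t, y)))%E.
Proof.
move=> mh h0; have mc := @measurable_rV_cons R n.
rewrite -(fubini_tonelli1 (h \o @rV_cons R n)); last 2 first.
- exact: measurableT_comp.
- by move=> p; exact: h0.
transitivity (\int[pushforward (@lebesgue_measure R \x mu n)%E (@rV_cons R n)]_x h x)%E.
  by apply: eq_measure_integral.
by rewrite ge0_integral_pushforward.
Qed.

Lemma measurable_integral_rV_cons n (h : 'rV[R]_n.+1 -> \bar R) :
  measurable_fun [set: 'rV[R]_n.+1] h -> (forall x, 0 <= h x)%E ->
  measurable_fun [set: measurableTypeR R]
    (fun t => \int[mu n]_y h (rV_cons (t, y)))%E.
Proof.
move=> mh h0; have mc := @measurable_rV_cons R n.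
apply: (measurable_fun_fubini_tonelli_F (h \o @rV_cons R n)) => //.
  exact: measurableT_comp.
by move=> p; exact: h0.
Qed.

Lemma rV_cons_affine n (a : 'rV[R]_n.+1) (c : R) (t : R) (y : 'rV[R]_n) :
  a + c *: rV_cons (t, y) =
  rV_cons (a ord0 ord0 + c * t, \row_i a ord0 (lift ord0 i) + c *: y).
Proof.
apply/rowP => i; case: (unliftP ord0 i) => [j|] ->.
  by rewrite rV_consS mxE [X in _ + X]mxE rV_consS !mxE.
by rewrite rV_cons0 mxE [X in _ + X]mxE rV_cons0.
Qed.

Lemma measurable_rV_affine n (a : 'rV[R]_n) (c : R) :
  measurable_fun [set: 'rV[R]_n] (fun x => a + c *: x).
Proof.
apply/measurable_fun_rVP => i.
under eq_fun do rewrite !mxE.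
apply: measurable_funD => //; apply: measurable_funM => //.
exact: measurable_rV_coord.
Qed.

Lemma ge0_integral_affine n (a : 'rV[R]_n) (c : R) (h : 'rV[R]_n -> \bar R) :
  c != 0 -> measurable_fun [set: 'rV[R]_n] h -> (forall x, 0 <= h x)%E ->
  (\int[mu n]_x h (a + c *: x)%R = ((`|c| ^+ n)^-1)%:E * \int[mu n]_x h x)%E.
Proof.
move=> c0; elim: n a h => [|n IH] a h mh h0.
  rewrite expr0 invr1 mul1e; apply: eq_integral => x _; congr h.
  by apply/rowP => -[].
rewrite ge0_integral_rV_cons//; last first.
  by apply: (measurableT_comp mh); exact: measurable_rV_affine.
under eq_integral => t _.
  under eq_integral => y _ do rewrite rV_cons_affine.
  rewrite (IH _ (fun y => h (rV_cons (_, y))))//; last first.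
    apply: (measurableT_comp mh).
    apply: (measurableT_comp (@measurable_rV_cons R n)).
    exact: measurable_pair1.
  over.
rewrite ge0_integralZl//; last 2 first.
- apply: (measurableT_comp (measurable_integral_rV_cons mh h0)).
  by apply: measurable_funD => //; exact: mulrl_measurable.
- by move=> t _; exact: integral_ge0.
rewrite (@ge0_integral_affine1 _ _ _
  (fun t => \int[mu n]_y h (rV_cons (t, y)))%E)//; last 2 first.
- exact: measurable_integral_rV_cons.
- by move=> t; exact: integral_ge0.
rewrite muleA -EFinM exprS invfM [in LHS]mulrC; congr (_ * _)%E.
by rewrite [RHS]ge0_integral_rV_cons.
Qed.

Lemma ge0_integral_translate n (a : 'rV[R]_n) (h : 'rV[R]_n -> \bar R) :
  measurable_fun [set: 'rV[R]_n] h -> (forall x, 0 <= h x)%E ->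
  (\int[mu n]_x h (a + x)%R = \int[mu n]_x h x)%E.
Proof.
move=> mh h0; rewrite -[RHS]mul1e -[1%E]/(1%:E) -invr1 -[X in X^-1](expr1n R n).
rewrite -[X in X ^+ n](@normr1 R) -(ge0_integral_affine a)// ?oner_neq0//.
by under [RHS]eq_integral do rewrite scale1r.
Qed.

Lemma integral_translate n (a : 'rV[R]_n) (h : 'rV[R]_n -> \bar R) :
  measurable_fun [set: 'rV[R]_n] h ->
  (\int[mu n]_x h (a + x)%R = \int[mu n]_x h x)%E.
Proof.
move=> mh; rewrite [LHS]integralE [RHS]integralE.
rewrite -(ge0_integral_translate a (measurable_funepos mh))//.
rewrite -(ge0_integral_translate a (measurable_funeneg mh))//.
by congr (_ - _)%E; apply: eq_integral => x _; rewrite ?funeposE ?funenegE.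
Qed.

Definition dotr n (tau y : 'rV[R]_n) : R := \sum_i tau ord0 i * y ord0 i.

Lemma measurable_dotr n (tau : 'rV[R]_n) :
  measurable_fun [set: 'rV[R]_n] (dotr tau).
Proof.
apply: measurable_sum => i; apply: measurable_funM => //.
exact: measurable_rV_coord.
Qed.

Opaque lebesgue_rV.

(** Fubini along the hyperplanes y_0 + tau . y = t instead of the
    coordinate hyperplanes: on each line parallel to the first axis the shear is a
    translation. *)
Lemma ge0_integral_shear n (tau : 'rV[R]_n) (h : 'rV[R]_n.+1 -> \bar R) :
  measurable_fun [set: 'rV[R]_n.+1] h -> (forall x, 0 <= h x)%E ->
  (\int[lebesgue_measure]_t \int[mu n]_y h (rV_cons (t - dotr tau y, y)%R)
   = \int[mu n.+1]_x h x)%E.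
Proof.
move=> mh h0.
rewrite (fubini_tonelli (fun p : measurableTypeR R * 'rV[R]_n =>
    h (rV_cons ((p.1 : R) - dotr tau p.2, p.2)))) => //; last first.
  apply: (measurableT_comp mh).
  apply: (measurableT_comp (@measurable_rV_cons R n)).
  apply/measurable_fun_pairP; split => /=; last exact: measurable_snd.
  apply: measurable_funB; first exact: measurable_fst.
  by apply: (measurableT_comp (measurable_dotr tau)); exact: measurable_snd.
rewrite [RHS]ge0_integral_rV_cons//.
have mc : measurable_fun setT (h \o @rV_cons R n).
  by apply: (measurableT_comp mh); exact: measurable_rV_cons.
apply: etrans (esym (@fubini_tonelli _ _ _ _ R (@lebesgue_measure R) (mu n) _
  mc (fun=> h0 _))).
apply: eq_integral => y _ /=.
have mhy : measurable_fun [set: measurableTypeR R] (fun t => h (rV_cons (t, y))).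
  apply: (measurableT_comp mh).
  apply: (measurableT_comp (@measurable_rV_cons R n)).
  exact: measurable_pair2.
have := @ge0_integral_affine1 R (- dotr tau y) 1 _ (oner_neq0 _) mhy.
rewrite normr1 invr1 mul1e => <-//.
by apply: eq_integral => t _; rewrite mul1r addrC.
Qed.

End lebesgue_rV_fubini.

Section compact_support.
Variable R : realType.
Local Notation mu n := (lebesgue_rV R n).

Definition bounded_support n (g : 'rV[R]_n -> R) :=
  exists2 B : R, 0 <= B & forall x, g x != 0 -> `|x| <= B.

Lemma measure_cube n (B : R) :
  (mu n [set x | (`|x| <= B)%R] < +oo)%E.
Proof.
have [B0|B0] := ltP B 0.
  rewrite (_ : mkset _ = set0) ?measure0//.
  by apply/seteqP; split=> // x /=; rewrite leNgt (lt_le_trans B0).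
have -> : [set x : 'rV[R]_n | `|x| <= B] =
    [set x | forall i, (`[- B, B]%classic : set R) (x ord0 i)].
  apply/seteqP; split=> x /=; rewrite (rV_norm_leP x B0) => + i => /(_ i).
    by rewrite in_itv/= ler_norml.
  by rewrite in_itv/= ler_norml.
rewrite (@lebesgue_rV_box R n (fun=> `[- B, B]%classic))//.
rewrite ltey_eq prode_fin_num// => i _.
by rewrite lebesgue_measure_itv/=; case: ifP.
Qed.

Lemma measurable_cube n (B : R) : measurable [set x : 'rV[R]_n | (`|x| <= B)%R].
Proof.
rewrite -[X in measurable X]setCK; apply: measurableC; apply: open_measurable_rV.
rewrite (_ : ~` _ = (fun x : 'rV[R]_n => `|x|) @^-1` `]B, +oo[%classic); last first.
  by apply/seteqP; split=> x /=; rewrite in_itv/= andbT ltNge => /negP.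
by apply: open_comp => //= x _; exact: norm_continuous.
Qed.

Lemma continuous_bounded_support_bounded n (g : 'rV[R]_n -> R) :
  continuous g -> bounded_support g -> exists2 K : R, 0 <= K & forall x, `|g x| <= K.
Proof.
move=> cg [B B0 gB].
pose A := [set x : 'rV[R]_n | `|x| <= B].
have cA : compact A.
  apply: bounded_closed_compact.
    by exists B; split; [exact: num_real|move=> M BM x /= xB; exact: le_trans xB (ltW BM)].
  rewrite (_ : A = (fun x : 'rV[R]_n => `|x|) @^-1` `]-oo, B]%classic); last first.
    by apply/seteqP; split=> x /=; rewrite in_itv.
  by apply: closed_comp => //= x _; exact: norm_continuous.
have A0 : A !=set0 by exists 0; rewrite /A/= normr0.
have cng : {within A, continuous (fun x => `|g x|)}.
  apply: continuous_subspaceT => x.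
  by apply: continuous_comp; [exact: cg|exact: norm_continuous].
have [c _ cmax] := EVT_max_rV A0 cA cng.
exists `|g c| => // x; have [->|gx0] := eqVneq (g x) 0; first by rewrite normr0.
by apply: cmax; rewrite inE; exact: gB.
Qed.

Lemma integrable_bounded_support n (g : 'rV[R]_n -> R) :
  measurable_fun [set: 'rV[R]_n] g -> bounded_support g ->
  (exists2 K : R, 0 <= K & forall x, `|g x| <= K) ->
  (mu n).-integrable [set: 'rV[R]_n] (EFin \o g).
Proof.
move=> mg [B B0 gB] [K K0 gK].
apply/integrableP; split; first exact/measurable_EFinP.
pose A := [set x : 'rV[R]_n | `|x| <= B].
have mA : measurable A by exact: measurable_cube.
apply: (@le_lt_trans _ _ (\int[mu n]_x (K%:E * (\1_A x)%:E))%E).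
  apply: ge0_le_integral => //.
  - by apply: measurableT_comp => //; exact/measurable_EFinP.
  - apply: emeasurable_funM => //; apply/measurable_EFinP.
    exact: measurable_indic.
  - move=> x _ /=; rewrite -EFinM lee_fin indicE; have [xA|] := boolP (x \in A).
      by rewrite mulr1.
    rewrite notin_setE/= => xB; rewrite mulr0 normr_le0.
    by apply/negPn/negP => gx0; apply: xB; exact: gB.
rewrite ge0_integralZl//; last first.
  by apply/measurable_EFinP; exact: measurable_indic.
rewrite integral_indic// setIT.
by apply: lte_mul_pinfty => //; exact: measure_cube.
Qed.

Lemma integrable_indic_cube n (B : R) : 0 <= B ->
  (mu n).-integrable setT (EFin \o \1_[set x : 'rV[R]_n | `|x| <= B]).
Proof.
move=> B0; apply: integrable_bounded_support.
- by apply: measurable_indic; exact: measurable_cube.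
- exists B => // x; rewrite indicE; case: (boolP (x \in _)); last by rewrite eqxx.
  by rewrite inE.
- by exists 1 => // x; rewrite indicE normr_nat lern1; case: (_ \in _).
Qed.

Lemma integrable_continuous_bounded_support n (g : 'rV[R]_n -> R) :
  continuous g -> bounded_support g ->
  (mu n).-integrable [set: 'rV[R]_n] (EFin \o g).
Proof.
move=> cg bg; apply: integrable_bounded_support => //.
  exact: continuous_measurable_rV.
exact: continuous_bounded_support_bounded.
Qed.

Lemma test_functionP n (g : 'rV[R]_n -> R) :
  test_function g <-> smooth g /\ bounded_support g.
Proof.
split=> -[sg].
  move=> /compact_bounded[B [_ /(_ (`|B| + 1))]] H; split=> //.
  exists (`|B| + 1); first by rewrite addr_ge0.
  move=> x gx0; apply: H; last exact: subset_closure.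
  by rewrite (le_lt_trans (ler_norm _))// ltrDl.
move=> [B B0 gB]; split => //; apply: bounded_closed_compact; last exact: closed_closure.
exists B; split; first exact: num_real.
move=> M BM x clx /=.
have : closed [set x : 'rV[R]_n | `|x| <= B].
  rewrite (_ : mkset _ = (fun x : 'rV[R]_n => `|x|) @^-1` `]-oo, B]%classic); last first.
    by apply/seteqP; split=> y /=; rewrite in_itv.
  by apply: closed_comp => //= y _; exact: norm_continuous.
move=> /closure_id cB; apply: le_trans (ltW BM).
have : closure [set x | g x != 0] `<=` closure [set x : 'rV[R]_n | `|x| <= B].
  exact: closure_subset.
by rewrite -cB; exact.
Qed.

End compact_support.

(** * Smooth functions and test functions *)

Section continuous_rV.
Variables (R : realType) (n : nat).
Implicit Types g h : 'rV[R]_n -> R.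

Lemma continuous_rVD g h : continuous g -> continuous h ->
  continuous (fun x => g x + h x).
Proof. by move=> cg ch x; apply: (@continuousD _ _ _ g h); [exact: cg|exact: ch]. Qed.

Lemma continuous_rVM g h : continuous g -> continuous h ->
  continuous (fun x => g x * h x).
Proof. by move=> cg ch x; apply: (@continuousM _ _ g h); [exact: cg|exact: ch]. Qed.

End continuous_rV.

Section directional_derivative.
Variable R : realType.

Lemma is_deriveP (V W : normedModType R) (g : V -> W) (x v : V) (d : W) :
  is_derive x v g d <->
  (fun h : R => h^-1 *: (g (h *: v + x) - g x)) @ 0^' --> d.
Proof.
split=> [[dg <-]|cg]; first exact: dg.
apply: DeriveDef; first by apply/cvg_ex; exists d.
exact: cvg_lim.
Qed.

Lemma is_derive_line (V W : normedModType R) (g : V -> W) (a v : V) (t : R) d :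
  is_derive (a + t *: v) v g d -> is_derive t 1 (fun t : R => g (a + t *: v)) d.
Proof.
move=> /is_deriveP dg; apply/is_deriveP.
rewrite (_ : (fun h : R => _) =
  (fun h => h^-1 *: (g (h *: v + (a + t *: v)) - g (a + t *: v))))//.
apply/funext => h; congr (_ *: (g _ - _)).
by rewrite [h%:A]mulr1 scalerDl addrCA.
Qed.

Lemma MVT_dist (f df : R -> R) (p q : R) :
  (forall x : R, is_derive x 1 f (df x)) ->
  exists2 c : R, `|c - p| <= `|q - p| & f q - f p = df c * (q - p).
Proof.
move=> df_.
have cf a b : {within `[a, b], continuous f}.
  apply: continuous_subspaceT => x; apply: differentiable_continuous.
  by apply/derivable1_diffP; have [] := df_ x.
have [pq|qp] := leP p q.
  have [c cpq ->] := @MVT_segment R f df p q pq (fun x _ => df_ x) (cf _ _).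
  exists c => //; move: cpq; rewrite in_itv/= => /andP[pc cq].
  by rewrite !ger0_norm ?subr_ge0// lerD2r.
have [c cpq E] := @MVT_segment R f df q p (ltW qp) (fun x _ => df_ x) (cf _ _).
exists c; last by rewrite -opprB E -mulrN opprB.
move: cpq; rewrite in_itv/= => /andP[pc cq].
by rewrite distrC [leRHS]distrC !ger0_norm ?subr_ge0 ?lerD2l ?lerN2//; exact: ltW.
Qed.

Lemma lipschitz_continuous (V : normedModType R) (g : V -> R) (K : R) :
  (forall x y, `|g x - g y| <= K * `|x - y|) -> continuous g.
Proof.
move=> gK x; apply/(@cvgrPdist_lt _ _ _ (nbhs x)) => e e0.
have K1 : 0 < `|K| + 1 by rewrite ltr_wpDl.
apply/nbhs_ballP; exists (e / (`|K| + 1)) => /=; first exact: divr_gt0.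
move=> y; rewrite -ball_normE/= ltr_pdivlMr// => xy.
apply: le_lt_trans xy; rewrite (le_trans (gK _ _))// mulrC ler_wpM2l//.
by rewrite (le_trans (ler_norm _))// lerDl.
Qed.

Variable n : nat.
Implicit Types g : 'rV[R]_n -> R.
Local Notation delta i := (delta_mx ord0 i : 'rV[R]_n).

Lemma norm_delta_le (i : 'I_n) : `|delta i| <= 1.
Proof.
apply/rV_norm_leP => // j; rewrite mxE eqxx/=.
by case: (_ == _); rewrite ?normr1 ?normr0.
Qed.

(** The increment along w + c delta_j splits into one along w and one along
    delta_j from a nearby point; the mean value theorem and the continuity of the
    j-th partial derivative handle the second. This is the induction step from
    partial derivatives to derivatives in all directions. *)
Lemma is_derive_add_coord g (x w : 'rV[R]_n) (j : 'I_n) (c d : R) :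
  (forall y, derivable g y (delta j)) -> {for x, continuous (partial j g)} ->
  is_derive x w g d ->
  is_derive x (w + c *: delta j) g (d + c * partial j g x).
Proof.
move=> dgj cgj /is_deriveP dg; apply/is_deriveP.
pose A h := h^-1 *: (g (h *: w + x) - g x).
pose B h := h^-1 *: (g (h *: (w + c *: delta j) + x) - g (h *: w + x)).
rewrite (_ : (fun h : R => _) = A \+ B); last first.
  apply/funext => h; rewrite /A /B/= -scalerDr; congr (_ *: _).
  by rewrite [RHS]addrC addrA subrK.
apply: cvgD => //.
apply/cvgrPdist_le => e e0.
have e'0 : 0 < e / (`|c| + 1) by rewrite divr_gt0// ltr_wpDl.
move/cvgrPdist_le : (cgj) => /(_ _ e'0) /nbhs_ballP[r/= r0 xr].
have K0 : 0 < `|w| + `|c| + 1 by rewrite ltr_wpDl// addr_ge0.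
near=> h.
have h0 : h != 0 by near: h; exact: nbhs_dnbhs_neq.
have hr : `|h| * (`|w| + `|c| + 1) < r.
  rewrite -ltr_pdivlMr//; near: h; apply: dnbhs0_lt; exact: divr_gt0.
have df (t : R) : is_derive t 1 (fun t : R => g ((h *: w + x) + t *: delta j))
    (partial j g ((h *: w + x) + t *: delta j)).
  by apply: is_derive_line; exact/derivableP.
have [s sle E] := MVT_dist 0 (h * c) df.
rewrite scale0r addr0 !subr0 in sle E.
rewrite /B [h *: (_ + _)]scalerDr [h *: (c *: _)]scalerA [h *: w + _ + x]addrAC E.
rewrite -[h^-1 *: _]/(h^-1 * _) mulrCA [h^-1 * _]mulrA mulVf// mul1r [_ * c]mulrC -mulrBr normrM.
rewrite (@le_trans _ _ (`|c| * (e / (`|c| + 1))))//; last first.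
  by rewrite mulrCA ger_pMr// ler_pdivrMr ?ltr_wpDl// mul1r lerDl.
rewrite ler_wpM2l//; apply: xr; rewrite mx_norm_ball /ball_/=.
rewrite [h *: w + x]addrC -addrA opprD addrA subrr sub0r normrN.
apply: le_lt_trans hr; rewrite (le_trans (ler_normD _ _))// !normrZ.
rewrite -addrA mulrDr lerD2l.
rewrite (le_trans (ler_wpM2l (normr_ge0 s) (norm_delta_le j)))// mulr1.
by rewrite (le_trans sle)// normrM ler_wpM2l// lerDl.
Unshelve. all: end_near. Qed.

Definition C1 g := continuous g /\ forall i,
  (forall y, derivable g y (delta i)) /\ continuous (partial i g).

Lemma C1_is_derive g (x v : 'rV[R]_n) : C1 g ->
  is_derive x v g (\sum_i v ord0 i * partial i g x).
Proof.
move=> [_ dg]; rewrite [v in is_derive _ v](_ : v = \sum_i v ord0 i *: delta i);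
  last by rewrite [LHS]row_sum_delta.
elim/big_rec2 : _ => [|i d w _ IH]; first exact: is_derive0.
rewrite addrC [_ + d]addrC.
by apply: is_derive_add_coord => //; [have [] := dg i|have [_] := dg i; exact].
Qed.

Lemma C1_is_derive_line g (a v : 'rV[R]_n) (t : R) : C1 g ->
  is_derive t 1 (fun t : R => g (a + t *: v))
    (\sum_i v ord0 i * partial i g (a + t *: v)).
Proof. by move=> Cg; apply: is_derive_line; exact: C1_is_derive. Qed.

Lemma C1_lipschitz g (K : R) : C1 g -> (forall i x, `|partial i g x| <= K) ->
  forall x y, `|g x - g y| <= n%:R * K * `|x - y|.
Proof.
move=> Cg gK x y.
have [c _] := MVT_dist 0 1 (fun t => C1_is_derive_line y (x - y) t Cg).
rewrite scale1r scale0r addr0 subr0 mulr1 [y + (x - y)]addrC subrK => ->.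
rewrite (le_trans (ler_norm_sum _ _ _))//.
rewrite (@le_trans _ _ (\sum_(i < n) K * `|x - y|))//; last first.
  by rewrite sumr_const card_ord -[X in X <= _]mulr_natl mulrA.
apply: ler_sum => i _; rewrite normrM mulrC ler_pM//.
exact: rV_norm_coord.
Qed.

End directional_derivative.

Section smooth_functions.
Variables (R : realType) (n : nat).
Implicit Types g h : 'rV[R]_n -> R.
Local Notation delta i := (delta_mx ord0 i : 'rV[R]_n).

Lemma smooth_iter_partial (s : seq 'I_n) g : smooth g -> smooth (iter_partial s g).
Proof. by move=> sg r; have := sg (r ++ s); rewrite /iter_partial foldr_cat. Qed.

Lemma smooth_partial i g : smooth g -> smooth (partial i g).
Proof. exact: (@smooth_iter_partial [:: i]). Qed.

Lemma smooth_C1 g : smooth g -> C1 g.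
Proof.
move=> sg; split=> [|i]; first by have [] := sg [::].
by split; [move=> y; have [_] := sg [::]; exact|have [] := sg [:: i]].
Qed.

Lemma smooth_continuous g : smooth g -> continuous g.
Proof. by case/smooth_C1. Qed.

Lemma smooth_is_partial g i x : smooth g ->
  is_derive x (delta i) g (partial i g x).
Proof. by move=> sg; apply: derivableP; have [_] := sg [::]; exact. Qed.

(** Smoothness is a greatest fixed point, so it is enough to exhibit a
    family of continuous functions closed under partial derivatives. The closure
    properties of smooth functions follow by choosing the family: finite sums of
    products, multiples of shifted functions, integrals of derivatives, and so on. *)
Lemma smooth_coind (P : ('rV[R]_n -> R) -> Prop) :
  (forall g, P g -> continuous g /\
     forall i, exists2 g', P g' & forall x, is_derive x (delta i) g (g' x)) ->
  forall g, P g -> smooth g.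
Proof.
move=> HP g Pg s.
have Ps : P (iter_partial s g).
  elim: s => //= i s /HP[_ /(_ i)[g' Pg' dg']].
  rewrite (_ : partial i _ = g')//; apply/funext => x.
  by rewrite /partial; apply: derive_val; exact: dg'.
have [cs ds] := HP _ Ps; split=> // i x.
by have [g' _ /(_ x) []] := ds i.
Qed.

Opaque smooth partial.

Lemma smooth_cst (c : R) : smooth (fun _ : 'rV[R]_n => c).
Proof.
apply: (@smooth_coind (fun g => exists c : R, g = fun=> c)); last by exists c.
move=> _ [a ->]; split; first exact: cst_continuous.
by move=> i; exists (fun=> 0) => [|x]; [by exists 0|exact: is_derive_cst].
Qed.

Lemma smoothD g h : smooth g -> smooth h -> smooth (g \+ h).
Proof.
move=> sg sh; apply: (@smooth_coind (fun f => exists g h,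
    [/\ smooth g, smooth h & f = g \+ h])); last by exists g, h.
move=> _ [{sg sh}g [{}h [sg sh ->]]]; split.
  by apply: continuous_rVD; exact: smooth_continuous.
move=> i; exists (partial i g \+ partial i h).
  exists (partial i g), (partial i h).
  by split; [exact: (smooth_partial i sg)|exact: (smooth_partial i sh)|].
by move=> x; apply: is_deriveD; exact: smooth_is_partial.
Qed.

Lemma smooth_sum (I : Type) (r : seq I) (g_ : I -> 'rV[R]_n -> R) :
  (forall i, smooth (g_ i)) -> smooth (fun x => \sum_(i <- r) g_ i x).
Proof.
move=> sg; elim: r => [|i r IH].
  by under eq_fun do rewrite big_nil; exact: smooth_cst.
by under eq_fun do rewrite big_cons; exact: (smoothD (sg i) IH).
Qed.

Lemma smoothM g h : smooth g -> smooth h -> smooth (fun x => g x * h x).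
Proof.
move=> sg sh.
pose ok (p : ('rV[R]_n -> R) * ('rV[R]_n -> R)) := smooth p.1 /\ smooth p.2.
apply: (@smooth_coind (fun f => exists2 l : seq _, List.Forall ok l &
    f = fun x => \sum_(p <- l) p.1 x * p.2 x)); last first.
  exists [:: (g, h)]; first by do 2 constructor.
  by apply/funext => x; rewrite big_seq1.
move=> _ [l okl ->]; split.
  elim: okl => [|p {}l [s1 s2] _ IH].
    by under eq_fun do rewrite big_nil; exact: cst_continuous.
  under eq_fun do rewrite big_cons.
  by apply: continuous_rVD IH; apply: continuous_rVM; exact: smooth_continuous.
move=> i; pose l' := flatten [seq [:: (partial i p.1, p.2); (p.1, partial i p.2)] | p <- l].
exists (fun x => \sum_(p <- l') p.1 x * p.2 x).
  exists l' => //; rewrite /l' {l'}; elim: okl => [|p {}l [s1 s2] _ IH]/=; constructor.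
    by split; [exact: (smooth_partial i s1)|exact: s2].
  constructor; last exact: IH.
  by split; [exact: s1|exact: (smooth_partial i s2)].
move=> x; rewrite /l'; elim: okl => [|p {l'}l [s1 s2] _ IH]/=.
  rewrite big_nil; under eq_fun do rewrite big_nil; exact: is_derive_cst.
rewrite !big_cons/= addrA; under eq_fun do rewrite big_cons.
apply: is_deriveD => //.
rewrite addrC [partial i p.1 x * _]mulrC.
by apply: is_deriveM; exact: smooth_is_partial.
Qed.

Lemma smoothZ (c : R) g : smooth g -> smooth (fun x => c * g x).
Proof. by move=> sg; apply: smoothM; [exact: smooth_cst|exact: sg]. Qed.

Lemma smooth_coord (j : 'I_n) : smooth (fun x : 'rV[R]_n => x ord0 j).
Proof.
apply: (@smooth_coind (fun f => f = (fun x : 'rV[R]_n => x ord0 j) \/ smooth f));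
  last by left.
move=> f [->|sf]; last first.
  split; first exact: smooth_continuous.
  move=> i; exists (partial i f); first by right; exact: smooth_partial.
  by move=> x; exact: smooth_is_partial.
split; first exact: coord_continuous.
move=> i; exists (fun=> (i == j)%:R); first by right; exact: smooth_cst.
move=> x; apply/is_deriveP; apply: cvg_near_cst.
near=> h; rewrite !mxE eqxx/= eq_sym.
rewrite addrK /GRing.scale/= mulrA mulVf ?mul1r//.
by near: h; exact: nbhs_dnbhs_neq.
Unshelve. all: end_near. Qed.

End smooth_functions.

Section smooth_line.
Variables (R : realType).

Lemma is_derive1_dir (f : R -> R) (x v d : R) :
  is_derive x 1 f d -> is_derive x v f (v * d).
Proof.
move=> [df dE]; have Df : differentiable f x by exact/derivable1_diffP.
apply: DeriveDef; first exact: diff_derivable.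
rewrite deriveE// -[v in 'd _ _ v]mulr1 -[v * 1]/(v *: 1) linearZ/=.
by rewrite -deriveE// dE.
Qed.

(** Profiles of one variable, later composed with linear forms; iterated
    ordinary derivatives are what the fundamental theorem of calculus provides. *)
Variant smooth1 (f : R -> R) : Prop :=
  Smooth1 of forall k (x : R), derivable (derive1n k f) x 1.

Lemma smooth1_is_derive (f : R -> R) k (x : R) : smooth1 f ->
  is_derive x 1 (derive1n k f) ((derive1n k.+1 f) x).
Proof. by case=> sf; rewrite derive1nS derive1E; exact: derivableP. Qed.

Lemma smooth1_continuous (f : R -> R) k : smooth1 f -> continuous (derive1n k f).
Proof.
by case=> sf x; apply: differentiable_continuous; exact/derivable1_diffP.
Qed.

Variable n : nat.
Local Notation delta i := (delta_mx ord0 i : 'rV[R]_n).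

Lemma dotrD (a x y : 'rV[R]_n) : dotr a (x + y) = dotr a x + dotr a y.
Proof. by rewrite /dotr -big_split/=; apply: eq_bigr => i _; rewrite mxE mulrDr. Qed.

Lemma dotrZ (a x : 'rV[R]_n) c : dotr a (c *: x) = c * dotr a x.
Proof. by rewrite /dotr mulr_sumr; apply: eq_bigr => i _; rewrite mxE mulrCA. Qed.

Lemma dotr_delta (a : 'rV[R]_n) i : dotr a (delta i) = a ord0 i.
Proof.
rewrite /dotr (bigD1 i)//= mxE !eqxx mulr1 big1 ?addr0// => j ji.
by rewrite mxE eqxx/= (negbTE ji) mulr0.
Qed.

Lemma smooth_dotr (a : 'rV[R]_n) : smooth (dotr a).
Proof.
apply: (@smooth_sum _ _ _ _ (fun i x => a ord0 i * x ord0 i)) => i.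
by apply: smoothZ; exact: smooth_coord.
Qed.

Lemma is_derive_comp_dotr (f : R -> R) (d : R) (a x v : 'rV[R]_n) :
  is_derive (dotr a x) 1 f d ->
  is_derive x v (fun x => f (dotr a x)) (dotr a v * d).
Proof.
move=> /(is_derive1_dir (dotr a v))/is_deriveP df; apply/is_deriveP.
by under eq_fun do rewrite dotrD dotrZ.
Qed.

Lemma smooth_comp_dotr (f : R -> R) (a : 'rV[R]_n) : smooth1 f ->
  smooth (fun x => f (dotr a x)).
Proof.
move=> sf; apply: (@smooth_coind _ _ (fun g => exists c k,
    g = fun x => c * (derive1n k f) (dotr a x))); last first.
  by exists 1, 0%N; apply/funext => x; rewrite mul1r derive1n0.
move=> _ [c [k ->]]; split.
  move=> x; apply: (@continuousM _ _ (fun=> c) ((derive1n k f) \o dotr a)).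
    exact: cst_continuous.
  apply: continuous_comp; last exact: smooth1_continuous.
  exact: smooth_continuous (smooth_dotr a) _.
move=> i; exists (fun x => (c * a ord0 i) * (derive1n k.+1 f) (dotr a x)).
  by exists (c * a ord0 i), k.+1.
move=> x; rewrite -mulrA -(dotr_delta a i).
apply: (@is_deriveZ _ _ _ (fun x => (derive1n k f) (dotr a x)) c).
by apply: is_derive_comp_dotr; exact: smooth1_is_derive.
Qed.

End smooth_line.

Section integral_of_smooth.
Context {R : realType} {n : nat} d {W : measurableType d}.
Variable mu : {measure set W -> \bar R}.
Variables (D : set W) (mD : measurable D).
Local Notation delta i := (delta_mx ord0 i : 'rV[R]_n).

(** Only a neighbourhood of a matters for the derivative at a, so the
    dominating functions are local in t. *)
Lemma derive_under_integral (f df : R -> W -> R) (k0 k1 : W -> R) (a : R) :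
  (forall (t : R) w, D w -> is_derive t 1 (f ^~ w) (df t w)) ->
  (forall t, measurable_fun D (f t)) ->
  mu.-integrable D (EFin \o k0) -> mu.-integrable D (EFin \o k1) ->
  (forall t w, `|t - a| < 1 -> D w -> `|f t w| <= k0 w) ->
  (forall t w, `|t - a| < 1 -> D w -> `|df t w| <= k1 w) ->
  is_derive a 1 (fun t => \int[mu]_(w in D) f t w) (\int[mu]_(w in D) df a w).
Proof.
move=> df_ mf ik0 ik1 fk0 fk1.
have Iaa : `](a - 1), (a + 1)[%classic a by rewrite /= in_itv/= gtrBl ltrDl ltr01.
have Ia (t : R) : `](a - 1), (a + 1)[%classic t -> `|t - a| < 1.
  by rewrite /= in_itv/= => /andP[t1 t2]; rewrite ltr_norml; apply/andP; split; lra.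
have intf (t : R) : `](a - 1), (a + 1)[%classic t -> mu.-integrable D (EFin \o f t).
  move=> /Ia ta; apply: le_integrable ik0 => //; first exact/measurable_EFinP.
  by move=> w Dw; rewrite /= lee_fin (le_trans (fk0 _ _ ta Dw))// ler_norm.
have dfE (t : R) w : D w -> partial1of2 f t w = df t w.
  by move=> Dw; rewrite partial1of2E; apply: derive_val; exact: df_.
have ik1' : mu.-integrable D (EFin \o (fun w => `|k1 w|)).
  exact: integrable_norm ik1.
have Gub (t : R) w : `](a - 1), (a + 1)[%classic t -> D w ->
    `|partial1of2 f t w| <= `|k1 w|.
  by move=> /Ia ta Dw; rewrite dfE// (le_trans (fk1 _ _ ta Dw))// ler_norm.
have derf (t : R) w : `](a - 1), (a + 1)[%classic t -> D w -> derivable (f ^~ w) t 1.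
  by move=> _ Dw; have [] := df_ t w Dw.
have := cvg_differentiation_under_integral mD Iaa intf derf _ ik1' Gub.
move=> /(_ (fun=> normr_ge0 _)) H; apply/is_deriveP; move: H.
rewrite (_ : \int[mu]_(w in D) partial1of2 f a w =
    \int[mu]_(w in D) df a w); last first.
  by apply: eq_Rintegral => w /set_mem Dw; rewrite dfE.
by apply: cvg_trans; apply: near_eq_cvg; near=> h; rewrite [h%:A]mulr1.
Unshelve. all: end_near.
Qed.

Lemma integral_C1_derive (v : W -> 'rV[R]_n -> R) (i : 'I_n) (k0 k1 : W -> R)
    (x : 'rV[R]_n) :
  (forall w, C1 (v w)) ->
  (forall x, measurable_fun D (fun w => v w x)) ->
  mu.-integrable D (EFin \o k0) -> mu.-integrable D (EFin \o k1) ->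
  (forall w y, `|y - x| <= 1 -> D w -> `|v w y| <= k0 w) ->
  (forall w y, `|y - x| <= 1 -> D w -> `|partial i (v w) y| <= k1 w) ->
  is_derive x (delta i) (fun x => \int[mu]_(w in D) v w x)
    (\int[mu]_(w in D) partial i (v w) x).
Proof.
move=> Cv mv ik0 ik1 vk0 vk1.
have near1 (t : R) : `|t - 0| < 1 -> `|x + t *: delta i - x| <= 1.
  rewrite subr0 [x + _]addrC addrK normrZ => t1.
  by rewrite (le_trans (ler_wpM2l _ (norm_delta_le R i)))// mulr1 ltW.
have dI : is_derive (0 : R) 1 (fun t : R => \int[mu]_(w in D) v w (x + t *: delta i))
    (\int[mu]_(w in D) partial i (v w) (x + 0 *: delta i)).
  apply: (@derive_under_integral (fun t w => v w (x + t *: delta i))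
    (fun t w => partial i (v w) (x + t *: delta i)) k0 k1 0) => //.
  - move=> t w _; apply: is_derive_line; apply: derivableP.
    by have [_ /(_ i)[dv _]] := Cv w; exact: dv.
  - by move=> t w /near1 t1 Dw; exact: vk0.
  - by move=> t w /near1 t1 Dw; exact: vk1.
rewrite scale0r addr0 in dI.
move/is_deriveP : dI => H; apply/is_deriveP; move: H.
apply: cvg_trans; apply: near_eq_cvg; near=> h; rewrite scale0r !addr0.
by congr (_ *: (_ - _)); apply: eq_Rintegral => w _; rewrite [_%:A]mulr1 addrC.
Unshelve. all: end_near. Qed.

Lemma integral_C1_continuous (v : W -> 'rV[R]_n -> R) (k0 : W -> R)
    (k1 : 'I_n -> W -> R) :
  (forall w, C1 (v w)) ->
  (forall x, measurable_fun D (fun w => v w x)) ->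
  mu.-integrable D (EFin \o k0) -> (forall i, mu.-integrable D (EFin \o k1 i)) ->
  (forall w x, D w -> `|v w x| <= k0 w) ->
  (forall i w x, D w -> `|partial i (v w) x| <= k1 i w) ->
  continuous (fun x => \int[mu]_(w in D) v w x).
Proof.
move=> Cv mv ik0 ik1 vk0 vk1.
have iv x : mu.-integrable D (EFin \o (fun w => v w x)).
  apply: le_integrable ik0 => //; first exact/measurable_EFinP.
  by move=> w Dw; rewrite /= lee_fin (le_trans (vk0 _ _ Dw))// ler_norm.
pose K w := n%:R * \sum_i `|k1 i w|.
have iK : mu.-integrable D (EFin \o K).
  apply: integrable_EFinZl => //; apply: integrable_EFin_sum => // i.
  exact: integrable_norm (ik1 i).
apply: (@lipschitz_continuous _ 'rV[R]_n _ (\int[mu]_(w in D) K w)) => x y.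
rewrite -RintegralB//.
apply: (le_trans (le_normr_Rintegral _ _)) => //.
  exact: (integrable_EFinB mD (iv x) (iv y)).
rewrite -RintegralZr//; apply: le_Rintegral => //.
- apply: integrable_norm.
  exact: (integrable_EFinB mD (iv x) (iv y)).
- exact: (integrable_EFinZr mD `|x - y| iK).
move=> w Dw; apply: C1_lipschitz => // i z.
rewrite (le_trans (vk1 i _ _ Dw))// (le_trans (ler_norm _))//.
by rewrite (bigD1 i)//= lerDl sumr_ge0.
Qed.

(** The integrals of all iterated derivatives form a family closed under
    partial derivatives, by dominated differentiation. *)
Lemma smooth_integral (u : W -> 'rV[R]_n -> R) :
  (forall w, smooth (u w)) ->
  (forall s x, measurable_fun D (fun w => iter_partial s (u w) x)) ->
  (forall s, exists2 k : W -> R, mu.-integrable D (EFin \o k) &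
     forall w x, D w -> `|iter_partial s (u w) x| <= k w) ->
  smooth (fun x => \int[mu]_(w in D) u w x) /\
  forall s x, iter_partial s (fun x => \int[mu]_(w in D) u w x) x =
    \int[mu]_(w in D) iter_partial s (u w) x.
Proof.
move=> su mu_ bu.
have [k kP] := choice (fun s => let: ex_intro2 k a b := bu s in
  ex_intro (fun k => _ /\ _) k (conj a b)).
have dI s i x : is_derive x (delta i)
    (fun x => \int[mu]_(w in D) iter_partial s (u w) x)
    (\int[mu]_(w in D) iter_partial (i :: s) (u w) x).
  apply: (@integral_C1_derive (fun w => iter_partial s (u w)) i (k s) (k (i :: s))).
  - by move=> w; exact: (smooth_C1 (smooth_iter_partial s (su w))).
  - exact: mu_.
  - exact: (kP s).1.
  - exact: (kP (i :: s)).1.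
  - by move=> w y _; exact: (kP s).2.
  - by move=> w y _; exact: (kP (i :: s)).2.
have cI s : continuous (fun x => \int[mu]_(w in D) iter_partial s (u w) x).
  apply: (@integral_C1_continuous (fun w => iter_partial s (u w)) (k s)
    (fun i => k (i :: s))).
  - by move=> w; exact: (smooth_C1 (smooth_iter_partial s (su w))).
  - exact: mu_.
  - exact: (kP s).1.
  - by move=> i; exact: (kP (i :: s)).1.
  - exact: (kP s).2.
  - by move=> i; exact: (kP (i :: s)).2.
split.
  apply: (@smooth_coind _ _ (fun g => exists s,
    g = fun x => \int[mu]_(w in D) iter_partial s (u w) x)); last by exists [::].
  move=> _ [s ->]; split; first exact: cI.
  move=> i; exists (fun x => \int[mu]_(w in D) iter_partial (i :: s) (u w) x).
    by exists (i :: s).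
  exact: dI.
move=> s; elim: s => [//|i s IH] x.
rewrite [LHS]/= (_ : iter_partial s _ =
  fun x => \int[mu]_(w in D) iter_partial s (u w) x); last exact/funext.
by apply: derive_val.
Qed.

End integral_of_smooth.

Section test_functions.
Variables (R : realType) (n : nat).
Implicit Types g h : 'rV[R]_n -> R.
Local Notation delta i := (delta_mx ord0 i : 'rV[R]_n).
Local Notation mu := (lebesgue_rV R n).

Lemma test_smooth g : test_function g -> smooth g.
Proof. by case. Qed.

Lemma test_continuous g : test_function g -> continuous g.
Proof. by case=> /smooth_continuous. Qed.

Lemma test_bounded_support g : test_function g -> bounded_support g.
Proof. by move/test_functionP => []. Qed.

Lemma test_bounded g : test_function g ->
  exists2 K : R, 0 <= K & forall x, `|g x| <= K.
Proof.
move=> tg; apply: continuous_bounded_support_bounded; first exact: test_continuous.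
exact: test_bounded_support.
Qed.

Lemma test_integrable g : test_function g -> mu.-integrable [set: 'rV[R]_n] (EFin \o g).
Proof.
move=> tg; apply: integrable_continuous_bounded_support.
  exact: test_continuous.
exact: test_bounded_support.
Qed.

Lemma test_measurable g : test_function g -> measurable_fun [set: 'rV[R]_n] g.
Proof. by move=> tg; apply: continuous_measurable_rV; exact: test_continuous. Qed.

Lemma test_partial i g : test_function g -> test_function (partial i g).
Proof.
move=> /test_functionP[sg [B B0 gB]]; apply/test_functionP; split.
  exact: smooth_partial.
exists B => // x; apply: contraNT; rewrite -ltNge => Bx; apply/eqP.
have [_ <-] : is_derive x (delta i) g 0 => //.
have g0 y : B < `|y| -> g y = 0.
  by move=> By; apply/eqP; apply: contraTT By => /gB; rewrite -leNgt.
apply/is_deriveP; apply: cvg_near_cst.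
near=> h; rewrite !g0 ?subrr ?scaler0//.
have hB : `|h| < `|x| - B.
  by near: h; apply: dnbhs0_lt; rewrite subr_gt0.
have := ler_normD (h *: delta i + x) (- (h *: delta i)).
rewrite addrAC subrr add0r normrN normrZ => H.
have : `|h| * `|delta i| <= `|h|.
  by rewrite -[leRHS]mulr1 ler_wpM2l// norm_delta_le.
lra.
Unshelve. all: end_near. Qed.

Lemma test_iter_partial s g : test_function g -> test_function (iter_partial s g).
Proof. by move=> tg; elim: s => //= i s IH; exact: test_partial. Qed.

Lemma testM g h : test_function g -> smooth h -> test_function (fun x => g x * h x).
Proof.
move=> /test_functionP[sg [B B0 gB]] sh; apply/test_functionP; split.
  exact: smoothM.
by exists B => // x; rewrite mulf_eq0 negb_or => /andP[/gB].
Qed.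

Lemma testMl g h : smooth g -> test_function h -> test_function (fun x => g x * h x).
Proof.
move=> sg th; rewrite (_ : (fun _ => _) = (fun x => h x * g x)); first exact: testM.
by apply/funext => x; rewrite mulrC.
Qed.

Lemma testZ (c : R) g : test_function g -> test_function (fun x => c * g x).
Proof. by move=> tg; apply: testMl; [exact: smooth_cst|exact: tg]. Qed.

Lemma testD g h : test_function g -> test_function h ->
  test_function (fun x => g x + h x).
Proof.
move=> /test_functionP[sg [B B0 gB]] /test_functionP[sh [B' B'0 hB]].
apply/test_functionP; split; first exact: (smoothD sg sh).
exists (B + B'); first exact: addr_ge0.
move=> x; have [->|/gB gx _] := eqVneq (g x) 0.
  by rewrite add0r => /hB hx; rewrite (le_trans hx)// lerDr.
by rewrite (le_trans gx)// lerDl.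
Qed.

Lemma test0 : test_function (fun _ : 'rV[R]_n => 0 : R).
Proof.
apply/test_functionP; split; first exact: smooth_cst.
by exists 0 => // x; rewrite eqxx.
Qed.

Lemma test_sum (I : Type) (r : seq I) (P : pred I) (g_ : I -> 'rV[R]_n -> R) :
  (forall i, test_function (g_ i)) ->
  test_function (fun x => \sum_(i <- r | P i) g_ i x).
Proof.
move=> tg; elim: r => [|i r IH].
  by under eq_fun do rewrite big_nil; exact: test0.
under eq_fun do rewrite big_cons; case: (P i) => //.
exact: (testD (tg i) IH).
Qed.

Lemma partialE g i x d : is_derive x (delta i) g d -> partial i g x = d.
Proof. by move=> dg; apply: derive_val. Qed.

Lemma partialM g h i x : smooth g -> smooth h ->
  partial i (fun x => g x * h x) x = partial i g x * h x + g x * partial i h x.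
Proof.
move=> sg sh; apply: partialE; rewrite addrC [partial i g x * _]mulrC.
apply: (@is_deriveM _ _ g h); first exact: (smooth_is_partial i x sg).
exact: (smooth_is_partial i x sh).
Qed.

Lemma partialZ (c : R) g i x : smooth g ->
  partial i (fun x => c * g x) x = c * partial i g x.
Proof.
move=> sg; apply: partialE; apply: (@is_deriveZ _ _ _ g c).
exact: (smooth_is_partial i x sg).
Qed.

Lemma partial_sum (I : Type) (r : seq I) (g_ : I -> 'rV[R]_n -> R) i x :
  (forall j, smooth (g_ j)) ->
  partial i (fun x => \sum_(j <- r) g_ j x) x = \sum_(j <- r) partial i (g_ j) x.
Proof.
move=> sg; apply: partialE; elim: r => [|j r IH].
  by rewrite big_nil; under eq_fun do rewrite big_nil; exact: is_derive_cst.
rewrite big_cons; under eq_fun do rewrite big_cons.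
apply: (@is_deriveD _ _ _ (g_ j)) => //.
exact: (smooth_is_partial i x (sg j)).
Qed.

Lemma smooth_shift g (a : 'rV[R]_n) : smooth g ->
  smooth (fun x => g (x + a)) /\
  forall s x, iter_partial s (fun x => g (x + a)) x = iter_partial s g (x + a).
Proof.
move=> sg.
have ds s i x : is_derive x (delta i) (fun x => iter_partial s g (x + a))
    (iter_partial (i :: s) g (x + a)).
  have /is_deriveP H := smooth_is_partial i (x + a) (smooth_iter_partial s sg).
  by apply/is_deriveP; move: H; under eq_fun do rewrite addrA.
split.
  apply: (@smooth_coind _ _ (fun h => exists s,
    h = fun x => iter_partial s g (x + a))); last by exists [::].
  move=> _ [s ->]; split.
    move=> x; apply: (@continuous_comp 'rV[R]_n 'rV[R]_n R (fun x => x + a)).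
      by apply: (@cvgD _ _ _ (nbhs x)); [exact: cvg_id|exact: cvg_cst].
    exact: smooth_continuous (smooth_iter_partial s sg) _.
  move=> i; exists (fun x => iter_partial (i :: s) g (x + a)); first by exists (i :: s).
  exact: ds.
move=> s; elim: s => // i s IH x /=.
rewrite (_ : iter_partial s _ = fun x => iter_partial s g (x + a)); last exact/funext.
by apply: partialE; exact: ds.
Qed.

Lemma iter_partialZ (c : R) s g x : smooth g ->
  iter_partial s (fun x => c * g x) x = c * iter_partial s g x.
Proof.
move=> sg; elim: s x => // i s IH x /=.
rewrite (_ : iter_partial s _ = fun x => c * iter_partial s g x); last exact/funext.
by apply: partialZ; exact: smooth_iter_partial.
Qed.

Lemma Rintegral_translate (a : 'rV[R]_n) g : measurable_fun [set: 'rV[R]_n] g ->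
  \int[mu]_x g (a + x) = \int[mu]_x g x.
Proof.
move=> mg; rewrite /Rintegral; congr fine.
exact: (integral_translate a (h := EFin \o g)) (measurableT_comp _ mg).
Qed.

(** The integral of a translate of g does not depend on the translation;
    differentiate this constant function. *)
Lemma integral_partial_eq0 i g : test_function g -> \int[mu]_x partial i g x = 0.
Proof.
move=> tg; have [sg [B B0 gB]] := (test_functionP _).1 tg.
have tdg := test_partial i tg; have [_ [B' B'0 dgB]] := (test_functionP _).1 tdg.
have [K K0 gK] := test_bounded tg; have [K' K'0 dgK] := test_bounded tdg.
pose k (K B : R) (x : 'rV[R]_n) := K * \1_[set x : 'rV[R]_n | `|x| <= B] x : R.
have ik C (D : R) : 0 <= C -> 0 <= D -> mu.-integrable setT (EFin \o k C D).
  by move=> C0 D0; apply: integrable_EFinZl => //; exact: integrable_indic_cube.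
have bk (f : 'rV[R]_n -> R) C D : 0 <= C -> (forall x, f x != 0 -> `|x| <= D) ->
    (forall x, `|f x| <= C) -> forall w y, `|y - 0| <= 1 -> setT w ->
    `|f (w + y)| <= k C (D + 1) w.
  move=> C0 fD fC w y; rewrite subr0 => y1 _; rewrite /k indicE.
  case: (boolP (w \in _)) => [_|]; first by rewrite mulr1; exact: fC.
  rewrite notin_setE/= => /negP; rewrite -ltNge => wD.
  rewrite mulr0 normr_le0; apply: contraTT wD => /fD wyD; rewrite -leNgt.
  have := ler_normD (w + y) (- y); rewrite addrK normrN; lra.
have Cg w : C1 (fun x => g (w + x)).
  by under eq_fun do rewrite addrC; exact: (smooth_C1 (smooth_shift w sg).1).
have dE w x : partial i (fun x => g (w + x)) x = partial i g (w + x).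
  under [X in partial _ X]eq_fun do rewrite addrC.
  by have /= -> := (smooth_shift w sg).2 [:: i] x; rewrite addrC.
have := @integral_C1_derive R n _ _ mu setT measurableT (fun w x => g (w + x)) i
  (k K (B + 1)) (k K' (B' + 1)) 0 Cg.
case.
- move=> x; apply: (measurableT_comp (test_measurable tg)).
  under eq_fun do rewrite addrC -[X in _ + X]scale1r.
  exact: measurable_rV_affine.
- by apply: ik => //; rewrite addr_ge0.
- by apply: ik => //; rewrite addr_ge0.
- exact: bk.
- by move=> w y y1 _; rewrite dE; exact: bk.
move=> _.
under eq_Rintegral do rewrite dE addr0.
move=> <-; rewrite (_ : (fun x => _) = cst (\int[mu]_x g x)).
  exact: derive_cst.
apply/funext => x /=; rewrite -[RHS](Rintegral_translate x (test_measurable tg)).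
by apply: eq_Rintegral => w _; rewrite addrC.
Qed.

Lemma integration_by_parts_rV i g h : test_function g -> smooth h ->
  \int[mu]_x (partial i g x * h x) = - \int[mu]_x (g x * partial i h x).
Proof.
move=> tg sh; apply/eqP; rewrite -addr_eq0 -RintegralD//; last 2 first.
- exact: (test_integrable (testM (test_partial i tg) sh)).
- exact: (test_integrable (testM tg (smooth_partial i sh))).
apply/eqP; rewrite -[RHS](integral_partial_eq0 i (testM tg sh)).
by apply: eq_Rintegral => x _; rewrite partialM//; exact: test_smooth.
Qed.

End test_functions.

(** * Bump functions *)

Opaque lebesgue_rV smooth partial.

Section smooth1_theory.
Variable R : realType.
Implicit Types f g : R -> R.

Lemma smooth1_coind (P : (R -> R) -> Prop) :
  (forall f, P f -> exists2 f', P f' & forall x : R, is_derive x 1 f (f' x)) ->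
  forall f, P f -> smooth1 f.
Proof.
move=> HP f Pf; split=> k.
have Pk : P (derive1n k f).
  elim: k => [|k /HP[f' Pf' df']]; first by rewrite derive1n0.
  rewrite derive1nS (_ : derive1 _ = f')//.
  by apply/funext => x; rewrite derive1E; apply: derive_val.
by have [f' _ df'] := HP _ Pk; move=> x; have [] := df' x.
Qed.

Lemma smooth1_derive f : smooth1 f -> smooth1 (derive1n 1 f).
Proof. by case=> sf; split=> k; have := sf k.+1; rewrite derive1Sn -derive1n1. Qed.

Lemma smooth1_is_derive1 f (x : R) : smooth1 f -> is_derive x 1 f (derive1n 1 f x).
Proof. by move=> sf; have := smooth1_is_derive 0 x sf; rewrite derive1n0. Qed.

Lemma smooth1_continuous0 f : smooth1 f -> continuous f.
Proof. by move/(@smooth1_continuous _ _ 0); rewrite derive1n0. Qed.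

Lemma smooth1M f g : smooth1 f -> smooth1 g -> smooth1 (fun x => f x * g x).
Proof.
move=> sf sg.
pose ok (p : (R -> R) * (R -> R)) := smooth1 p.1 /\ smooth1 p.2.
apply: (@smooth1_coind (fun f => exists2 l : seq _, List.Forall ok l &
    f = fun x => \sum_(p <- l) p.1 x * p.2 x)); last first.
  exists [:: (f, g)]; first by do 2 constructor.
  by apply/funext => x; rewrite big_seq1.
move=> _ [l okl ->].
pose l' := flatten [seq [:: (derive1n 1 p.1, p.2); (p.1, derive1n 1 p.2)] | p <- l].
exists (fun x => \sum_(p <- l') p.1 x * p.2 x).
  exists l' => //; rewrite /l' {l'}; elim: okl => [|p {}l [s1 s2] _ IH]/=; constructor.
    by split; [exact: (smooth1_derive s1)|exact: s2].
  constructor; last exact: IH.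
  by split; [exact: s1|exact: (smooth1_derive s2)].
move=> x; rewrite /l'; elim: okl => [|p {l'}l [s1 s2] _ IH]/=.
  rewrite big_nil; under eq_fun do rewrite big_nil; exact: is_derive_cst.
rewrite !big_cons/= addrA; under eq_fun do rewrite big_cons.
apply: is_deriveD => //.
rewrite addrC [derive1n 1 p.1 x * _]mulrC.
apply: is_deriveM; [exact: (smooth1_is_derive1 x s1)|exact: (smooth1_is_derive1 x s2)].
Qed.

Lemma smooth1_affine f (a b c : R) : smooth1 f ->
  smooth1 (fun x => c * f (a * x + b)).
Proof.
move=> sf; apply: (@smooth1_coind (fun g => exists c f, smooth1 f /\
  g = fun x => c * f (a * x + b))); last by exists c, f.
move=> _ [{}c [{sf}f [sf ->]]].
exists (fun x => (c * a) * derive1n 1 f (a * x + b)).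
  by exists (c * a), (derive1n 1 f); split=> //; exact: smooth1_derive.
move=> x; rewrite -mulrA; apply: (@is_deriveZ _ _ _ (fun x => f (a * x + b)) c).
rewrite mulrC; apply: (@is_derive1_comp _ f (fun x => a * x + b)).
  exact: smooth1_is_derive1.
rewrite -[a in is_derive _ _ _ a]addr0; apply: is_deriveD.
by rewrite -[a in is_derive _ _ _ a]mulr1; apply: is_deriveZ.
Qed.

Lemma smooth1B f g : smooth1 f -> smooth1 g -> smooth1 (fun x => f x - g x).
Proof.
move=> sf sg; apply: (@smooth1_coind (fun h => exists f g, [/\ smooth1 f, smooth1 g &
  h = fun x => f x - g x])); last by exists f, g.
move=> _ [{sf}f [{sg}g [sf sg ->]]].
exists (fun x => derive1n 1 f x - derive1n 1 g x).
  exists (derive1n 1 f), (derive1n 1 g).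
  by split; [exact: (smooth1_derive sf)|exact: (smooth1_derive sg)|].
by move=> x; apply: is_deriveB; exact: smooth1_is_derive1.
Qed.

End smooth1_theory.

Section bump.
Variable R : realType.

(** With p ranging over the polynomials these functions form a family closed under
    differentiation, which makes exp (-1/x) smooth at 0. *)
Let pexp (p : {poly R}) (x : R) : R :=
  if 0 < x then p.[x^-1] * expR (- x^-1) else 0.

Let pexp_bound (p : {poly R}) : exists2 C : R, 0 <= C & forall x, `|pexp p x| <= C * x ^+ 2.
Proof.
(* The bound x^-1 ^ (i+2) <= (i+2)! exp (x^-1) for each monomial. *)
exists (\sum_(i < size p) `|p`_i| * (i.+2)`!%:R).
  by apply: sumr_ge0 => i _; rewrite mulr_ge0.
move=> x; rewrite /pexp; case: ifPn => [x0|_]; last first.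
  by rewrite normr0 mulr_ge0 ?sqr_ge0// sumr_ge0// => i _; rewrite mulr_ge0.
rewrite horner_coef mulr_suml mulr_suml (le_trans (ler_norm_sum _ _ _))//.
apply: ler_sum => i _; rewrite !normrM -!mulrA ler_wpM2l//.
rewrite expRN ger0_norm ?exprn_ge0 ?invr_ge0 ?(ltW x0)//.
rewrite ger0_norm ?invr_ge0 ?expR_ge0//.
have := @expR_ge1Dxn R x^-1 i.+1; rewrite invr_ge0 (ltW x0) => /(_ isT) H.
rewrite ler_pdivrMr ?expR_gt0// -ler_pdivrMl ?mulr_gt0 ?exprn_gt0 ?ltr0n ?fact_gt0//.
apply: le_trans H; rewrite -[leLHS]add0r lerD//.
by rewrite invfM -exprVn -mulrA -exprD add2n mulrC.
Qed.

Let is_derive_pexp (p : {poly R}) (x : R) :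
  is_derive x 1 (pexp p) (pexp ('X^2 * (p - p^`())) x).
Proof.
have [x0|x0|<-] := ltgtP 0 x.
- apply: (@near_eq_is_derive _ R^o R^o (fun x : R => p.[x^-1] * expR (- x^-1))).
    near=> y; rewrite /pexp ifT//.
    by near: y; exact: (@cvgr_gt _ _ _ _ id x).
  rewrite /pexp x0 hornerM hornerXn hornerD hornerN.
  have dV : is_derive x 1 (fun y : R => y^-1) (- x ^- 2).
    have := @is_deriveV _ (id : R -> R) x 1 1; rewrite gt_eqF//= => /(_ isT).
    by move=> /(_ (is_derive_id _ _)); rewrite [_ *: 1]mulr1.
  have d1 : is_derive x 1 (fun y : R => p.[y^-1]) (p^`().[x^-1] * (- x ^- 2)).
    exact: (@is_derive1_comp _ (horner p) (fun y : R => y^-1)).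
  have d2 : is_derive x 1 (fun y : R => expR (- y^-1)) (expR (- x^-1) * x ^- 2).
    apply: (@is_derive1_comp _ expR (fun y : R => - y^-1)).
    by rewrite -[x ^- 2]opprK; apply: is_deriveN.
  rewrite (_ : x^-1 ^+ 2 * _ * _ = p.[x^-1] * (expR (- x^-1) / x ^+ 2) +
    expR (- x^-1) * (p^`().[x^-1] * - x ^- 2)); first exact: is_deriveM.
  by rewrite exprVn; ring.
- rewrite [X in is_derive _ _ _ X]/pexp ltNge (ltW x0)/=.
  apply: (@near_eq_is_derive _ R^o R^o (cst 0)).
    near=> y; rewrite /pexp ifF//; apply/negbTE; rewrite -leNgt.
    by apply: ltW; near: y; exact: (@cvgr_lt _ _ _ _ id x).
- have [C C0 pC] := pexp_bound p.
  rewrite [X in is_derive _ _ _ X]/pexp ltxx.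
  apply/is_deriveP; apply/cvgrPdist_le => e e0; near=> h.
  have h0 : h != 0 by near: h; exact: nbhs_dnbhs_neq.
  rewrite addr0 [h%:A]mulr1 [pexp p 0]/pexp ltxx subr0 sub0r normrN normrM normfV.
  rewrite ler_pdivrMl ?normr_gt0// (le_trans (pC h))// -real_normK ?num_real//.
  rewrite expr2 mulrCA ler_wpM2l//.
  have : `|h| < e / (C + 1).
    by near: h; apply: dnbhs0_lt; rewrite divr_gt0// ltr_wpDl.
  rewrite ltr_pdivlMr ?ltr_wpDl// => H.
  rewrite mulrC (le_trans _ (ltW H))// ler_wpM2l// lerDl//.
Unshelve. all: end_near. Qed.

Lemma exists_bump01 : exists b : R -> R, [/\ smooth1 b,
  forall x, 0 <= b x, forall x, 0 < x < 1 -> 0 < b x &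
  forall x, ~~ (0 < x < 1) -> b x = 0].
Proof.
pose h := pexp 1.
have sh : smooth1 h.
  apply: (@smooth1_coind _ (fun f => exists p, f = pexp p)); last by exists 1.
  move=> _ [p ->]; exists (pexp ('X^2 * (p - p^`()))); first by eexists.
  exact: is_derive_pexp.
have h0 x : 0 <= h x.
  by rewrite /h /pexp; case: ifP => // _; rewrite hornerC mul1r expR_ge0.
exists (fun x => h x * h (1 - x)); split.
- apply: smooth1M => //; have := smooth1_affine (-1) 1 1 sh.
  by under [X in smooth1 X -> _]eq_fun do rewrite mul1r mulN1r addrC.
- by move=> x; rewrite mulr_ge0.
- move=> x /andP[x0 x1]; rewrite /h /pexp x0 subr_gt0 x1 !hornerC !mul1r.
  by rewrite mulr_gt0 ?expR_gt0.
- move=> x; rewrite negb_and /h /pexp subr_gt0 => /orP[] /negbTE ->.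
    by rewrite mul0r.
  by rewrite mulr0.
Qed.

(** The normalised primitive of a bump function. *)
Lemma exists_smooth_step : exists H : R -> R, [/\ smooth1 H,
  forall x, x <= 0 -> H x = 0, forall x, 1 <= x -> H x = 1,
  {homo H : x y / x <= y} & forall x, 0 <= H x <= 1].
Proof.
have [b [sb b0 bp bz]] := exists_bump01.
have cb := smooth1_continuous0 sb.
pose mu := @lebesgue_measure R.
have ib : mu.-integrable setT (EFin \o b).
  have ib01 : mu.-integrable `[0, 1] (EFin \o b).
    apply: continuous_compact_integrable; first exact: segment_compact.
    exact: continuous_subspaceT.
  have -> : EFin \o b = (EFin \o b) \_ `[0, 1]%classic.
    apply/funext => x; rewrite patchE; case: ifPn => //= x01.
    rewrite bz//; apply: contra x01 => /andP[x0 x1].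
    by rewrite inE/= in_itv/= !ltW.
  exact: (integrable_mkcond _ _).1.
pose F x := \int[mu]_(t in `]-oo, x]) b t.
have dF (x : R) : is_derive x 1 F (b x).
  have [] := @continuous_FTC1 R b -oo%O x (x + 1) _ _ _ (cb x).
  - by rewrite ltrDl.
  - exact: integrableS ib.
  - exact: ltNyr.
  by move=> dF bE; exact: (DeriveDef dF (etrans (esym (derive1E _ _)) bE)).
have sF : smooth1 F.
  apply: (@smooth1_coind _ (fun f => f = F \/ smooth1 f)); last by left.
  move=> f [->|sf]; first by exists b => //; right.
  exists (derive1n 1 f); first by right; exact: (smooth1_derive sf).
  by move=> x; exact: smooth1_is_derive1.
have F0 x : x <= 0 -> F x = 0.
  move=> x0; rewrite /F (_ : \int[mu]_(t in _) _ = \int[mu]_(t in `]-oo, x]) 0).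
    by rewrite Rintegral_cst// mul0r.
  apply: eq_Rintegral => t; rewrite inE/= in_itv/= => tx.
  by apply: bz; rewrite negb_and -!leNgt (le_trans tx).
have Fnd : {homo F : x y / x <= y}.
  move=> x y xy; have [c _ E] := MVT_dist x y dF.
  by rewrite -subr_ge0 E mulr_ge0// subr_ge0.
have F1 x : 1 <= x -> F x = F 1.
  move=> x1; apply/eqP; rewrite -subr_eq0.
  have cF : {within `[1, x], continuous F}.
    by apply: continuous_subspaceT; exact: smooth1_continuous0.
  have [c cx ->] := @MVT_segment R F b 1 x x1 (fun y _ => dF y) cF.
  rewrite bz ?mul0r//; move: cx; rewrite in_itv/= negb_and -!leNgt => /andP[-> _].
  by rewrite orbT.
have Fpos : 0 < F 1.
  have := @gtr0_derive1_lt_cc R F 0 1.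
  rewrite -[X in X < _](F0 0)//; apply; rewrite ?in_itv/= ?lexx ?ler01 ?ltr01//.
  - by move=> x; rewrite in_itv/= => x01; rewrite derive1E derive_val; exact: bp.
  - by apply: continuous_subspaceT; exact: smooth1_continuous0.
pose H x := (F 1)^-1 * F (1 * x + 0).
have H0 x : x <= 0 -> H x = 0 by move=> x0; rewrite /H mul1r addr0 (F0 x x0) mulr0.
have H1 x : 1 <= x -> H x = 1.
  by move=> x1; rewrite /H mul1r addr0 (F1 x x1) mulVf// gt_eqF.
have Hnd : {homo H : x y / x <= y}.
  by move=> x y xy; rewrite /H !mul1r !addr0 ler_pM2l ?invr_gt0//; exact: Fnd.
exists H; split=> //; first exact: smooth1_affine.
move=> t; apply/andP; split.
  have [t0|t0] := leP t 0; first by rewrite H0.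
  by rewrite -(H0 0)//; apply: Hnd; exact: ltW.
have [t1|t1] := leP 1 t; first by rewrite H1.
by rewrite -(H1 1)//; apply: Hnd; exact: ltW.
Qed.

Lemma smooth_prod n (I : Type) (r : seq I) (g_ : I -> 'rV[R]_n -> R) :
  (forall i, smooth (g_ i)) -> smooth (fun x => \prod_(i <- r) g_ i x).
Proof.
move=> sg; elim: r => [|i r IH].
  by under eq_fun do rewrite big_nil; exact: smooth_cst.
by under eq_fun do rewrite big_cons; exact: (smoothM (sg i) IH).
Qed.

(** The product over the coordinates of a one-dimensional plateau, itself the
    difference of two translated smooth steps; it is adapted to the cubes of the
    supremum norm. *)
Lemma exists_plateau n : exists chi : 'rV[R]_n -> R, [/\ test_function chi,
  forall x, 0 <= chi x <= 1, forall x, `|x| <= 1 -> chi x = 1 &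
  forall x, chi x != 0 -> `|x| <= 2].
Proof.
have [H [sH H0 H1 Hnd H01]] := exists_smooth_step.
pose q t := H (t + 2) - H (t - 1).
have sq : smooth1 q.
  have := smooth1B (smooth1_affine 1 2 1 sH) (smooth1_affine 1 (- 1) 1 sH).
  by congr smooth1; apply/funext => t; rewrite !mul1r.
have q01 t : 0 <= q t <= 1.
  rewrite subr_ge0 Hnd /=; last by lra.
  have /andP[_ h1] := H01 (t + 2); have /andP[h2 _] := H01 (t - 1).
  by rewrite /q; lra.
have q1 t : `|t| <= 1 -> q t = 1.
  by rewrite ler_norml => /andP[t1 t2]; rewrite /q H1 ?H0 ?subr0//; lra.
have q2 t : q t != 0 -> `|t| <= 2.
  apply: contraNT; rewrite -ltNge => t2; apply/eqP; rewrite /q.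
  have [t0|t0] := leP 0 t.
    by rewrite !H1 ?subrr//; move: t2; rewrite ger0_norm//; lra.
  by rewrite !H0 ?subrr//; move: t2; rewrite ltr0_norm//; lra.
pose chi (x : 'rV[R]_n) := \prod_(i < n) q (x ord0 i).
have chi2 x : chi x != 0 -> `|x| <= 2.
  move=> cx; apply/rV_norm_leP => // i; apply: q2; apply: contra cx => /eqP qx.
  by apply/eqP; rewrite /chi (bigD1 i)//= qx mul0r.
exists chi; split=> //.
- apply/test_functionP; split; last by exists 2.
  apply: (@smooth_prod _ _ _ (fun i (x : 'rV[R]_n) => q (x ord0 i))) => i.
  have := smooth_comp_dotr (delta_mx ord0 i : 'rV[R]_n) sq.
  congr smooth; apply/funext => x; congr q.
  rewrite /dotr (bigD1 i)//= mxE !eqxx mul1r big1 ?addr0// => j ji.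
  by rewrite mxE eqxx/= (negbTE ji) mul0r.
- move=> x; apply/andP; split.
    by apply: prodr_ge0 => i _; have /andP[] := q01 (x ord0 i).
  apply: (@le_trans _ _ (\prod_(i < n) 1)); last by rewrite big1.
  by apply: ler_prod => i _; exact: q01.
- move=> x x1; apply: big1 => i _; apply: q1; exact: le_trans (rV_norm_coord _ _) x1.
Qed.

Lemma measure_unit_cube n :
  lebesgue_rV R n [set x | `|x| <= 1] = (2 ^+ n)%:E.
Proof.
have -> : [set x : 'rV[R]_n | `|x| <= 1] =
    [set x | forall i, (`[- 1, 1]%classic : set R) (x ord0 i)].
  apply/seteqP; split=> x /=; rewrite (rV_norm_leP x ler01) => + i => /(_ i).
    by rewrite in_itv/= ler_norml.
  by rewrite in_itv/= ler_norml.
rewrite (@lebesgue_rV_box R n (fun=> `[- 1, 1]%classic))//.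
under eq_bigr do rewrite lebesgue_measure_itv/= lte_fin ifT ?gtrN//.
by rewrite -EFinD opprK prodEFin prodr_const card_ord.
Qed.

Lemma exists_mollifier n : exists rho : 'rV[R]_n -> R, test_function rho /\
  \int[lebesgue_rV R n]_x rho x = 1.
Proof.
have [chi [tchi chi01 chi1 _]] := exists_plateau n.
have I_gt0 : 0 < \int[lebesgue_rV R n]_x chi x.
  apply: (@lt_le_trans _ _ (\int[lebesgue_rV R n]_x (\1_[set x : 'rV[R]_n | `|x| <= 1] x : R))).
    rewrite /Rintegral integral_indic//; last exact: measurable_cube.
    rewrite setIT [X in fine X](_ : _ = (2 ^+ n)%:E)/= ?exprn_gt0//.
    exact: measure_unit_cube.
  apply: le_Rintegral => //.
  - exact: integrable_indic_cube.
  - exact: test_integrable.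
  - move=> x _; rewrite indicE; case: (boolP (x \in _)).
      by rewrite inE/= => /chi1 ->.
    by move=> _; have /andP[] := chi01 x.
exists (fun x => (\int[lebesgue_rV R n]_x chi x)^-1 * chi x).
split; first exact: testZ.
by rewrite RintegralZl ?mulVf ?gt_eqF//; exact: test_integrable.
Qed.

End bump.

(** * Averages over slanted discs *)

Lemma rowP0 (T : Type) n (u v : 'rV[T]_n) :
  (forall i, u ord0 i = v ord0 i) -> u = v.
Proof. by move=> uv; apply/rowP => i; have := uv i; congr (_ = _); congr fun_of_matrix; exact: ord1. Qed.

Section slanted_average.
Variables (R : realType) (m : nat) (tau : 'rV[R]_m).
Local Notation mu := (lebesgue_rV R m).
Local Notation e0 := (delta_mx ord0 ord0 : 'rV[R]_m.+1).

(** The hyperplanes xi . x = t are graphs over the last m coordinates, since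
    the first coordinate of xi is 1: [tangent] parametrizes the direction of these
    hyperplanes and [slice] the hyperplanes themselves by R^m. *)
Definition covector : 'rV[R]_m.+1 := rV_cons (1, tau).

Definition tangent (z : 'rV[R]_m) : 'rV[R]_m.+1 := rV_cons (- dotr tau z, z).

Definition slice (t : R) (y : 'rV[R]_m) : 'rV[R]_m.+1 :=
  rV_cons (t - dotr tau y, y).

Definition tail (x : 'rV[R]_m.+1) : 'rV[R]_m := \row_j x ord0 (lift ord0 j).

(** The derivative along the constant field delta_j - tau_j delta_0, which is
    tangent to the hyperplanes xi . x = t; it annihilates functions of xi . x. *)
Definition tang (j : 'I_m) (w : 'rV[R]_m.+1 -> R) (x : 'rV[R]_m.+1) : R :=
  partial (lift ord0 j) w x - tau ord0 j * partial ord0 w x.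

Lemma covector0 : covector ord0 ord0 = 1.
Proof. exact: rV_cons0. Qed.

Lemma covectorS j : covector ord0 (lift ord0 j) = tau ord0 j.
Proof. exact: rV_consS. Qed.

Lemma tangentD y z : tangent (y + z) = tangent y + tangent z.
Proof.
apply/rowP => i; rewrite [RHS]mxE; case: (unliftP ord0 i) => [j|] ->.
  by rewrite !rV_consS mxE.
by rewrite !rV_cons0 dotrD opprD.
Qed.

Lemma tangentZ c z : tangent (c *: z) = c *: tangent z.
Proof.
apply/rowP => i; rewrite [RHS]mxE; case: (unliftP ord0 i) => [j|] ->.
  by rewrite !rV_consS mxE.
by rewrite !rV_cons0 dotrZ mulrN.
Qed.

Lemma sum_tangent (z : 'rV[R]_m) (a : 'I_m.+1 -> R) :
  \sum_i tangent z ord0 i * a i =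
  \sum_j z ord0 j * (a (lift ord0 j) - tau ord0 j * a ord0).
Proof.
rewrite big_ord_recl rV_cons0 mulNr /dotr mulr_suml -sumrN -big_split/=.
by apply: eq_bigr => j _; rewrite rV_consS; ring.
Qed.

Lemma dotr_covector x : dotr covector x = x ord0 ord0 + dotr tau (tail x).
Proof.
rewrite /dotr big_ord_recl covector0 mul1r; congr (_ + _).
by apply: eq_bigr => j _; rewrite covectorS mxE.
Qed.

Lemma dotr_covector_slice t y : dotr covector (slice t y) = t.
Proof.
rewrite dotr_covector rV_cons0 (_ : tail _ = y) ?subrK//.
by apply/rowP => j; rewrite mxE rV_consS.
Qed.

Variable eps : R.

(** As z runs over the unit ball, x + trans s z runs over a disc of radius
    comparable to eps + s in the hyperplane at depth s below x. The radius grows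
    linearly with s so that a derivative of the kernel costs exactly 1/(eps + s);
    it starts at eps to keep that factor bounded. *)
Definition trans (s : R) (z : 'rV[R]_m) : 'rV[R]_m.+1 :=
  - (s *: e0) - (eps + s) *: tangent z.

Lemma transD s y z : trans s (y + z) = trans s y - (eps + s) *: tangent z.
Proof. by rewrite /trans tangentD scalerDr opprD addrA. Qed.

Lemma trans_lin s t z :
  trans (t + s) z = trans s z + t *: (- (e0 + tangent z)).
Proof.
rewrite /trans scalerN scalerDr addrA !scalerDl; rewrite !opprD.
apply/rowP => i; rewrite !mxE; ring.
Qed.

Lemma transE s z i :
  trans s z ord0 i = - (s *: e0) ord0 i - (eps + s) * tangent z ord0 i.
Proof.
by rewrite /trans !mxE.
Qed.

Lemma trans0 s z : trans s z ord0 ord0 = - s + (eps + s) * dotr tau z.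
Proof. by rewrite transE rV_cons0 mulrN opprK !mxE !eqxx mulr1. Qed.

Lemma transS s z j : trans s z ord0 (lift ord0 j) = - (eps + s) * z ord0 j.
Proof. by rewrite transE rV_consS !mxE eqxx/= mulr0 oppr0 add0r mulNr. Qed.

Lemma add_trans x s z :
  x + trans s z = slice (dotr covector x - s) (tail x - (eps + s) *: z).
Proof.
apply/rowP0 => i; rewrite [LHS]mxE; case: (unliftP ord0 i) => [j|] ->.
  by rewrite transS [RHS]rV_consS !mxE mulNr.
rewrite trans0 [RHS]rV_cons0 dotr_covector -scaleNr dotrD dotrZ/=; ring.
Qed.

Lemma dotr_covector_trans x s z : dotr covector (x + trans s z) = dotr covector x - s.
Proof. by rewrite add_trans dotr_covector_slice. Qed.

Lemma tangent_bound : exists2 K : R, 0 <= K & forall z, `|tangent z| <= K * `|z|.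
Proof.
exists (1 + \sum_j `|tau ord0 j|); first by rewrite addr_ge0// sumr_ge0.
move=> z; apply/rV_norm_leP => [|i].
  by rewrite mulr_ge0// addr_ge0// sumr_ge0.
case: (unliftP ord0 i) => [j|] ->.
  rewrite rV_consS (le_trans (rV_norm_coord _ _))// mulrDl mul1r lerDl.
  by rewrite mulr_ge0// sumr_ge0.
rewrite rV_cons0 normrN mulrDl (le_trans (ler_norm_sum _ _ _))//.
rewrite mulr_suml (@le_trans _ _ (\sum_j `|tau ord0 j| * `|z|))//; last first.
  by rewrite lerDr mul1r.
by apply: ler_sum => j _; rewrite normrM ler_wpM2l// rV_norm_coord.
Qed.

Lemma continuous_comp_trans (w : 'rV[R]_m.+1 -> R) x s :
  continuous w -> continuous (fun z => w (x + trans s z)).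
Proof.
move=> cw z; apply/(@cvgrPdist_lt _ _ _ (nbhs z)) => e e0_.
have /(@cvgrPdist_lt _ _ _ (nbhs _)) /(_ _ e0_) /nbhs_ballP[d /= d0 wd] := cw (x + trans s z).
have [K K0 tK] := tangent_bound.
have K1 : 0 < `|eps + s| * K + 1 by rewrite ltr_wpDl// mulr_ge0.
apply/nbhs_ballP; exists (d / (`|eps + s| * K + 1)) => /=; first exact: divr_gt0.
move=> y; rewrite mx_norm_ball /ball_/= ltr_pdivlMr// => zy.
apply: wd; rewrite mx_norm_ball /ball_/=.
have -> : x + trans s z - (x + trans s y) = (eps + s) *: tangent (y - z).
  rewrite -[y in LHS](subrK z) [y - z + z]addrC transD.
  by rewrite opprD addrACA subrr add0r opprB addrC subrK.
apply: le_lt_trans zy; rewrite normrZ (distrC z) mulrDr mulr1.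
rewrite (@le_trans _ _ (`|y - z| * (`|eps + s| * K)))// ?lerDl//.
by rewrite mulrCA ler_wpM2l// mulrC.
Qed.

Lemma smooth_tang j w : smooth w -> smooth (tang j w).
Proof.
move=> sw; rewrite (_ : tang j w = fun x => partial (lift ord0 j) w x +
    (- tau ord0 j) * partial ord0 w x).
  apply: (smoothD (smooth_partial _ sw)); apply: smoothZ.
  exact: (smooth_partial _ sw).
by apply/funext => x; rewrite mulNr.
Qed.

Lemma test_tang j w : test_function w -> test_function (tang j w).
Proof.
move=> tw; rewrite (_ : tang j w = fun x => partial (lift ord0 j) w x +
    (- tau ord0 j) * partial ord0 w x).
  apply: (testD (test_partial _ tw)); apply: testZ.
  exact: (test_partial _ tw).
by apply/funext => x; rewrite mulNr.
Qed.

Lemma is_derive_comp_trans (w : 'rV[R]_m.+1 -> R) x s j z : smooth w ->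
  is_derive z (delta_mx ord0 j) (fun z => w (x + trans s z))
    (- (eps + s) * tang j w (x + trans s z)).
Proof.
move=> sw.
have := C1_is_derive (x + trans s z) (- (eps + s) *: tangent (delta_mx ord0 j))
  (smooth_C1 sw).
rewrite (_ : \sum_i _ = - (eps + s) * tang j w (x + trans s z)); last first.
  under eq_bigr do rewrite mxE -mulrA.
  rewrite -mulr_sumr (sum_tangent _ (fun i => partial i w (x + trans s z))).
  rewrite (bigD1 j)//= mxE !eqxx mul1r big1 ?addr0// => l lj.
  by rewrite mxE (negbTE lj) andbF mul0r.
move=> /is_deriveP H; apply/is_deriveP; move: H.
apply: cvg_trans; apply: near_eq_cvg; near=> h.
congr (_ *: (w _ - _)); rewrite [h *: _ + z]addrC transD tangentZ.
rewrite addrC -addrA; congr (_ + (_ + _)).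
by rewrite scaleNr scalerN !scalerA mulrC.
Unshelve. all: end_near. Qed.

Lemma smooth_comp_trans (w : 'rV[R]_m.+1 -> R) x s : smooth w ->
  smooth (fun z => w (x + trans s z)).
Proof.
move=> sw; apply: (@smooth_coind _ _ (fun g => exists2 w, smooth w &
  g = fun z => w (x + trans s z))); last by exists w.
move=> _ [{sw}w sw ->]; split.
  by apply: continuous_comp_trans; exact: smooth_continuous.
move=> j; exists (fun z => - (eps + s) * tang j w (x + trans s z)).
  exists (fun y => - (eps + s) * tang j w y); last by [].
  by apply: smoothZ; exact: smooth_tang.
by move=> z; exact: is_derive_comp_trans.
Qed.

Definition avg (kap : 'rV[R]_m -> R) (w : 'rV[R]_m.+1 -> R) (x : 'rV[R]_m.+1) (s : R) : R :=
  \int[mu]_z (kap z * w (x + trans s z)).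

Section avg_theory.
Implicit Types (kap : 'rV[R]_m -> R) (w : 'rV[R]_m.+1 -> R) (x : 'rV[R]_m.+1) (s : R).

Lemma avg_test kap w x s : test_function kap -> smooth w ->
  test_function (fun z => kap z * w (x + trans s z)).
Proof. by move=> tk sw; apply: testM => //; exact: smooth_comp_trans. Qed.

Lemma avg_integrable kap w x s : test_function kap -> smooth w ->
  mu.-integrable setT (EFin \o (fun z => kap z * w (x + trans s z))).
Proof. by move=> tk sw; apply: test_integrable; exact: avg_test. Qed.

Lemma avgZl c kap w x s : test_function kap -> smooth w ->
  avg (fun z => c * kap z) w x s = c * avg kap w x s.
Proof.
move=> tk sw; rewrite /avg -RintegralZl//; last exact: avg_integrable.
by apply: eq_Rintegral => z _; rewrite mulrA.
Qed.

Lemma avgDl kap1 kap2 w x s : test_function kap1 -> test_function kap2 -> smooth w ->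
  avg (fun z => kap1 z + kap2 z) w x s = avg kap1 w x s + avg kap2 w x s.
Proof.
move=> tk1 tk2 sw; rewrite /avg -RintegralD//; [|exact: avg_integrable..].
by apply: eq_Rintegral => z _; rewrite mulrDl.
Qed.

Lemma avgDr kap w1 w2 x s : test_function kap -> smooth w1 -> smooth w2 ->
  avg kap (fun y => w1 y + w2 y) x s = avg kap w1 x s + avg kap w2 x s.
Proof.
move=> tk sw1 sw2; rewrite /avg -RintegralD//; [|exact: avg_integrable..].
by apply: eq_Rintegral => z _; rewrite mulrDr.
Qed.

Lemma avgZr c kap w x s : test_function kap -> smooth w ->
  avg kap (fun y => c * w y) x s = c * avg kap w x s.
Proof.
move=> tk sw; rewrite /avg -RintegralZl//; last exact: avg_integrable.
by apply: eq_Rintegral => z _; rewrite mulrCA.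
Qed.

Lemma avg_suml (I : Type) (r : seq I) (K : I -> 'rV[R]_m -> R) w x s :
  (forall i, test_function (K i)) -> smooth w ->
  avg (fun z => \sum_(i <- r) K i z) w x s = \sum_(i <- r) avg (K i) w x s.
Proof.
move=> tK sw; elim: r => [|i r IH].
  rewrite big_nil /avg; under eq_Rintegral do rewrite big_nil mul0r.
  by rewrite Rintegral_cst// mul0r.
rewrite big_cons -IH -avgDl//.
  by apply: eq_Rintegral => z _; rewrite big_cons.
exact: (test_sum r xpredT tK).
Qed.

Definition divergence (K : 'I_m -> 'rV[R]_m -> R) (z : 'rV[R]_m) : R :=
  \sum_j partial j (K j) z.

Lemma test_divergence K : (forall j, test_function (K j)) -> test_function (divergence K).
Proof.
by move=> tK; apply: (test_sum (index_enum _) xpredT) => j; exact: (test_partial j (tK j)).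
Qed.

(** Integration by parts in z moves a derivative between the kernel and the
    function at the price of the radius of the disc. *)
Lemma avg_tang kap w j x s : test_function kap -> smooth w ->
  avg (partial j kap) w x s = (eps + s) * avg kap (tang j w) x s.
Proof.
move=> tk sw; rewrite /avg integration_by_parts_rV//; last exact: smooth_comp_trans.
rewrite -RintegralZl; [|exact: measurableT|
  exact: (avg_integrable _ _ tk (smooth_tang j sw))].
rewrite -[LHS]mulN1r -RintegralZl//; last first.
  apply: test_integrable; apply: testM => //.
  by apply: smooth_partial; exact: smooth_comp_trans.
apply: eq_Rintegral => z _.
by rewrite (partialE (is_derive_comp_trans _ _ _ _ sw)); ring.
Qed.

Lemma avg_divergence K w x s : (forall j, test_function (K j)) -> smooth w ->
  avg (divergence K) w x s = (eps + s) * \sum_j avg (K j) (tang j w) x s.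
Proof.
move=> tK sw; rewrite [LHS]avg_suml//; last by move=> j; exact: (test_partial j (tK j)).
by rewrite mulr_sumr; apply: eq_bigr => j _; rewrite avg_tang.
Qed.

(** The depth derivative of the average: x + trans s z moves with velocity
    - (e0 + tangent z). *)
Definition avg_slope kap w x s : R := - avg kap (partial ord0 w) x s
  - \sum_j avg (fun z => z ord0 j * kap z) (tang j w) x s.

Lemma test_coordM kap j : test_function kap ->
  test_function (fun z : 'rV[R]_m => z ord0 j * kap z).
Proof. by move=> tk; apply: testMl => //; exact: smooth_coord. Qed.

Lemma is_derive_avg kap w x s : test_function kap -> test_function w ->
  is_derive s 1 (avg kap w x) (avg_slope kap w x s).
Proof.
move=> tk tw; have sw := test_smooth tw.
have [K K0 kK] := test_bounded tw.
have [K' K'0 kK'] := test_bounded (test_partial ord0 tw).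
have /choice[KT kKT] j : exists C, forall x, `|tang j w x| <= C.
  by have [C _ tC] := test_bounded (test_tang j tw); exists C.
pose dfz (s : R) z := kap z * (- partial ord0 w (x + trans s z)) -
   \sum_j z ord0 j * kap z * tang j w (x + trans s z).
have -> : avg_slope kap w x s = \int[mu]_z dfz s z.
  rewrite /avg_slope -[X in X - _]mulN1r -avgZr//; last exact: (smooth_partial _ sw).
  rewrite -Rintegral_sum; last 2 first.
  - exact: measurableT.
  - by move=> j; exact: (avg_integrable _ _ (test_coordM j tk) (smooth_tang j sw)).
  rewrite -RintegralB; last 3 first.
  - exact: measurableT.
  - exact: (avg_integrable _ _ tk (smoothZ (-1) (smooth_partial ord0 sw))).
  - apply: test_integrable; apply: test_sum => j.
    exact: (avg_test _ _ (test_coordM j tk) (smooth_tang j sw)).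
  by apply: eq_Rintegral => z _; rewrite mulN1r.
pose k0 z := `|kap z| * K.
pose k1 z := `|kap z| * K' + \sum_j `|z ord0 j * kap z| * KT j.
have ikn (g : 'rV[R]_m -> R) C : test_function g ->
    mu.-integrable setT (EFin \o (fun z => `|g z| * C)).
  move=> tg; exact: (integrable_EFinZr measurableT C (integrable_norm (test_integrable tg))).
apply: (@derive_under_integral _ _ _ mu setT measurableT
  (fun s z => kap z * w (x + trans s z)) dfz k0 k1).
- move=> t z _.
  rewrite (_ : dfz t z = kap z *: (- (partial ord0 w (x + trans t z) +
      \sum_j z ord0 j * tang j w (x + trans t z)))); last first.
    rewrite /dfz /GRing.scale/= opprD mulrDr; congr (_ + _).
    rewrite mulrN mulr_sumr; congr (- _); apply: eq_bigr => j _.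
    by rewrite mulrA [z ord0 j * _]mulrC.
  apply: (@is_deriveZ _ _ _ (fun t : R => w (x + trans t z))).
  have lin (u : R) : x + trans u z = (x + trans 0 z) + u *: (- (e0 + tangent z)).
    by rewrite -[u in LHS]addr0 trans_lin addrA.
  under eq_fun do rewrite lin.
  have := C1_is_derive_line (x + trans 0 z) (- (e0 + tangent z)) t (smooth_C1 sw).
  rewrite -lin; congr is_derive.
  under eq_bigr do rewrite mxE mulNr mxE mulrDl.
  rewrite sumrN big_split/= (sum_tangent z (fun i => partial i w (x + trans t z))).
  congr (- (_ + _)); rewrite (bigD1 ord0)//= mxE !eqxx mul1r big1 ?addr0// => i i0.
  by rewrite mxE (negbTE i0) andbF mul0r.
- by move=> t; exact: (test_measurable (avg_test x t tk sw)).
- exact: ikn.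
- apply: integrable_EFinD => //; first exact: ikn.
  apply: integrable_EFin_sum => // j; apply: (ikn (fun z => z ord0 j * kap z)).
  exact: test_coordM.
- by move=> t z _ _; rewrite /k0 normrM ler_wpM2l.
- move=> t z _ _; rewrite /k1 /dfz mulrN.
  rewrite (le_trans (ler_normB _ _))// normrN normrM lerD ?ler_wpM2l//.
  rewrite (le_trans (ler_norm_sum _ _ _))//; apply: ler_sum => j _.
  by rewrite normrM ler_wpM2l.
Qed.

Lemma avg_continuous kap w x : test_function kap -> test_function w ->
  continuous (avg kap w x).
Proof.
move=> tk tw s; apply: differentiable_continuous; apply/derivable1_diffP.
by have [] := is_derive_avg x s tk tw.
Qed.

Lemma avg_slope_continuous kap w x : test_function kap -> test_function w ->
  continuous (avg_slope kap w x).
Proof.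
move=> tk tw s; apply: (@continuousB _ _ _ (fun s => - avg kap (partial ord0 w) x s)
  (fun s => \sum_j avg (fun z => z ord0 j * kap z) (tang j w) x s)).
  apply: (@continuousN _ _ _ (avg kap (partial ord0 w) x)).
  by apply: avg_continuous => //; exact: (test_partial ord0 tw).
rewrite (_ : (fun s => _) =
    \sum_j avg (fun z : 'rV_m => z ord0 j * kap z) (tang j w) x); last first.
  by apply/funext => t; rewrite fct_sumE.
elim/big_ind : _ => [|f g cf cg|j _].
- exact: cst_continuous.
- exact: continuousD.
- apply: avg_continuous.
    exact: (test_coordM j tk).
  exact: (test_tang j tw).
Qed.

(** The decomposition of the direction i along - (e0 + tangent z), the
    velocity in s, and along the hyperplane: the coefficients of the tangential
    part, times kap. *)
Definition kernel_field (i : 'I_m.+1) kap (j : 'I_m) (z : 'rV[R]_m) : R :=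
  (i == lift ord0 j)%:R * kap z - covector ord0 i * (z ord0 j * kap z).

Lemma test_kernel_field i kap j : test_function kap ->
  test_function (kernel_field i kap j).
Proof.
move=> tk; rewrite (_ : kernel_field i kap j = fun z =>
  (i == lift ord0 j)%:R * kap z + (- covector ord0 i) * (z ord0 j * kap z)).
  by apply: (testD (testZ _ tk)); exact: (testZ _ (test_coordM j tk)).
by apply/funext => z; rewrite /kernel_field mulNr.
Qed.

Lemma avg_partial i kap w x s : test_function kap -> test_function w ->
  avg kap (partial i w) x s = - (covector ord0 i * avg_slope kap w x s) +
    \sum_j avg (kernel_field i kap j) (tang j w) x s.
Proof.
move=> tk tw; have sw := test_smooth tw.
under eq_bigr => j _.
  rewrite (_ : kernel_field i kap j = fun z => (i == lift ord0 j)%:R * kap z +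
      (- covector ord0 i) * (z ord0 j * kap z)); last first.
    by apply/funext => z; rewrite /kernel_field mulNr.
  rewrite avgDl; [|exact: (testZ _ tk)|exact: (testZ _ (test_coordM j tk))|
    exact: (smooth_tang j sw)].
  rewrite avgZl; [|exact: tk|exact: (smooth_tang j sw)].
  rewrite avgZl; [|exact: (test_coordM j tk)|exact: (smooth_tang j sw)].
  over.
rewrite big_split/= -mulr_sumr.
set S := (X in - covector ord0 i * X).
have -> : - (covector ord0 i * avg_slope kap w x s) =
    covector ord0 i * avg kap (partial ord0 w) x s + covector ord0 i * S.
  by rewrite /avg_slope -/S; ring.
rewrite addrACA mulNr subrr addr0.
case: (unliftP ord0 i) => [l|] ->.
  rewrite covectorS (bigD1 l)//= eqxx mul1r big1 => [|j jl]; last first.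
    by rewrite (inj_eq (lift_inj)) eq_sym (negbTE jl) mul0r.
  rewrite addr0 -avgZr; [|exact: tk|exact: (smooth_partial _ sw)].
  rewrite -avgDr; [|exact: tk|exact: (smoothZ _ (smooth_partial _ sw))|
    exact: (smooth_tang l sw)].
  apply: eq_Rintegral => z _; congr (_ * _).
  by rewrite /tang [RHS]addrC subrK.
rewrite covector0 mul1r big1 ?addr0// => j _.
by rewrite (negbTE (neq_lift _ _)) mul0r.
Qed.

(** A full derivative of w is traded for the depth derivative of the average,
    which can be integrated by parts against a weight in s, and for tangential
    derivatives, which can be put on the kernel. *)
Lemma avg_partial_divergence i kap w x s :
  eps + s != 0 -> test_function kap -> test_function w ->
  avg kap (partial i w) x s = - (covector ord0 i * avg_slope kap w x s) +
    (eps + s)^-1 * avg (divergence (kernel_field i kap)) w x s.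
Proof.
move=> e0_ tk tw; rewrite avg_partial//; congr (_ + _).
rewrite avg_divergence; last 2 first.
- by move=> j; exact: test_kernel_field.
- exact: test_smooth.
by rewrite mulrA mulVf// mul1r.
Qed.

Lemma avg_le (K : R) kap w x s : test_function kap -> smooth w ->
  (forall z, `|w (x + trans s z)| <= K) ->
  `|avg kap w x s| <= \int[mu]_z `|kap z| * K.
Proof.
move=> tk sw wK; have it := avg_integrable x s tk sw.
rewrite (le_trans (le_normr_Rintegral _ it))// -RintegralZr//; last first.
  exact: integrable_norm (test_integrable tk).
apply: le_Rintegral => //; first exact: integrable_norm it.
- exact: (integrable_EFinZr measurableT K (integrable_norm (test_integrable tk))).
- by move=> z _; rewrite normrM ler_wpM2l.
Qed.

Lemma smooth_avg kap w s : test_function kap -> test_function w ->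
  smooth (fun x => avg kap w x s) /\
  forall r x, iter_partial r (fun x => avg kap w x s) x = avg kap (iter_partial r w) x s.
Proof.
move=> tk tw; have sw := test_smooth tw.
have E r z x : iter_partial r (fun x => kap z * w (x + trans s z)) x =
    kap z * iter_partial r w (x + trans s z).
  rewrite iter_partialZ; last exact: (smooth_shift _ sw).1.
  by rewrite (smooth_shift _ sw).2.
have [|||sI EI] := @smooth_integral R m.+1 _ _ mu setT measurableT
    (fun z x => kap z * w (x + trans s z)).
- by move=> z; apply: smoothZ; exact: (smooth_shift _ sw).1.
- move=> r x; under eq_fun do rewrite E.
  exact: (test_measurable (avg_test x s tk (test_smooth (test_iter_partial r tw)))).
- move=> r; have [K K0 rK] := test_bounded (test_iter_partial r tw).
  exists (fun z => `|kap z| * K).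
    exact: (integrable_EFinZr measurableT K (integrable_norm (test_integrable tk))).
  by move=> z x _; rewrite E normrM ler_wpM2l.
split=> // r x; rewrite EI.
by apply: eq_Rintegral => z _; rewrite E.
Qed.

End avg_theory.
End slanted_average.

Section slice_energy.
Variables (R : realType) (m : nat) (tau : 'rV[R]_m).
Local Notation mu := (lebesgue_rV R m).

(** The n-th power of the L^n norm on the slice, where n = m + 1 is the
    dimension of the whole space and exceeds that of the slice. *)
Definition energy (w : 'rV[R]_m.+1 -> R) (t : R) : R :=
  \int[mu]_y (`|w (slice tau t y)| ^+ m.+1).

Lemma slice_trans t y : slice tau t y = t *: delta_mx ord0 ord0 + trans tau (-1) 0 y.
Proof.
rewrite add_trans addr0 subr0 scaleN1r opprK; congr slice.
  rewrite dotrZ dotr_delta covector0 mulr1//.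
by apply/rowP => j; rewrite !mxE eqxx/= mulr0 add0r.
Qed.

Lemma energy_integrand_continuous w t : test_function w ->
  continuous (fun y => `|w (slice tau t y)| ^+ m.+1).
Proof.
move=> tw; have cw : continuous (fun y => w (slice tau t y)).
  under eq_fun do rewrite slice_trans.
  by apply: continuous_comp_trans; exact: test_continuous.
have cn : continuous (fun y => `|w (slice tau t y)|).
  move=> y; apply: (@continuous_comp 'rV[R]_m R R (fun y => w (slice tau t y))).
    exact: cw.
  exact: norm_continuous.
elim: m.+1 => [|k IH]; first by under eq_fun do rewrite expr0; exact: cst_continuous.
under eq_fun do rewrite exprS.
exact: continuous_rVM.
Qed.

Lemma norm_slice_ge t y : `|y| <= `|slice tau t y|.
Proof.
apply/rV_norm_leP => // j; rewrite (le_trans _ (rV_norm_coord _ (lift ord0 j)))//.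
by rewrite rV_consS.
Qed.

Lemma energy_integrand_bounded_support w t : test_function w ->
  bounded_support (fun y => `|w (slice tau t y)| ^+ m.+1).
Proof.
move=> /test_bounded_support[B B0 wB]; exists B => // y.
rewrite expf_eq0/= normr_eq0 => H; rewrite (le_trans (norm_slice_ge t y))//.
exact: wB.
Qed.

Lemma energy_integrable w t : test_function w ->
  mu.-integrable setT (EFin \o (fun y => `|w (slice tau t y)| ^+ m.+1)).
Proof.
move=> tw; apply: integrable_continuous_bounded_support.
  exact: energy_integrand_continuous.
exact: energy_integrand_bounded_support.
Qed.

Lemma energy_ge0 w t : 0 <= energy w t.
Proof. by apply: Rintegral_ge0 => y _; rewrite exprn_ge0. Qed.

(** The disc at depth s is a copy of R^m scaled by eps + s. *)
Lemma integral_trans_energy w (eps s : R) x : test_function w -> 0 < eps + s ->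
  mu.-integrable setT (EFin \o (fun z => `|w (x + trans tau eps s z)| ^+ m.+1)) /\
  \int[mu]_z (`|w (x + trans tau eps s z)| ^+ m.+1) =
  (eps + s) ^- m * energy w (dotr (covector tau) x - s).
Proof.
move=> tw es0; set t := dotr _ x - s.
pose h y := `|w (slice tau t y)| ^+ m.+1.
have ih : mu.-integrable setT (EFin \o h) by exact: energy_integrable.
have h0 y : (0 <= (h y)%:E)%E by rewrite lee_fin /h exprn_ge0.
have mh : measurable_fun setT (EFin \o h) by exact: measurable_int ih.
have E z : `|w (x + trans tau eps s z)| ^+ m.+1 = h (tail x + (- (eps + s)) *: z).
  by rewrite add_trans scaleNr.
have c0 : - (eps + s) != 0 by rewrite oppr_eq0 gt_eqF.
have I := ge0_integral_affine (tail x) c0 mh h0.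
rewrite normrN gtr0_norm// in I.
have hE : (\int[mu]_y (EFin \o h) y = (energy w t)%:E)%E.
  rewrite /energy /Rintegral fineK//.
  exact: (integrable_fin_num _ ih).
rewrite hE in I.
split; last by rewrite /Rintegral; under eq_integral do rewrite E; rewrite I.
apply/integrableP; split.
  under eq_fun do rewrite /= E.
  by apply: (measurableT_comp mh); exact: measurable_rV_affine.
under eq_integral do rewrite /= E ger0_norm ?exprn_ge0//.
rewrite I; exact: ltry.
Qed.

(** This replaces the Hoelder inequality: integrated with th chosen so that
    the two terms balance, it bounds an L^1 norm on the kernel support by an L^n norm. *)
Lemma young_threshold (a th : R) : 0 <= a -> 0 < th -> a <= th + th ^- m * a ^+ m.+1.
Proof.
move=> a0 th0; have [ath|tha] := leP a th.
  by rewrite (le_trans ath)// lerDl mulr_ge0// ?exprn_ge0// invr_ge0 exprn_ge0// ltW.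
rewrite ler_wpDl ?(ltW th0)// mulrC ler_pdivlMr ?exprn_gt0//.
by rewrite exprS ler_wpM2l// lerXn2r// ?nnegrE// ltW.
Qed.

(** By the Hoelder inequality the average over a disc of radius eps + s is at most
    (eps + s)^(- m / n) times the L^n norm on the slice; with eps = om^n the power is
    at most om^-m. The parameter om avoids fractional exponents. *)
Lemma avg_le_energy kap : test_function kap -> exists2 C : R, 0 <= C &
  forall (w : 'rV[R]_m.+1 -> R) (x : 'rV[R]_m.+1) (s om nu : R),
  test_function w -> 0 < om -> 0 < nu -> 0 <= s ->
  energy w (dotr (covector tau) x - s) <= nu ^+ m.+1 ->
  `|avg tau (om ^+ m.+1) kap w x s| <= C * (om ^- m * nu).
Proof.
move=> tk; have [K K0 kK] := test_bounded tk.
have ik := integrable_norm (test_integrable tk).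
exists (\int[mu]_z `|kap z| + K).
  by rewrite addr_ge0// Rintegral_ge0.
move=> w x s om nu tw om0 nu0 s0 wnu.
set eps := om ^+ m.+1; have eps0 : 0 < eps by rewrite exprn_gt0.
have es0 : 0 < eps + s by rewrite ltr_pwDl.
(* The value om^-m nu is the expected size of the average. *)
set th := om ^- m * nu; have th0 : 0 < th by rewrite mulr_gt0// invr_gt0 exprn_gt0.
have [iv vE] := integral_trans_energy x tw es0.
have it := avg_integrable tau eps x s tk (test_smooth tw).
rewrite (le_trans (le_normr_Rintegral _ it))//.
have ikt : mu.-integrable setT (EFin \o (fun z => th * `|kap z|)).
  exact: (integrable_EFinZl measurableT th ik).
pose v z := `|w (x + trans tau eps s z)| ^+ m.+1.
have ivt : mu.-integrable setT (EFin \o (fun z => (K * th ^- m) * v z)).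
  exact: (integrable_EFinZl measurableT (K * th ^- m) iv).
have -> : (\int[mu]_z `|kap z| + K) * th = th * (\int[mu]_z `|kap z|) + K * th.
  by ring.
apply: (@le_trans _ _ (\int[mu]_z (th * `|kap z| + (K * th ^- m) * v z))).
  apply: le_Rintegral => //.
  - exact: integrable_norm it.
  - exact: (integrable_EFinD measurableT ikt ivt).
  move=> z _; rewrite normrM.
  apply: le_trans (ler_wpM2l (normr_ge0 _) (young_threshold (normr_ge0 _) th0)) _.
  rewrite mulrDr [_ * th]mulrC lerD2l mulrA /v ler_wpM2r// ?exprn_ge0//.
  by rewrite ler_wpM2r// invr_ge0 exprn_ge0// ltW.
rewrite RintegralD// !RintegralZl// lerD2l -mulrA ler_wpM2l//.
rewrite ler_pdivrMl ?exprn_gt0// -exprSr vE.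
apply: (@le_trans _ _ ((eps + s) ^- m * nu ^+ m.+1)).
  by rewrite ler_wpM2l// invr_ge0 exprn_ge0// ltW.
rewrite /th exprMn ler_wpM2r ?exprn_ge0 ?(ltW nu0)//.
rewrite -[om ^- m]exprVn -exprM -[(eps + s) ^- m]exprVn; apply: (@le_trans _ _ (eps^-1 ^+ m)).
  rewrite lerXn2r ?nnegrE ?invr_ge0 ?(ltW es0) ?(ltW eps0)//.
  by rewrite lef_pV2 ?posrE// lerDl.
by rewrite /eps -exprVn -exprM mulnC.
Qed.

(** Shrink the disc at depth 0 to a point, with radius r^n for r in [0, om]. The
    derivative in r is n r^m times averages of tangential derivatives, each at most
    C r^-m nu: the powers of r cancel and the increment is at most C om nu. *)
Lemma avg0_approx rho : test_function rho -> \int[mu]_z rho z = 1 ->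
  exists2 C : R, 0 <= C &
  forall (w : 'rV[R]_m.+1 -> R) (x : 'rV[R]_m.+1) (om nu : R),
  test_function w -> 0 < om -> 0 < nu ->
  (forall j, energy (tang tau j w) (dotr (covector tau) x) <= nu ^+ m.+1) ->
  `|avg tau (om ^+ m.+1) rho w x 0 - w x| <= C * (om * nu).
Proof.
move=> tr r1.
have /choice[C_ C_P] j : exists C : R, 0 <= C /\
    forall (w : 'rV[R]_m.+1 -> R) (x : 'rV[R]_m.+1) (s om nu : R),
    test_function w -> 0 < om -> 0 < nu -> 0 <= s ->
    energy w (dotr (covector tau) x - s) <= nu ^+ m.+1 ->
    `|avg tau (om ^+ m.+1) (fun z => z ord0 j * rho z) w x s| <= C * (om ^- m * nu).
  by have [C C0 CP] := avg_le_energy (test_coordM j tr); exists C.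
exists (m.+1%:R * \sum_j C_ j).
  by rewrite mulr_ge0// sumr_ge0// => j _; exact: (C_P j).1.
move=> w x om nu tw om0 nu0 wnu; have sw := test_smooth tw.
have [K K0 wK] := test_bounded tw.
have /choice[KT KTP] j : exists C : R, forall x, `|tang tau j w x| <= C.
  by have [C _ tC] := test_bounded (test_tang tau j tw); exists C.
(* The parameter of the disc is r = eps^(1/n), in which g is Lipschitz. *)
pose g (r : R) := avg tau (r ^+ m.+1) rho w x 0.
pose f (r : R) z := rho z * w (x + trans tau (r ^+ m.+1) 0 z).
pose df (r : R) (z : 'rV[R]_m) := (- (m.+1%:R * r ^+ m)) *
  \sum_j z ord0 j * rho z * tang tau j w (x + trans tau (r ^+ m.+1) 0 z).
have dg (r : R) : is_derive r 1 g (\int[mu]_z df r z).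
  pose k1 (z : 'rV[R]_m) := (m.+1%:R * (`|r| + 1) ^+ m) * \sum_j `|z ord0 j * rho z| * KT j.
  have ikn (h : 'rV[R]_m -> R) C : test_function h ->
      mu.-integrable setT (EFin \o (fun z => `|h z| * C)).
    move=> th; exact: (integrable_EFinZr measurableT C (integrable_norm (test_integrable th))).
  apply: (@derive_under_integral _ _ _ mu setT measurableT f df
    (fun z => `|rho z| * K) k1).
  - move=> t z _.
    have trE (u : R) : x + trans tau u 0 z = x + (- u) *: tangent tau z.
      by rewrite /trans scale0r oppr0 add0r addr0 scaleNr.
    rewrite (_ : df t z = rho z *: ((\sum_i tangent tau z ord0 i *
        partial i w (x + (- t ^+ m.+1) *: tangent tau z)) * (- (m.+1%:R * t ^+ m)))); last first.
      rewrite /df mulrC (sum_tangent _ _ (fun i => partial i w _)) -trE.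
      rewrite /GRing.scale/= mulrA mulr_sumr; congr (_ * _).
      by apply: eq_bigr => j _; rewrite /tang mulrA [rho z * _]mulrC.
    apply: (@is_deriveZ _ _ _ (fun t : R => w (x + trans tau (t ^+ m.+1) 0 z))).
    under eq_fun do rewrite trE.
    apply: (@is_derive1_comp _ (fun u : R => w (x + u *: tangent tau z))
      (fun t : R => - t ^+ m.+1)).
      exact: C1_is_derive_line (smooth_C1 sw).
    apply: is_deriveN; have := @is_deriveX _ _ (@id R) m.+1 t 1 1 (is_derive_id _ _).
    by rewrite /= [_ *: 1]mulr1 exprfctE.
  - by move=> t; exact: (test_measurable (avg_test tau _ x 0 tr sw)).
  - exact: ikn.
  - apply: integrable_EFinZl => //; apply: integrable_EFin_sum => // j.
    by apply: (ikn (fun z => z ord0 j * rho z)); exact: test_coordM.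
  - by move=> t z _ _; rewrite /f normrM ler_wpM2l.
  - move=> t z tr1 _; rewrite /df /k1 normrM; apply: ler_pM => //.
      rewrite normrN normrM normr_nat ler_wpM2l// normrX lerXn2r ?nnegrE ?addr_ge0//.
      by have := ler_normD (t - r) r; rewrite subrK; lra.
    rewrite (le_trans (ler_norm_sum _ _ _))//; apply: ler_sum => j _.
    by rewrite normrM ler_wpM2l.
have g0 : g 0 = w x.
  rewrite /g /avg -[RHS]mul1r -r1 -RintegralZr//; last exact: test_integrable.
  apply: eq_Rintegral => z _; congr (_ * w _).
  by rewrite /trans expr0n/= addr0 !scale0r subr0 oppr0 addr0.
have cg : {within `[0, om], continuous g}.
  apply: continuous_subspaceT => r; apply: differentiable_continuous.
  by apply/derivable1_diffP; have [] := dg r.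
have [c + E] := @MVT R g (fun r => \int[mu]_z df r z) 0 om om0 (fun r _ => dg r) cg.
rewrite in_itv/= => /andP[c0 _].
rewrite -/(g om) -g0 E subr0 normrM (gtr0_norm om0) mulrCA mulrC ler_wpM2l ?(ltW om0)//.
have -> : \int[mu]_z df c z = - (m.+1%:R * c ^+ m) *
    \sum_j avg tau (c ^+ m.+1) (fun z => z ord0 j * rho z) (tang tau j w) x 0.
  rewrite -Rintegral_sum; last 2 first.
  - exact: measurableT.
  - by move=> j; exact: (avg_integrable tau _ _ _ (test_coordM j tr) (smooth_tang tau j sw)).
  rewrite -RintegralZl//; apply: test_integrable; apply: test_sum => j.
  exact: (avg_test tau _ _ _ (test_coordM j tr) (smooth_tang tau j sw)).
rewrite normrM normrN normrM normr_nat -!mulrA ler_wpM2l//.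
rewrite -ler_pdivlMl ?normr_gt0 ?expf_neq0 ?gt_eqF//.
rewrite (le_trans (ler_norm_sum _ _ _))// mulr_suml mulr_sumr.
apply: ler_sum => j _; rewrite ger0_norm ?exprn_ge0 ?(ltW c0)// mulrCA.
by apply: (C_P j).2 => //; [exact: (test_tang tau j tw)|rewrite subr0; exact: wnu].
Qed.

End slice_energy.

(** * Weights and integration by parts in the depth *)

Section weights.
Variables (R : realType) (eps La : R).
Hypotheses (eps0 : 0 < eps) (La0 : 0 < La).
Local Notation leb := (@lebesgue_measure R).

(** A family closed under d/ds and under division by eps + s. The zero of order
    d at La removes the boundary terms there, and for
    a = b + q the weight is at most 1 on [0, La]. *)
Definition weight (a b d q : nat) (s : R) : R :=
  s ^+ a * (eps + s) ^- b * (1 - s / La) ^+ d * La ^- q.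

Definition dweight (a b d q : nat) (s : R) : R :=
  a%:R * weight a.-1 b d q s - b%:R * weight a b.+1 d q s
  - d%:R * weight a b d.-1 q.+1 s.

Lemma is_derive_exprn (f : R -> R) (df s : R) k : is_derive s 1 f df ->
  is_derive s 1 (fun s => f s ^+ k) (k%:R * f s ^+ k.-1 * df).
Proof.
move=> dfs; have := @is_deriveX _ _ f k s 1 df dfs.
by rewrite exprfctE.
Qed.

Lemma is_derive_weight a b d q s : 0 < eps + s ->
  is_derive s 1 (weight a b d q) (dweight a b d q s).
Proof.
move=> es0.
have d1 : is_derive s 1 (fun s : R => s ^+ a) (a%:R * s ^+ a.-1 * 1).
  exact: (@is_derive_exprn id).
have dV : is_derive s 1 (fun s : R => (eps + s)^-1) (- (eps + s) ^- 2 * 1).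
  have := @is_deriveV _ (fun s : R => eps + s) s 1 1; apply; first by rewrite gt_eqF.
  rewrite (_ : [eta _] = cst eps \+ (id : R -> R)) //.
  by have := is_deriveD (is_derive_cst eps s 1) (is_derive_id s 1); rewrite add0r.
have d2 : is_derive s 1 (fun s : R => (eps + s) ^- b)
    (b%:R * (eps + s)^-1 ^+ b.-1 * (- (eps + s) ^- 2 * 1)).
  have := is_derive_exprn b dV.
  by congr is_derive; apply/funext => t; rewrite exprVn.
have d3 : is_derive s 1 (fun s : R => (1 - s / La) ^+ d)
    (d%:R * (1 - s / La) ^+ d.-1 * (- La^-1)).
  apply: (@is_derive_exprn (fun s => 1 - s / La)).
  rewrite -[- La^-1]add0r; apply: is_deriveB => //.
  under eq_fun do rewrite mulrC; rewrite -[X in is_derive _ _ _ X]mulr1.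
  exact: is_deriveZ.
have := is_deriveM (is_deriveM (is_deriveM d1 d2) d3) (is_derive_cst (La ^- q) s 1).
move=> dw; apply: (@is_derive_eq _ _ _ _ _ _ _ _ dw).
rewrite /dweight /weight /= /GRing.scale/= mulr0 add0r.
have -> : b%:R * (eps + s)^-1 ^+ b.-1 * (- (eps + s) ^- 2 * 1) =
    - (b%:R * (eps + s) ^- b.+1).
  case: b {dw d2} => [|b]; first by rewrite !mul0r oppr0.
  rewrite -!exprVn !exprS !expr0 /=; ring.
have -> : La ^- q.+1 = La^-1 * La ^- q by rewrite -!exprVn exprS.
change ((((@GRing.exp R)^~ a : R -> R) * (fun s0 : R => (eps + s0) ^- b)) s)
  with (s ^+ a * (eps + s) ^- b).
ring.
Qed.

Lemma weight0 a b d q : (0 < a)%N -> weight a b d q 0 = 0.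
Proof. by case: a => // a _; rewrite /weight expr0n/= !mul0r. Qed.

Lemma weight00 d : weight 0 0 d 0 0 = 1.
Proof. by rewrite /weight mul0r subr0 expr1n !expr0 !invr1 !mulr1. Qed.

Lemma weightLa a b d q : (0 < d)%N -> weight a b d q La = 0.
Proof.
by case: d => // d _; rewrite /weight divff ?gt_eqF// subrr expr0n/= mulr0 mul0r.
Qed.

Lemma weight_div a b d q s : (eps + s)^-1 * weight a b d q s = weight a b.+1 d q s.
Proof. by rewrite /weight exprS invfM; ring. Qed.

Lemma weight_le1 b d q s : 0 <= s <= La ->
  `|weight (b + q) b d q s| <= 1.
Proof.
move=> /andP[s0 sL].
have es0 : 0 < eps + s by rewrite ltr_pwDl.
rewrite /weight -!mulrA exprD -mulrA.
have -> : s ^+ b * (s ^+ q * ((eps + s) ^- b * ((1 - s / La) ^+ d * La ^- q))) =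
  (s / (eps + s)) ^+ b * ((s / La) ^+ q * (1 - s / La) ^+ d).
  by rewrite !exprMn !exprVn; ring.
have u1 : 0 <= s / La <= 1 by rewrite divr_ge0 ?(ltW La0)//= ler_pdivrMr// mul1r.
have v1 : 0 <= s / (eps + s) <= 1.
  by rewrite divr_ge0 ?(ltW es0)//= ler_pdivrMr// mul1r lerDr (ltW eps0).
have /andP[u0 u1'] := u1; have /andP[v0 v1'] := v1.
rewrite ger0_norm; last first.
  by rewrite !mulr_ge0// exprn_ge0// ?subr_ge0//.
rewrite -[leRHS]mulr1 ler_pM ?mulr_ge0 ?exprn_ge0 ?subr_ge0//.
  by rewrite exprn_ile1.
rewrite -[leRHS]mulr1 ler_pM ?mulr_ge0 ?exprn_ge0 ?subr_ge0//.
  by rewrite exprn_ile1.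
by rewrite exprn_ile1// ?subr_ge0// gerBl.
Qed.

Lemma weight_continuous a b d q : {within `[0, La], continuous (weight a b d q)}.
Proof.
apply: derivable_within_continuous => s; rewrite in_itv/= => /andP[s0 _].
have es0 : 0 < eps + s by rewrite ltr_pwDl.
by have [] := is_derive_weight a b d q es0.
Qed.

Lemma continuous_itv_integrable (f : R -> R) (c : R) :
  {within `[0, c], continuous f} -> leb.-integrable `[0, c] (EFin \o f).
Proof. by move=> cf; apply: continuous_compact_integrable => //; exact: segment_compact. Qed.

Lemma dweight_continuous a b d q : {within `[0, La], continuous (dweight a b d q)}.
Proof.
have cw c a' b' d' q' :
    {within `[0, La], continuous (fun s => c * weight a' b' d' q' s)}.
  move=> s; apply: (@continuousM _ (subspace `[0, La]) (cst c) (weight a' b' d' q')).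
    exact: cst_continuous.
  exact: weight_continuous.
move=> s; apply: (@continuousB _ R^o (subspace `[0, La])
  (fun s => a%:R * weight a.-1 b d q s - b%:R * weight a b.+1 d q s)
  (fun s => d%:R * weight a b d.-1 q.+1 s)); last exact: cw.
apply: (@continuousB _ R^o (subspace `[0, La])
  (fun s => a%:R * weight a.-1 b d q s)
  (fun s => b%:R * weight a b.+1 d q s)); exact: cw.
Qed.

Lemma derive_oo_LRcontinuous (f df : R -> R) :
  (forall s, 0 < eps + s -> is_derive s 1 f (df s)) -> derivable_oo_LRcontinuous f 0 La.
Proof.
move=> fdf.
have cf s : 0 < eps + s -> {for s, continuous f}.
  move=> es0; apply: differentiable_continuous; apply/derivable1_diffP.
  by have [] := fdf _ es0.
split.
- move=> s; rewrite in_itv/= => /andP[s0 _].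
  by have [] := fdf s (addr_gt0 eps0 s0).
- by apply: cvg_at_right_filter; apply: cf; rewrite addr0.
- by apply: cvg_at_left_filter; apply: cf; rewrite addr_gt0.
Qed.

Lemma weight_by_parts a b d q (G g : R -> R) :
  (forall s : R, is_derive s 1 G (g s)) -> continuous g ->
  \int[leb]_(s in `[0, La]) (weight a b d q s * g s) =
    weight a b d q La * G La - weight a b d q 0 * G 0
    - \int[leb]_(s in `[0, La]) (dweight a b d q s * G s).
Proof.
move=> dG cg.
apply: (@Rintegration_by_parts R (weight a b d q) G (dweight a b d q) g 0 La La0).
- exact: dweight_continuous.
- by apply: derive_oo_LRcontinuous => s; exact: is_derive_weight.
- move=> s; rewrite in_itv/= => /andP[s0 _].
  rewrite derive1E; have dw := is_derive_weight a b d q (addr_gt0 eps0 s0).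
  exact: (@derive_val _ _ _ _ _ _ _ dw).
- exact: continuous_subspaceT.
- by apply: (@derive_oo_LRcontinuous _ g).
- by move=> s _; rewrite derive1E; exact: (@derive_val _ _ _ _ _ _ _ (dG s)).
Qed.

End weights.

Section weighted_average.
Variables (R : realType) (m : nat) (tau : 'rV[R]_m) (eps La : R).
Hypotheses (eps0 : 0 < eps) (La0 : 0 < La).
Local Notation leb := (@lebesgue_measure R).
Implicit Types (kap : 'rV[R]_m -> R) (w : 'rV[R]_m.+1 -> R) (x : 'rV[R]_m.+1).

Definition wavg (a b d q : nat) kap w x : R :=
  \int[leb]_(s in `[0, La]) (weight eps La a b d q s * avg tau eps kap w x s).

Lemma wavg_continuous a b d q (f : R -> R) : continuous f ->
  {within `[0, La], continuous (fun s => weight eps La a b d q s * f s)}.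
Proof.
move=> cf s.
apply: (@continuousM _ (subspace `[0, La]) (weight eps La a b d q) f).
  exact: weight_continuous.
exact: continuous_subspaceT.
Qed.

Lemma wavg_integrable a b d q (f : R -> R) : continuous f ->
  leb.-integrable `[0, La] (EFin \o (fun s => weight eps La a b d q s * f s)).
Proof. by move=> cf; apply: continuous_itv_integrable; exact: wavg_continuous. Qed.

(** Integration by parts in s of the term in d/ds of [avg_partial_divergence];
    the other term raises the power of 1/(eps + s) and changes the kernel to a
    divergence. *)
Lemma wavg_partial a b d q i kap w x : test_function kap -> test_function w ->
  wavg a b d q kap (partial i w) x =
  covector tau ord0 i * (weight eps La a b d q 0 * avg tau eps kap w x 0
    - weight eps La a b d q La * avg tau eps kap w x La
    + (a%:R * wavg a.-1 b d q kap w x - b%:R * wavg a b.+1 d q kap w x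
       - d%:R * wavg a b d.-1 q.+1 kap w x))
  + wavg a b.+1 d q (divergence (kernel_field tau i kap)) w x.
Proof.
move=> tk tw.
have tdk : test_function (divergence (kernel_field tau i kap)).
  by apply: test_divergence => j; exact: test_kernel_field.
have ca := @avg_continuous _ _ tau eps kap w x tk tw.
have cda := @avg_slope_continuous _ _ tau eps kap w x tk tw.
have cdv := @avg_continuous _ _ tau eps _ w x tdk tw.
have mI : measurable (`[0, La]%classic : set (measurableTypeR R)).
  exact: measurable_itv.
have iw a' b' d' q' := @wavg_integrable a' b' d' q' _ ca.
have izw c a' b' d' q' : leb.-integrable `[0, La]
    (EFin \o (fun s => c * (weight eps La a' b' d' q' s * avg tau eps kap w x s))).
  exact: (integrable_EFinZl mI c (iw a' b' d' q')).
rewrite /wavg; transitivity (\int[leb]_(s in `[0, La])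
   ((- covector tau ord0 i) * (weight eps La a b d q s * avg_slope tau eps kap w x s) +
    weight eps La a b.+1 d q s * avg tau eps (divergence (kernel_field tau i kap)) w x s)).
  apply: eq_Rintegral => s; rewrite inE/= in_itv/= => /andP[s0 _].
  have es0 : 0 < eps + s by rewrite ltr_pwDl.
  rewrite avg_partial_divergence ?gt_eqF// -weight_div mulrDr; congr (_ + _); ring.
have idw := @wavg_integrable a b d q _ cda.
have izd : leb.-integrable `[0, La] (EFin \o (fun s =>
    (- covector tau ord0 i) * (weight eps La a b d q s * avg_slope tau eps kap w x s))).
  exact: (integrable_EFinZl mI (- covector tau ord0 i) idw).
rewrite RintegralD//; last exact: wavg_integrable.
congr (_ + _); rewrite RintegralZl//.
rewrite (weight_by_parts eps0 La0 _ _ _ _ (fun s => is_derive_avg tau eps x s tk tw) cda).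
rewrite mulNr -mulrN; congr (_ * _); rewrite opprB.
rewrite [RHS]addrC; congr (_ + _); last by rewrite opprB.
transitivity (\int[leb]_(s in `[0, La])
   (a%:R * (weight eps La a.-1 b d q s * avg tau eps kap w x s)
   - b%:R * (weight eps La a b.+1 d q s * avg tau eps kap w x s)
   - d%:R * (weight eps La a b d.-1 q.+1 s * avg tau eps kap w x s))).
  by apply: eq_Rintegral => s _; rewrite /dweight; ring.
have iB : leb.-integrable `[0, La] (EFin \o (fun s =>
   (a%:R * (weight eps La a.-1 b d q s * avg tau eps kap w x s)
   - b%:R * (weight eps La a b.+1 d q s * avg tau eps kap w x s)))).
  exact: (integrable_EFinB mI (izw a%:R a.-1 b d q) (izw b%:R a b.+1 d q)).
by rewrite !RintegralB// !RintegralZl.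
Qed.

End weighted_average.

(** * Derivatives of the weighted averages *)

Section slab_estimates.
Variables (R : realType) (m : nat) (tau : 'rV[R]_m).
Local Notation leb := (@lebesgue_measure R).
Local Notation xi := (covector tau).
Implicit Types (kap : 'rV[R]_m -> R) (phi : 'rV[R]_m.+1 -> R) (x : 'rV[R]_m.+1).

(** Cutting by a function of xi . x commutes with the averages and with the
    tangential derivatives, so that it costs no derivative of th. *)
Definition localize (th : R -> R) phi (x : 'rV[R]_m.+1) : R := th (dotr xi x) * phi x.

Lemma test_localize th phi : smooth1 th -> test_function phi ->
  test_function (localize th phi).
Proof. by move=> sth tphi; apply: testMl => //; exact: smooth_comp_dotr. Qed.

Lemma tang_localize j th phi : smooth1 th -> smooth phi ->
  tang tau j (localize th phi) = localize th (tang tau j phi).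
Proof.
move=> sth sphi; apply/funext => y.
have sth' := smooth_comp_dotr xi sth.
have pth i : partial i (fun x => th (dotr xi x)) y = xi ord0 i * derive1 th (dotr xi y).
  apply: partialE; have := is_derive_comp_dotr (delta_mx ord0 i) (smooth1_is_derive1 (dotr xi y) sth).
  by rewrite dotr_delta.
rewrite /tang /localize !(partialM _ _ sth' sphi) !pth covectorS covector0; ring.
Qed.

Lemma avg_localize eps kap th phi x s : test_function kap -> smooth phi ->
  avg tau eps kap (localize th phi) x s = th (dotr xi x - s) * avg tau eps kap phi x s.
Proof.
move=> tk sphi; rewrite /avg -RintegralZl//; last exact: avg_integrable.
by apply: eq_Rintegral => z _; rewrite /localize dotr_covector_trans mulrCA.
Qed.

(** The data of one slab: nu bounds the slice norms of the tangential
    derivatives of phi on the slab only, and Ith bounds the mass of th along the ray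
    of depths below x. *)
Record slab_bounds (om nu La Ith B0 : R) (th : R -> R) phi x : Prop := SlabBounds {
  slab_om : 0 < om;
  slab_nu : 0 < nu;
  slab_La : 0 < La;
  slab_smooth : smooth1 th;
  slab_test : test_function phi;
  slab_ge0 : forall t, 0 <= th t;
  slab_energy : forall j t, th t != 0 -> energy tau (tang tau j phi) t <= nu ^+ m.+1;
  slab_bound : forall y, `|phi y| <= B0;
  slab_mass : \int[leb]_(s in `[0, La]) th (dotr xi x - s) <= Ith }.

Lemma itv_integrable_shift (th : R -> R) (t La : R) : continuous th ->
  leb.-integrable `[0, La] (EFin \o (fun s => th (t - s))).
Proof.
move=> cth; apply: continuous_itv_integrable; apply: continuous_subspaceT => s.
apply: (@continuous_comp R R R (fun s => t - s) th); last exact: cth.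
by apply: (@continuousB _ R^o R); [exact: cst_continuous|exact: cvg_id].
Qed.

(** After [avg_localize] the integrand in s carries the factor th (xi . x - s). *)
Lemma Rintegral_shift_le (th : R -> R) (t La C I : R) (f : R -> R) : continuous th -> 0 <= C ->
  leb.-integrable `[0, La] (EFin \o f) ->
  (forall s, 0 <= s <= La -> `|f s| <= C * th (t - s)) ->
  \int[leb]_(s in `[0, La]) th (t - s) <= I ->
  `|\int[leb]_(s in `[0, La]) f s| <= C * I.
Proof.
move=> cth C0 fi fC thI; have ith := @itv_integrable_shift th t La cth.
have mI : measurable (`[0, La]%classic : set (measurableTypeR R)).
  exact: measurable_itv.
rewrite (le_trans (le_normr_Rintegral _ fi))//.
apply: le_trans (ler_wpM2l C0 thI); rewrite -RintegralZl//.
apply: le_Rintegral => //.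
- exact: (integrable_norm fi).
- exact: (integrable_EFinZl mI C ith).
Qed.

(** Each derivative lowers the degree of the weight by one, which leaves degree
    - 1 at the end. The average against a divergence equals eps + s times
    averages of tangential derivatives, so that this last factor is absorbed.
    The power of s stays positive until all derivatives are used, hence there is no
    boundary term at depth 0. *)
Lemma divergence_wavg_bound r (K : 'I_m -> 'rV[R]_m -> R) b d q :
  (forall j, test_function (K j)) -> (size r <= d)%N ->
  exists2 C : R, 0 <= C & forall om nu La Ith B0 th phi x,
    slab_bounds om nu La Ith B0 th phi x ->
    `|wavg tau (om ^+ m.+1) La (size r + b + q) b.+1 d q (divergence K)
       (iter_partial r (localize th phi)) x| <= C * (om ^- m * nu * Ith).
Proof.
elim: r K b d q => [|i r IH] K b d q tK rd.
  have /choice[C_ C_P] j : exists C : R, 0 <= C /\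
      forall (w : 'rV[R]_m.+1 -> R) (x : 'rV[R]_m.+1) (s om nu : R),
      test_function w -> 0 < om -> 0 < nu -> 0 <= s ->
      energy tau w (dotr xi x - s) <= nu ^+ m.+1 ->
      `|avg tau (om ^+ m.+1) (K j) w x s| <= C * (om ^- m * nu).
    by have [C C0 CP] := avg_le_energy tau (tK j); exists C.
  exists (\sum_j C_ j); first by rewrite sumr_ge0// => j _; exact: (C_P j).1.
  move=> om nu La Ith B0 th phi x [om0 nu0 La0 sth tphi th0 thnu phB thI].
  set eps := om ^+ m.+1; have eps0 : 0 < eps by rewrite exprn_gt0.
  have tpsi := test_localize sth tphi.
  have cav := @avg_continuous _ _ tau eps _ _ x (test_divergence tK) tpsi.
  rewrite mulrA; apply: Rintegral_shift_le thI.
  - exact: smooth1_continuous0.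
  - by rewrite mulr_ge0 ?sumr_ge0// ?mulr_ge0 ?invr_ge0 ?exprn_ge0 ?(ltW om0) ?(ltW nu0)// => j _; exact: (C_P j).1.
  - exact: (wavg_integrable La eps0 _ _ _ _ cav).
  move=> s /andP[s0 sLa]; have es0 : 0 < eps + s by rewrite ltr_pwDl.
  rewrite add0n -weight_div.
  rewrite avg_divergence//; last exact: test_smooth.
  rewrite mulrACA mulVf ?gt_eqF// mul1r normrM -[leRHS]mul1r.
  apply: ler_pM => //.
    by apply: weight_le1 => //; rewrite s0.
  under eq_bigr => j _.
    rewrite tang_localize; [|exact: sth|exact: test_smooth].
    rewrite avg_localize; [|exact: tK|exact: (smooth_tang tau j (test_smooth tphi))].
    over.
  rewrite -mulr_sumr normrM (ger0_norm (th0 _)) mulrC.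
  have [->|thN0] := eqVneq (th (dotr xi x - s)) 0; first by rewrite !mulr0.
  rewrite ler_wpM2r// mulr_suml (le_trans (ler_norm_sum _ _ _))//.
  apply: ler_sum => j _; apply: (C_P j).2 => //; last exact: thnu.
  exact: test_tang.
have rd' : (size r <= d.-1)%N by move: rd => /=; case: (d).
have rd'' : (size r <= d)%N by apply: leq_trans rd' _; exact: leq_pred.
have d0 : (0 < d)%N by move: rd => /=; case: (d).
have tkf j : test_function (kernel_field tau i (divergence K) j).
  by apply: test_kernel_field; exact: test_divergence.
have [C1 C10 C1P] := IH K b d q tK rd''.
have [C2 C20 C2P] := IH K b.+1 d q tK rd''.
have [C3 C30 C3P] := IH K b d.-1 q.+1 tK rd'.
have [C4 C40 C4P] := IH _ b.+1 d q tkf rd''.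
set a := (size r + b + q)%N.
exists (`|xi ord0 i| * (a.+1%:R * C1 + b.+1%:R * C2 + d%:R * C3) + C4).
  by rewrite !addr_ge0 ?mulr_ge0 ?addr_ge0 ?mulr_ge0.
move=> om nu La Ith B0 th phi x sb.
have [om0 nu0 La0 sth tphi th0 thnu phB thI] := sb.
set eps := om ^+ m.+1; have eps0 : 0 < eps by rewrite exprn_gt0.
have tpsi := test_localize sth tphi.
rewrite /= !addSn wavg_partial//; last 2 first.
- exact: test_divergence.
- exact: test_iter_partial.
rewrite (@weight0 _ _ _ _.+1); last by [].
rewrite (@weightLa _ _ _ La0); last by [].
rewrite (mul0r (avg _ _ _ _ _ 0)) (mul0r (avg _ _ _ _ _ La)) subrr add0r.
set G := om ^- m * nu * Ith.
move: {C1P}(C1P _ _ _ _ _ _ _ _ sb) {C2P}(C2P _ _ _ _ _ _ _ _ sb)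
  {C3P}(C3P _ _ _ _ _ _ _ _ sb) {C4P}(C4P _ _ _ _ _ _ _ _ sb).
rewrite /= -/a !addnS !addSn -/a -/eps -/G.
set W1 := wavg _ _ _ a b.+1 d q _ _ _; set W2 := wavg _ _ _ _ _ d q (divergence K) _ _.
set W3 := wavg _ _ _ _ _ _ q.+1 _ _ _; set W4 := wavg _ _ _ _ _ _ _ (divergence (kernel_field _ _ _)) _ _.
move=> h1 h2 h3 h4.
rewrite (le_trans (ler_normD _ _))// mulrDl lerD// normrM -mulrA ler_wpM2l//.
rewrite !mulrDl (le_trans (ler_normB _ _))// lerD//.
  rewrite (le_trans (ler_normB _ _))// lerD// normrM normr_nat -mulrA ler_wpM2l//.
by rewrite normrM normr_nat -mulrA ler_wpM2l.
Qed.

(** The derivatives of the weight act in three ways. Those on the power of s lower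
    it to s^0 and leave (size r).-1`! times a boundary term at depth 0, the
    only term not small; a derivative on the power of 1 - s/La yields a factor 1/La,
    so its terms are bounded by the supremum B0 of phi; and derivatives on the kernel
    give a divergence, to which [divergence_wavg_bound] applies. *)
Lemma wavg_bound r kap a d q :
  test_function kap -> a.+1 = (size r + q)%N -> (size r <= d)%N ->
  exists2 C : R, 0 <= C & forall om nu La Ith B0 th phi x,
    slab_bounds om nu La Ith B0 th phi x ->
    `|wavg tau (om ^+ m.+1) La a 0 d q kap (iter_partial r (localize th phi)) x
      - ((q == 0%N) * (size r).-1`!)%:R * (\prod_(i <- r) xi ord0 i)
        * avg tau (om ^+ m.+1) kap (localize th phi) x 0|
    <= C * (om ^- m * nu * Ith) + C * (La^-1 * B0 * Ith).
Proof.
move=> tk; elim: r a d q => [|i r IH] a d q aE rd.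
  move: aE; rewrite add0n => qE; subst q.
  have [K K0 kK] := test_bounded tk.
  set Ik := \int[lebesgue_rV R m]_z `|kap z|.
  have Ik0 : 0 <= Ik by exact: Rintegral_ge0.
  exists Ik => // om nu La Ith B0 th phi x [om0 nu0 La0 sth tphi th0 thnu phB thI].
  set eps := om ^+ m.+1; have eps0 : 0 < eps by rewrite exprn_gt0.
  have tpsi := test_localize sth tphi.
  have B00 : 0 <= B0 by apply: le_trans (phB 0).
  have Ith0 : 0 <= Ith.
    by apply: le_trans thI; apply: Rintegral_ge0 => // s _.
  rewrite mul0n !mul0r subr0 /= ler_wpDl ?mulr_ge0 ?invr_ge0 ?exprn_ge0 ?(ltW om0) ?(ltW nu0)//.
  have cav := @avg_continuous _ _ tau eps _ _ x tk tpsi.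
  rewrite !mulrA; apply: Rintegral_shift_le thI.
  - exact: smooth1_continuous0.
  - by rewrite !mulr_ge0// invr_ge0 (ltW La0).
  - exact: (wavg_integrable La eps0 _ _ _ _ cav).
  move=> s /andP[s0 sLa].
  have -> : weight eps La a 0 d a.+1 s = La^-1 * weight eps La (0 + a) 0 d a s.
    by rewrite /weight add0n -[La ^- a.+1]exprVn exprS exprVn; ring.
  rewrite avg_localize//; last exact: test_smooth.
  have -> : Ik / La * B0 * th (dotr xi x - s) = La^-1 * (th (dotr xi x - s) * (Ik * B0)).
    by ring.
  rewrite -[La^-1 * _ * (_ * _)]mulrA normrM (@ger0_norm _ La^-1) ?invr_ge0 ?(ltW La0)//.
  rewrite ler_wpM2l ?invr_ge0 ?(ltW La0)// normrM -[leRHS]mul1r.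
  apply: ler_pM => //; first by apply: weight_le1 => //; rewrite s0.
  rewrite normrM (ger0_norm (th0 _)) ler_wpM2l//.
  by apply: avg_le => //; exact: test_smooth.
have rd' : (size r <= d.-1)%N by move: rd => /=; case: (d).
have rd'' : (size r <= d)%N by apply: leq_trans rd' _; exact: leq_pred.
have d0 : (0 < d)%N by move: rd => /=; case: (d).
have {}aE : a = (size r + q)%N by move: aE; rewrite /= addSn => -[].
have [C1 C10 C1P] : exists2 C : R, 0 <= C & forall om nu La Ith B0 th phi x,
    slab_bounds om nu La Ith B0 th phi x ->
    `|(weight (om ^+ m.+1) La a 0 d q 0 * avg tau (om ^+ m.+1) kap (iter_partial r (localize th phi)) x 0
       + a%:R * wavg tau (om ^+ m.+1) La a.-1 0 d q kap (iter_partial r (localize th phi)) x)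
      - ((q == 0%N) * (size r)`!)%:R * (\prod_(i <- r) xi ord0 i)
        * avg tau (om ^+ m.+1) kap (localize th phi) x 0|
    <= C * (om ^- m * nu * Ith) + C * (La^-1 * B0 * Ith).
  case: (posnP a) => [a0|a0].
    exists 0 => // om nu La Ith B0 th phi x sb.
    move: aE; rewrite a0 => /esym/eqP; rewrite addn_eq0 => /andP[/nilP -> /eqP ->].
    rewrite big_nil (_ : (_ * _)%:R = 1 :> R)// weight00 !mul0r !addr0 !mul1r.
    by rewrite subrr normr0.
  have [C C0 CP] := IH a.-1 d q (etrans (prednK a0) aE) rd''.
  exists (a%:R * C); first exact: mulr_ge0.
  move=> om nu La Ith B0 th phi x sb.
  rewrite weight0// mul0r add0r -[a%:R * C * _]mulrA -[a%:R * C * _]mulrA -mulrDr.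
  rewrite (_ : _ - _ = a%:R * (wavg tau (om ^+ m.+1) La a.-1 0 d q kap
     (iter_partial r (localize th phi)) x - ((q == 0%N) * (size r).-1`!)%:R *
     (\prod_(i <- r) xi ord0 i) * avg tau (om ^+ m.+1) kap (localize th phi) x 0)).
    by rewrite normrM normr_nat ler_wpM2l//; exact: CP.
  rewrite mulrBr !mulrA -natrM; congr (_ - _%:R * _ * _).
  case: eqP aE a0 => [->|_ _ _]; last by rewrite !mul0n muln0.
  by rewrite addn0 => ->; case: (size r) => // l _; rewrite !mul1n factS.
have tkf j : test_function (kernel_field tau i kap j) by exact: test_kernel_field.
have [C3 C30 C3P] := IH a d.-1 q.+1 (esym (etrans (addnS _ _) (f_equal S (esym aE)))) rd'.
have [C4 C40 C4P] := @divergence_wavg_bound r _ 0 d q tkf rd''.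
exists (`|xi ord0 i| * (C1 + d%:R * C3) + C4).
  by rewrite addr_ge0 ?mulr_ge0 ?addr_ge0 ?mulr_ge0.
move=> om nu La Ith B0 th phi x sb.
have [om0 nu0 La0 sth tphi th0 thnu phB thI] := sb.
set eps := om ^+ m.+1; have eps0 : 0 < eps by rewrite exprn_gt0.
have tpsi := test_localize sth tphi.
have B00 : 0 <= B0 by apply: le_trans (phB 0).
have Ith0 : 0 <= Ith.
  by apply: le_trans thI; apply: Rintegral_ge0 => // s _.
rewrite wavg_partial//; last exact: test_iter_partial.
rewrite [weight _ _ _ _ _ _ La]weightLa// big_cons (mul0r (avg _ _ _ _ _ La)) subr0 (mul0r (wavg _ _ _ _ _ _ _ _ _ _)) subr0 /=.
move: {C1P}(C1P _ _ _ _ _ _ _ _ sb) {C3P}(C3P _ _ _ _ _ _ _ _ sb) {C4P}(C4P _ _ _ _ _ _ _ _ sb).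
rewrite addn0 -aE !mul0n !mul0r subr0 -/eps.
set W0 := weight _ _ _ _ _ _ _ * _.
set W1 := wavg _ _ _ a.-1 _ _ _ _ _ _; set W3 := wavg _ _ _ _ _ _ q.+1 _ _ _.
set W4 := wavg _ _ _ _ _ _ _ (divergence _) _ _.
set B := ((_ == _) * _)%:R; set P := \prod_(_ <- _) _; set J := avg _ _ _ _ _ _.
set G := om ^- m * nu * Ith; set H := La^-1 * B0 * Ith.
have G0 : 0 <= G by rewrite !mulr_ge0// ?invr_ge0 ?exprn_ge0 ?(ltW om0) ?(ltW nu0).
have H0 : 0 <= H by rewrite !mulr_ge0// invr_ge0 (ltW La0).
move=> h1 h3 h4.
have -> : xi ord0 i * (W0 + (a%:R * W1 - d%:R * W3)) + W4 - B * (xi ord0 i * P) * J =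
  xi ord0 i * ((W0 + a%:R * W1 - B * P * J) - d%:R * W3) + W4 by ring.
rewrite -mulrDr in h1 *; rewrite -mulrDr in h3 *.
rewrite -mulrDr mulrDl; apply: (le_trans (ler_normD _ _)); apply: lerD; last first.
  by rewrite (le_trans h4)// ler_wpM2l// lerDl.
rewrite [leLHS]normrM -[_ * _ * (G + H)]mulrA; apply: ler_wpM2l => //.
rewrite mulrDl (le_trans (ler_normB _ _))// lerD//.
by rewrite normrM normr_nat -mulrA ler_wpM2l.
Qed.

End slab_estimates.

(** * The potential as a test function *)

Section potential.
Variables (R : realType) (m : nat) (tau : 'rV[R]_m) (eps La : R).
Hypotheses (eps0 : 0 < eps) (La0 : 0 < La).
Local Notation leb := (@lebesgue_measure R).

Lemma avg_bounded_support kap w : test_function kap -> test_function w ->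
  exists2 B : R, 0 <= B & forall x s, 0 <= s <= La ->
    avg tau eps kap w x s != 0 -> `|x| <= B.
Proof.
move=> /test_bounded_support[Bk Bk0 kB] /test_bounded_support[Bw Bw0 wB].
have [K K0 tK] := tangent_bound tau.
exists (Bw + (La + (eps + La) * (K * Bk))).
  by rewrite !addr_ge0// ?mulr_ge0// ?addr_ge0// ?(ltW eps0) ?(ltW La0).
move=> x s /andP[s0 sLa]; apply: contraR; rewrite -ltNge => xB.
rewrite -[X in _ == X](mul0r (fine (lebesgue_rV R m setT))) -Rintegral_cst//; apply/eqP.
apply: eq_Rintegral => z _ /=.
have [->|kz] := eqVneq (kap z) 0; first by rewrite mul0r.
have [->|wz] := eqVneq (w (x + trans tau eps s z)) 0; first by rewrite mulr0.
exfalso; move: xB; apply/negP; rewrite -leNgt.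
rewrite -[x](addrK (trans tau eps s z)) (le_trans (ler_normB _ _))// lerD//.
  exact: wB.
rewrite /trans (le_trans (ler_normB _ _))// normrN !normrZ lerD//.
  rewrite ger0_norm// -[leRHS]mulr1 ler_pM//.
  apply/rV_norm_leP => // i; rewrite mxE; case: (_ && _); first by rewrite normr1.
  by rewrite normr0.
have es0 : 0 <= eps + s by rewrite addr_ge0// ltW.
rewrite ger0_norm//; apply: ler_pM => //; first by rewrite lerD2l.
by rewrite (le_trans (tK z))// ler_wpM2l//; exact: kB.
Qed.

(** The depths being bounded by La, the potential has bounded support. *)
Lemma test_wavg a b d q kap psi : test_function kap -> test_function psi ->
  test_function (fun x => wavg tau eps La a b d q kap psi x) /\
  forall r x, iter_partial r (fun x => wavg tau eps La a b d q kap psi x) x =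
    wavg tau eps La a b d q kap (iter_partial r psi) x.
Proof.
move=> tk tpsi.
have E s r x : iter_partial r (fun x => weight eps La a b d q s * avg tau eps kap psi x s) x
    = weight eps La a b d q s * avg tau eps kap (iter_partial r psi) x s.
  rewrite iter_partialZ; last exact: (smooth_avg tau eps s tk tpsi).1.
  by rewrite (smooth_avg tau eps s tk tpsi).2.
have mI : measurable (`[0, La]%classic : set (measurableTypeR R)).
  exact: measurable_itv.
have ci r x := @avg_continuous _ _ tau eps _ _ x tk (test_iter_partial r tpsi).
have [|||sI EI] := @smooth_integral R m.+1 _ _ leb _ mI
    (fun s x => weight eps La a b d q s * avg tau eps kap psi x s).
- by move=> s; exact: (smoothZ _ (smooth_avg tau eps s tk tpsi).1).
- move=> r x.
  rewrite (_ : (fun s => _) = (fun s : R => weight eps La a b d q s *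
    avg tau eps kap (iter_partial r psi) x s)); last by apply/funext => s; exact: E.
  by have := measurable_int _ (wavg_integrable La eps0 a b d q (ci r x)); move/measurable_EFinP.
- move=> r; have [K K0 rK] := test_bounded (test_iter_partial r tpsi).
  set Ik := (\int[lebesgue_rV R m]_z `|kap z|) * K.
  exists (fun s => `|weight eps La a b d q s| * Ik).
    have cw1 : continuous (cst 1 : R -> R) by exact: cst_continuous.
    have := integrableZr mI Ik (integrable_norm (wavg_integrable La eps0 a b d q cw1)).
    by apply: eq_integrable => //= s _; rewrite mulr1.
  move=> s x _; rewrite [X in `|X|]E normrM ler_wpM2l//; apply: avg_le => //.
  exact: (test_smooth (test_iter_partial r tpsi)).
split; last by move=> r x; rewrite EI; apply: eq_Rintegral => s _; exact: E.
apply/test_functionP; split => //.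
have [B B0 vB] := avg_bounded_support tk tpsi; exists B => // x.
apply: contraR => xB; rewrite -[X in _ == X](mul0r (fine (leb `[0, La]))).
rewrite -(@Rintegral_cst _ _ _ leb)//; apply/eqP; apply: eq_Rintegral => s.
rewrite inE/= in_itv/= => s0L; have [->|v0] := eqVneq (avg tau eps kap psi x s) 0.
  by rewrite mulr0.
by move: xB; rewrite (vB _ _ s0L v0).
Qed.

End potential.

Section multi_partial_list.
Variables (R : realType) (n k : nat).
Implicit Type a : multiindex n k.

(** The multi-index as a list of directions, for induction on derivatives. *)
Definition mseq a : seq 'I_n := flatten [seq nseq (val a i) i | i <- enum 'I_n].

Lemma multi_partialE a (g : 'rV[R]_n -> R) : multi_partial a g = iter_partial (mseq a) g.
Proof.
rewrite /multi_partial /mseq; elim: (enum 'I_n) => //= i s ->.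
rewrite /iter_partial foldr_cat; elim: (nat_of_ord _) => //= l IH; congr (partial _ _).
exact: IH.
Qed.

Lemma size_mseq a : size (mseq a) = k.
Proof.
rewrite size_flatten /shape -map_comp sumnE big_map big_enum/=.
under eq_bigr do rewrite size_nseq; exact/eqP/(valP a).
Qed.

Lemma prod_mseq a (x : 'I_n -> R) :
  \prod_(i <- mseq a) x i = \prod_i x i ^+ val a i.
Proof.
rewrite big_flatten/= big_map big_enum/=; apply: eq_bigr => i _.
by elim: (nat_of_ord _) => [|l IH]; rewrite ?big_nil//= big_cons IH exprS.
Qed.

End multi_partial_list.

Section weak_solutions.
Variables (R : realType) (m k : nat) (tau : 'rV[R]_m).
Local Notation mu := (lebesgue_rV R m.+1).
Local Notation xi := (covector tau).
Implicit Types (g : multiindex m.+1 k -> 'rV[R]_m.+1 -> R).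

(** The equation sum_a D^a g_a = 0 in the sense of distributions; the common
    sign (-1)^k of the integrations by parts is divided out. *)
Definition weak_solution g :=
  (forall a : multiindex m.+1 k, mu.-integrable setT (EFin \o g a)) /\
  forall psi, test_function psi ->
    \sum_(a : multiindex m.+1 k) \int[mu]_x (g a x * multi_partial a psi x) = 0.

Definition total_mass g : R := \sum_(a : multiindex m.+1 k) \int[mu]_x `|g a x|.

(** The symbol of sum_a D^a g_a at the covector xi. *)
Definition covector_sum g (x : 'rV[R]_m.+1) : R :=
  \sum_(a : multiindex m.+1 k) (\prod_i xi ord0 i ^+ val a i) * g a x.

Lemma total_mass_ge0 g : 0 <= total_mass g.
Proof. by apply: sumr_ge0 => a _; exact: Rintegral_ge0. Qed.

Lemma integrable_mul_bounded (f h : 'rV[R]_m.+1 -> R) (B : R) :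
  mu.-integrable setT (EFin \o f) -> measurable_fun setT h ->
  (forall x, `|h x| <= B) ->
  mu.-integrable setT (EFin \o (fun x => f x * h x)).
Proof.
move=> fi mh hB; have B0 : 0 <= B by exact: le_trans (hB 0).
apply: (@le_integrable _ _ _ mu setT measurableT _ (EFin \o (fun x => B * f x))).
- by apply/measurable_EFinP; apply: measurable_funM => //; apply/measurable_EFinP; exact: measurable_int fi.
- move=> x _; rewrite /= lee_fin !normrM (ger0_norm B0) mulrC.
  by rewrite ler_wpM2r.
- exact: (integrable_EFinZl measurableT B fi).
Qed.

Lemma le_Rintegral_bounded (f h : 'rV[R]_m.+1 -> R) (B : R) :
  mu.-integrable setT (EFin \o f) -> measurable_fun setT h ->
  (forall x, `|h x| <= B) ->
  `|\int[mu]_x (f x * h x)| <= (\int[mu]_x `|f x|) * B.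
Proof.
move=> fi mh hB; have ifh := integrable_mul_bounded fi mh hB.
rewrite (le_trans (le_normr_Rintegral _ ifh))// -RintegralZr//; last exact: integrable_norm fi.
apply: le_Rintegral => //; first exact: integrable_norm ifh.
- exact: (integrable_EFinZr measurableT B (integrable_norm fi)).
- by move=> x _; rewrite normrM ler_wpM2l.
Qed.

Lemma integrable_covector_sum g : weak_solution g ->
  mu.-integrable setT (EFin \o covector_sum g).
Proof.
move=> [ig _]; apply: integrable_EFin_sum => // a.
exact: (integrable_EFinZl measurableT _ (ig a)).
Qed.

Lemma integral_covector_sum g (h : 'rV[R]_m.+1 -> R) B : weak_solution g ->
  measurable_fun setT h -> (forall x, `|h x| <= B) ->
  \int[mu]_x (covector_sum g x * h x) =
  \sum_(a : multiindex m.+1 k) (\prod_i xi ord0 i ^+ val a i) * \int[mu]_x (g a x * h x).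
Proof.
move=> [ig _] mh hB.
have igh a := integrable_mul_bounded (ig a) mh hB.
under [RHS]eq_bigr => a _ do rewrite -RintegralZl//.
rewrite -Rintegral_sum//; last first.
  move=> a; exact: (integrable_EFinZl measurableT (\prod_i xi ord0 i ^+ val a i) (igh a)).
apply: eq_Rintegral => x _; rewrite /covector_sum mulr_suml.
by apply: eq_bigr => a _; rewrite mulrA.
Qed.

End weak_solutions.

Section annihilation.
Variables (R : realType) (m k : nat) (tau : 'rV[R]_m).
Local Notation mu := (lebesgue_rV R m.+1).
Local Notation xi := (covector tau).
Implicit Types (g : multiindex m.+1 k.+1 -> 'rV[R]_m.+1 -> R).

(** The a-th derivative of the potential with weight s^k (1 - s/La)^(k+1) is k! xi^a
    times the average at depth 0, up to the errors of [wavg_bound]. Summed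
    against g_a the main terms give the left-hand side and the derivatives give 0;
    the error in 1/La vanishes as La grows. *)
Lemma avg_annihilation rho : test_function rho ->
  exists2 C : R, 0 <= C & forall g om nu Ith B0 th phi,
    weak_solution g ->
    (forall La x, 0 < La -> slab_bounds tau om nu La Ith B0 th phi x) ->
    `|\int[mu]_x (covector_sum tau g x *
        avg tau (om ^+ m.+1) rho (localize tau th phi) x 0)|
      <= C * total_mass g * (om ^- m * nu * Ith).
Proof.
move=> trho.
have /choice[C_ C_P] (a : multiindex m.+1 k.+1) : exists C : R, 0 <= C /\
    forall om nu La Ith B0 th phi x,
    slab_bounds tau om nu La Ith B0 th phi x ->
    `|wavg tau (om ^+ m.+1) La k 0 k.+1 0 rho (iter_partial (mseq a) (localize tau th phi)) x
      - (k`!)%:R * (\prod_i xi ord0 i ^+ val a i)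
        * avg tau (om ^+ m.+1) rho (localize tau th phi) x 0|
    <= C * (om ^- m * nu * Ith + La^-1 * B0 * Ith).
  have [||C C0 CP] := @wavg_bound R m tau (mseq a) rho k k.+1 0 trho.
  - by rewrite size_mseq addn0.
  - by rewrite size_mseq.
  exists C; split=> // om nu La Ith B0 th phi x sb.
  have := CP _ _ _ _ _ _ _ _ sb.
  by rewrite size_mseq prod_mseq mul1n mulrDr.
pose C := \sum_a C_ a.
have C0 : 0 <= C by apply: sumr_ge0 => a _; exact: (C_P a).1.
have C_C a : C_ a <= C.
  by rewrite /C (bigD1 a)//= lerDl sumr_ge0// => b _; exact: (C_P b).1.
exists C => // g om nu Ith B0 th phi wg sb.
have [om0 nu0 _ sth tphi th0 _ phB _] := sb 1 0 ltr01.
set eps := om ^+ m.+1; have eps0 : 0 < eps by rewrite exprn_gt0.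
have tpsi := test_localize tau sth tphi.
pose J x := avg tau eps rho (localize tau th phi) x 0; set G := om ^- m * nu * Ith.
have sJ : smooth J by exact: (smooth_avg tau eps 0 trho tpsi).1.
have mJ : measurable_fun setT J by apply: continuous_measurable_rV; exact: smooth_continuous.
have [K K0 wK] := test_bounded tpsi.
have JB (x : 'rV[R]_m.+1) : `|J x| <= (\int[lebesgue_rV R m]_z `|rho z|) * K.
  by apply: avg_le; [exact: trho|exact: (test_smooth tpsi)|move=> z; exact: wK].
have B00 : 0 <= B0 by apply: le_trans (phB 0).
have Ith0 : 0 <= Ith.
  by have [_ _ _ _ _ _ _ _] := sb 1 0 ltr01; apply: le_trans; apply: Rintegral_ge0.
have key (La : R) : 0 < La ->
    `|\int[mu]_x (covector_sum tau g x * J x)| <= C * total_mass g * (G + La^-1 * B0 * Ith).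
  move=> La0; have [tP EP] := test_wavg tau eps0 La0 k 0 k.+1 0 trho tpsi.
  pose W (a : multiindex m.+1 k.+1) x := wavg tau eps La k 0 k.+1 0 rho (iter_partial (mseq a) (localize tau th phi)) x.
  pose P (a : multiindex m.+1 k.+1) : R := \prod_i xi ord0 i ^+ val a i.
  have WE (a : multiindex m.+1 k.+1) x : multi_partial a (fun x => wavg tau eps La k 0 k.+1 0 rho (localize tau th phi) x) x = W a x.
    by rewrite multi_partialE EP.
  have tW a : test_function (W a).
    rewrite (_ : W a = iter_partial (mseq a) (fun x => wavg tau eps La k 0 k.+1 0 rho (localize tau th phi) x)).
      exact: test_iter_partial.
    by apply/funext => x; rewrite EP.
  have mW a := test_measurable (tW a).
  have /choice[KW KWP] a : exists B : R, forall x, `|W a x| <= B.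
    by have [B _ WB] := test_bounded (tW a); exists B.
  have S0 : \sum_a \int[mu]_x (g a x * W a x) = 0.
    rewrite -[RHS](wg.2 _ tP); apply: eq_bigr => a _.
    by apply: eq_Rintegral => x _; rewrite WE.
  have kf1 : (1 : R) <= (k`!)%:R by rewrite ler1n fact_gt0.
  apply: (@le_trans _ _ ((k`!)%:R * `|\int[mu]_x (covector_sum tau g x * J x)|)).
    by rewrite ler_peMl.
  rewrite -[(k`!)%:R]normr_nat -normrM (integral_covector_sum tau wg mJ JB).
  have -> : (k`!)%:R * \sum_a P a * \int[mu]_x (g a x * J x) =
      - (\sum_a \int[mu]_x (g a x * W a x) -
         \sum_a (k`!)%:R * (P a * \int[mu]_x (g a x * J x))).
    by rewrite S0 sub0r opprK mulr_sumr.
  rewrite normrN -sumrB.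
  have igJ a := integrable_mul_bounded (wg.1 a) mJ JB.
  have igW a := integrable_mul_bounded (wg.1 a) (mW a) (KWP a).
  have E a : \int[mu]_x (g a x * W a x) - (k`!)%:R * (P a * \int[mu]_x (g a x * J x)) =
      \int[mu]_x (g a x * (W a x - (k`!)%:R * P a * J x)).
    have iPJ : mu.-integrable setT (EFin \o (fun x => ((k`!)%:R * P a) * (g a x * J x))).
      exact: (integrable_EFinZl measurableT ((k`!)%:R * P a) (igJ a)).
    rewrite mulrA -RintegralZl// -RintegralB//.
    by apply: eq_Rintegral => x _; ring.
  under eq_bigr do rewrite E.
  apply: (le_trans (ler_norm_sum _ _ _)).
  rewrite [C * _]mulrC -[total_mass g * C * _]mulrA [X in _ <= X]mulr_suml.
  apply: ler_sum => a _; apply: le_Rintegral_bounded.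
  - exact: wg.1.
  - by apply: measurable_funB => //; apply: measurable_funM.
  - move=> x; apply: le_trans ((C_P a).2 _ _ _ _ _ _ _ _ (sb La x La0)) _.
    apply: ler_wpM2r => //; rewrite addr_ge0// !mulr_ge0 ?invr_ge0 ?exprn_ge0 ?(ltW om0) ?(ltW nu0) ?(ltW La0)//.
rewrite -/J; apply/ler_addgt0Pr => e e0.
set Z := C * total_mass g * (B0 * Ith).
have Z0 : 0 <= Z by rewrite !mulr_ge0// total_mass_ge0.
have La0 : 0 < Z / e + 1 by rewrite ltr_wpDl// divr_ge0// ltW.
apply: le_trans (key _ La0) _; rewrite mulrDr lerD2l.
rewrite -[_^-1 * _ * _]mulrA [leLHS]mulrCA -/Z ler_pdivrMl//.
by rewrite mulrDl mul1r divfK ?gt_eqF// lerDl ltW.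
Qed.

(** Replacing the localized phi by its average at depth 0 costs om nu by
    [avg0_approx], and the average is nearly annihilated by [avg_annihilation]. *)
Lemma local_estimate :
  exists2 C : R, 0 <= C & forall g om nu Ith B0 th phi,
    weak_solution g -> (forall t, th t <= 1) ->
    (forall La x, 0 < La -> slab_bounds tau om nu La Ith B0 th phi x) ->
    `|\int[mu]_x (covector_sum tau g x * localize tau th phi x)|
      <= C * (om * nu * (\int[mu]_x (`|covector_sum tau g x| * th (dotr xi x)))
              + total_mass g * (om ^- m * nu * Ith)).
Proof.
have [rho [trho rho1]] := exists_mollifier R m.
have [C1 C10 C1P] := avg_annihilation trho.
have [C2 C20 C2P] := avg0_approx tau trho rho1.
exists (C1 + C2); first exact: addr_ge0.
move=> g om nu Ith B0 th phi wg th1 sb.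
have [om0 nu0 _ sth tphi th0 then_ phB _] := sb 1 0 ltr01.
set eps := om ^+ m.+1; have eps0 : 0 < eps by rewrite exprn_gt0.
have tpsi := test_localize tau sth tphi.
pose J x := avg tau eps rho (localize tau th phi) x 0.
have sJ : smooth J by exact: (smooth_avg tau eps 0 trho tpsi).1.
have mJ : measurable_fun setT J by apply: continuous_measurable_rV; exact: smooth_continuous.
have [K K0 wK] := test_bounded tpsi.
have JB (x : 'rV[R]_m.+1) : `|J x| <= (\int[lebesgue_rV R m]_z `|rho z|) * K.
  by apply: avg_le; [exact: trho|exact: (test_smooth tpsi)|move=> z; exact: wK].
have ig := integrable_covector_sum tau wg.
have igJ := integrable_mul_bounded ig mJ JB.
have igp := integrable_mul_bounded ig (test_measurable tpsi) wK.
have := C1P _ _ _ _ _ _ _ wg sb; rewrite -/eps -/J.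
set A := \int[mu]_x (_ * J x) => hA.
set D := \int[mu]_x (_ * localize _ _ _ _); set A' := \int[mu]_x (_ * th _); set G := om ^- m * nu * Ith.
have mth : measurable_fun setT (fun x => th (dotr xi x)).
  by apply: continuous_measurable_rV; exact: smooth_continuous (smooth_comp_dotr xi sth).
have iGth : mu.-integrable setT (EFin \o (fun x => `|covector_sum tau g x| * th (dotr xi x))).
  apply: (@integrable_mul_bounded _ _ _ _ 1) => //; first exact: (integrable_norm ig).
  by move=> x; rewrite ger0_norm.
have h2 : `|D - A| <= C2 * (om * nu) * A'.
  rewrite /D /A -RintegralB// -RintegralZl//.
  have iB : mu.-integrable setT (EFin \o (fun x =>
      covector_sum tau g x * localize tau th phi x - covector_sum tau g x * J x)).
    exact: (integrable_EFinB measurableT igp igJ).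
  apply: (le_trans (le_normr_Rintegral measurableT iB)).
  apply: le_Rintegral; first exact: measurableT.
  - exact: (integrable_norm iB).
  - exact: (integrable_EFinZl measurableT (C2 * (om * nu)) iGth).
  move=> x _; rewrite -mulrBr normrM mulrCA ler_wpM2l//.
  rewrite /J (avg_localize tau _ th x _ trho (test_smooth tphi)) subr0 /localize -mulrBr normrM (ger0_norm (th0 _)) mulrC.
  have [->|thx] := eqVneq (th (dotr xi x)) 0; first by rewrite !mulr0.
  by rewrite ler_wpM2r// distrC; apply: C2P => // j; exact: then_.
have A'0 : 0 <= A' by apply: Rintegral_ge0 => x _; rewrite mulr_ge0.
have Ith0 : 0 <= Ith.
  by have [_ _ _ _ _ _ _ _] := sb 1 0 ltr01; apply: le_trans; apply: Rintegral_ge0.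
have G0 : 0 <= G by rewrite !mulr_ge0 ?invr_ge0 ?exprn_ge0 ?(ltW om0) ?(ltW nu0).
have t0 := total_mass_ge0 g.
rewrite -[D](subrK A) (le_trans (ler_normD _ _))//.
rewrite mulrDr; apply: lerD.
  rewrite (le_trans h2)// -mulrA ler_wpM2r ?lerDr//.
  by rewrite !mulr_ge0// ltW.
by rewrite (le_trans hA)// -mulrA ler_wpM2r ?lerDl// mulr_ge0.
Qed.

End annihilation.

(** * The estimate for one covector *)

Section line_integrals.
Variable R : realType.
Local Notation leb := (@lebesgue_measure R).

Lemma integrable_continuous_bounded_support1 (f : R -> R) (B : R) : continuous f ->
  (forall t, f t != 0 -> `|t| <= B) -> leb.-integrable setT (EFin \o f).
Proof.
move=> cf fB.
have mI : measurable (`[- B, B]%classic : set (measurableTypeR R)).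
  exact: measurable_itv.
have : leb.-integrable `[- B, B]%classic (EFin \o f).
  apply: continuous_compact_integrable; first exact: segment_compact.
  exact: continuous_subspaceT.
move/(integrable_mkcond _ mI); congr (_.-integrable _ _); apply/funext => t.
rewrite patchE; case: ifPn => // tB; apply/esym/eqP; rewrite eqe.
apply: contraNT tB => /fB; rewrite inE/= in_itv/= ler_norml.
by [].
Qed.

Lemma root_exists (n : nat) (y : R) : 0 < y -> exists2 x : R, 0 < x & x ^+ n.+1 = y.
Proof.
move=> y0; exists (y `^ (n.+1%:R^-1)); first exact: powR_gt0.
by rewrite -powR_mulrn ?powR_ge0// -powRrM mulVf ?powRr1 ?(ltW y0)// pnatr_eq0.
Qed.

Lemma distX_le (K a b : R) (n : nat) : 0 <= a <= K -> 0 <= b <= K ->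
  `|a ^+ n.+1 - b ^+ n.+1| <= n.+1%:R * K ^+ n * `|a - b|.
Proof.
move=> /andP[a0 aK] /andP[b0 bK]; rewrite subrXX normrM mulrC ler_wpM2r//.
rewrite (le_trans (ler_norm_sum _ _ _))//.
apply: (@le_trans _ _ (\sum_(i < n.+1) K ^+ n)).
  apply: ler_sum => i _; rewrite ger0_norm ?mulr_ge0 ?exprn_ge0//.
  have -> : K ^+ n = K ^+ (n.+1.-1 - i) * K ^+ i.
    by rewrite -exprD subnK// -ltnS.
  have K0 := le_trans a0 aK.
  apply: ler_pM; rewrite ?exprn_ge0//; apply: lerXn2r; rewrite ?nnegrE//.
by rewrite sumr_const card_ord mulr_natl.
Qed.

End line_integrals.

Section energy_profile.
Variables (R : realType) (m : nat) (tau : 'rV[R]_m).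
Local Notation mu := (lebesgue_rV R m).
Local Notation leb := (@lebesgue_measure R).
Local Notation xi := (covector tau).

Lemma bounded_support_dotr (w : 'rV[R]_m.+1 -> R) : bounded_support w ->
  exists2 B : R, 0 <= B & forall x, w x != 0 -> `|dotr xi x| <= B.
Proof.
move=> [B B0 wB]; exists ((\sum_i `|xi ord0 i|) * B).
  by rewrite mulr_ge0// sumr_ge0.
move=> x /wB xB; rewrite (le_trans (ler_norm_sum _ _ _))// mulr_suml.
apply: ler_sum => i _; rewrite normrM ler_wpM2l//.
exact: le_trans (rV_norm_coord _ _) xB.
Qed.

Lemma energy_support (w : 'rV[R]_m.+1 -> R) : test_function w ->
  exists2 B : R, 0 <= B & forall t, energy tau w t != 0 -> `|t| <= B.
Proof.
move=> /test_bounded_support/bounded_support_dotr[B B0 wB]; exists B => // t.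
apply: contraR => tB; apply/eqP; rewrite /energy.
rewrite -[RHS](mul0r (fine (mu setT))) -Rintegral_cst//.
apply: eq_Rintegral => y _; apply/eqP; rewrite expf_eq0/= normr_eq0.
apply: contraNT tB => /wB; rewrite dotr_covector_slice//.
Qed.

(** Hence the slice energy hardly varies across a thin slab. *)
Lemma energy_lipschitz (w : 'rV[R]_m.+1 -> R) : test_function w ->
  exists2 K : R, 0 <= K & forall t u, `|energy tau w t - energy tau w u| <= K * `|t - u|.
Proof.
move=> tw; have sw := test_smooth tw.
have [B B0 wB] := test_bounded_support tw.
have [K K0 wK] := test_bounded tw.
have /choice[D DP] i : exists D : R, forall x, `|partial i w x| <= D.
  by have [D _ DP] := test_bounded (test_partial i tw); exists D.
pose Lw := m.+1%:R * \sum_i `|D i|.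
have wL x y : `|w x - w y| <= Lw * `|x - y|.
  apply: C1_lipschitz; first exact: smooth_C1.
  move=> i z; rewrite (le_trans (DP i z))// (le_trans (ler_norm _))//.
  by rewrite (bigD1 i)//= lerDl sumr_ge0.
have Lw0 : 0 <= Lw by rewrite mulr_ge0// sumr_ge0.
pose Q := [set y : 'rV[R]_m | `|y| <= B].
have iQ : mu.-integrable setT (EFin \o \1_Q) by exact: integrable_indic_cube.
exists (m.+1%:R * K ^+ m * Lw * \int[mu]_y \1_Q y).
  apply: mulr_ge0; first by rewrite (mulr_ge0 _ Lw0)// mulr_ge0// exprn_ge0.
  by apply: Rintegral_ge0 => y _; rewrite indicE ler0n.
move=> t u; rewrite /energy -RintegralB//; [|exact: energy_integrable..].
have iB := integrable_EFinB measurableT (energy_integrable tau t tw) (energy_integrable tau u tw).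
rewrite (le_trans (le_normr_Rintegral _ iB))// mulrAC -RintegralZl//.
apply: le_Rintegral => //.
- exact: integrable_norm iB.
- exact: (integrable_EFinZl measurableT (m.+1%:R * K ^+ m * Lw * `|t - u|) iQ).
move=> y _; rewrite indicE; have [yQ|yQ] := boolP (y \in Q).
  rewrite mulr1; apply: le_trans (distX_le (K := K) _ _ _) _.
  - by rewrite normr_ge0 wK.
  - by rewrite normr_ge0 wK.
  rewrite -[leRHS]mulrA ler_wpM2l ?mulr_ge0 ?exprn_ge0//.
  rewrite (le_trans (ler_dist_dist _ _))// (le_trans (wL _ _))// ler_wpM2l//.
  apply/rV_norm_leP => // i; rewrite mxE [X in _ + X]mxE.
  case: (unliftP ord0 i) => [j|] ->; first by rewrite !rV_consS subrr normr0.
  rewrite !rV_cons0/= (_ : _ - _ = t - u)//; ring.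
have w0 v : w (slice tau v y) = 0.
  apply/eqP; apply: contraNT yQ => /wB h; rewrite inE/=.
  exact: le_trans (norm_slice_ge _ _ _) h.
by rewrite mulr0 !w0 subrr normr0.
Qed.

Lemma energy_continuous (w : 'rV[R]_m.+1 -> R) : test_function w ->
  continuous (energy tau w).
Proof.
by move=> tw; have [K K0 wK] := energy_lipschitz tw; exact: (@lipschitz_continuous _ R^o _ K).
Qed.

(** Fubini along the slices. *)
Lemma integral_energy (w : 'rV[R]_m.+1 -> R) : test_function w ->
  leb.-integrable setT (EFin \o energy tau w) /\
  \int[leb]_t energy tau w t = \int[lebesgue_rV R m.+1]_x (`|w x| ^+ m.+1).
Proof.
move=> tw; have [B B0 wB] := energy_support tw.
have ie := integrable_continuous_bounded_support1 (energy_continuous tw) wB.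
split => //; rewrite /Rintegral -(ge0_integral_shear tau); last 2 first.
- apply: measurableT_comp => //; apply: measurable_funX.
  by apply: measurableT_comp => //; exact: test_measurable.
- by move=> x; rewrite lee_fin exprn_ge0.
congr fine; apply: eq_integral => t _; rewrite /energy /Rintegral fineK//.
exact: (integrable_fin_num _ (energy_integrable tau t tw)).
Qed.

End energy_profile.

Section partition.
Variable R : realType.
Local Notation leb := (@lebesgue_measure R).

(** Differences of consecutive translates of a smooth step at scale dl: their
    sum telescopes to a plateau. *)
Lemma exists_partition (T dl : R) (J : nat) : 0 < dl -> dl <= 1 -> J%:R * dl = 2 * T ->
  exists th : nat -> R -> R, [/\ forall j, smooth1 (th j), forall j s, 0 <= th j s,
    forall s, \sum_(j < J) th j s <= 1, forall j s, th j s <= 1 &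
    (forall j s, th j s != 0 -> `|s - (j%:R * dl - T)| <= 2 * dl) /\
    forall s, `|s| <= T - 1 -> \sum_(j < J) th j s = 1].
Proof.
move=> dl0 dl1 JT; have [H [sH H0 H1 Hnd H01]] := exists_smooth_step R.
pose u s := dl^-1 * s + dl^-1 * T.
exists (fun j s => H (u s - j%:R) - H (u s - j.+1%:R)).
have sumE s : \sum_(j < J) (H (u s - j%:R) - H (u s - j.+1%:R)) = H (u s) - H (u s - J%:R).
  elim: (J) => [|l IH]; first by rewrite big_ord0 subr0 subrr.
  by rewrite big_ord_recr/= IH addrA subrK.
have uE s j : s - (j%:R * dl - T) = dl * (u s - j%:R).
  by rewrite /u; field; rewrite gt_eqF.
split.
- move=> j; have := smooth1B (smooth1_affine dl^-1 (dl^-1 * T - j%:R) 1 sH)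
    (smooth1_affine dl^-1 (dl^-1 * T - j.+1%:R) 1 sH).
  by congr smooth1; apply/funext => s; rewrite !mul1r /u !addrA.
- by move=> j s; rewrite subr_ge0 Hnd// lerD2l lerN2 ler_nat.
- move=> s; rewrite sumE; have /andP[h1 _] := H01 (u s - J%:R).
  by have /andP[_ h2] := H01 (u s); lra.
- move=> j s; have /andP[h1 _] := H01 (u s - j.+1%:R).
  by have /andP[_ h2] := H01 (u s - j%:R); lra.
split.
- move=> j s; apply: contraNT; rewrite -ltNge uE normrM gtr0_norm// mulrC ltr_pM2l//.
  rewrite -natr1; have [v0|v0] := leP 0 (u s - j%:R).
    by rewrite ger0_norm// => v2; rewrite !H1 ?subrr//; lra.
  by move=> _; rewrite !H0 ?subrr//; lra.
- move=> s; rewrite sumE ler_norml => /andP[s1 s2].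
  have us : dl * u s = s + T by rewrite /u; field; rewrite gt_eqF.
  rewrite H1 ?H0 ?subr0//.
    by rewrite -(ler_pM2l dl0) mulr0 mulrBr us mulrC JT; lra.
  by rewrite -(ler_pM2l dl0) us mulr1; lra.
Qed.

Lemma integrable_supported (th : R -> R) (a r : R) : continuous th ->
  (forall s, th s != 0 -> `|s - a| <= r) -> leb.-integrable setT (EFin \o th).
Proof.
move=> cth thr; apply: (@integrable_continuous_bounded_support1 R th (`|a| + r) cth).
move=> t /thr h; rewrite -[t](subrK a) (le_trans (ler_normD _ _))// addrC.
by rewrite lerD2l.
Qed.

Lemma integral_supported_le (th : R -> R) (a r : R) : continuous th ->
  (forall s, 0 <= th s <= 1) ->
  (forall s, th s != 0 -> `|s - a| <= r) -> 0 <= r -> \int[leb]_s th s <= 2 * r.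
Proof.
move=> cth th01 thr r0; have ith := integrable_supported cth thr.
rewrite -lee_fin /Rintegral fineK ?(integrable_fin_num _ ith)//.
have mI : measurable (`[a - r, a + r]%classic : set (measurableTypeR R)).
  exact: measurable_itv.
apply: (@le_trans _ _ (\int[leb]_s (\1_(`[a - r, a + r]%classic) s)%:E)%E).
  apply: ge0_le_integral => //.
  - by move=> s _; rewrite lee_fin; have /andP[] := th01 s.
  - exact: measurable_int ith.
  - by apply/measurable_EFinP; exact: measurable_indic.
  - move=> s _; rewrite lee_fin indicE; case: (boolP (_ \in _)) => /= sI.
      by have /andP[] := th01 s.
    rewrite le_eqVlt; apply/orP; left; apply: contraNT sI => /thr.
    by rewrite inE/= in_itv/= ler_norml => /andP[h1 h2]; apply/andP; split; lra.
rewrite integral_indic// setIT [X in (X <= _)%E](lebesgue_measure_itv `[a - r, a + r])/= lte_fin.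
by case: ifPn => _; rewrite ?lee_fin; lra.
Qed.

Lemma integral_reflect_le (th : R -> R) (t La : R) : (forall s, 0 <= th s) -> continuous th ->
  leb.-integrable setT (EFin \o th) ->
  \int[leb]_(s in `[0, La]) th (t - s) <= \int[leb]_s th s.
Proof.
move=> th0 cth ith.
have mI : measurable (`[0, La]%classic : set (measurableTypeR R)).
  exact: measurable_itv.
have i1 := @itv_integrable_shift R th t La cth.
have mth := measurable_int _ ith.
rewrite -lee_fin /Rintegral !fineK ?(integrable_fin_num _ ith) ?(integrable_fin_num _ i1)//.
have c0 : (-1 : R) != 0 by rewrite oppr_eq0 oner_eq0.
have := ge0_integral_affine1 t c0 mth (fun s => th0 s).
rewrite normrN1 invr1 mul1e => <-.
have -> : (\int[leb]_(s in `[0%R, La]) (th (t - s))%:E =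
    \int[leb]_(s in `[0%R, La]) (EFin \o th) (t + -1 * s)%R)%E.
  by apply: eq_integral => s _; rewrite /= mulN1r.
apply: ge0_subset_integral => //; last by move=> s _; rewrite lee_fin.
by apply: (measurableT_comp mth); apply: measurable_funD.
Qed.

End partition.

Section scalar_estimate.
Variables (R : realType) (m : nat) (tau : 'rV[R]_m).
Local Notation mu := (lebesgue_rV R m.+1).
Local Notation leb := (@lebesgue_measure R).
Local Notation xi := (covector tau).

Lemma integral_covector_sum_le k : exists2 C : R, 0 <= C &
  forall g : multiindex m.+1 k -> 'rV[R]_m.+1 -> R, weak_solution g ->
  \int[mu]_x `|covector_sum tau g x| <= C * total_mass g.
Proof.
pose P (a : multiindex m.+1 k) : R := `|\prod_i xi ord0 i ^+ val a i|.
have P0 a : 0 <= P a by exact: normr_ge0.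
exists (\sum_a P a); first exact: sumr_ge0.
move=> g wg; have ig := integrable_covector_sum tau wg.
have iag a : mu.-integrable setT (EFin \o (fun x => P a * `|g a x|)).
  exact: (integrable_EFinZl measurableT (P a) (integrable_norm (wg.1 a))).
apply: (@le_trans _ _ (\int[mu]_x \sum_a P a * `|g a x|)).
  apply: le_Rintegral => //; first exact: (integrable_norm ig).
    by apply: integrable_EFin_sum => // a; exact: iag.
  move=> x _; rewrite (le_trans (ler_norm_sum _ _ _))//.
  by apply: ler_sum => a _; rewrite normrM.
rewrite Rintegral_sum// mulr_suml; apply: ler_sum => a _.
rewrite RintegralZl//; last exact: (integrable_norm (wg.1 a)).
rewrite ler_wpM2l// /total_mass (bigD1 a)//= lerDl sumr_ge0// => b _.
exact: Rintegral_ge0.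
Qed.

Definition tang_energy (phi : 'rV[R]_m.+1 -> R) : R :=
  \sum_(j < m) \int[mu]_x (`|tang tau j phi x| ^+ m.+1).

(** On a slab where the slices have energy about y = nu^n, the choice om = t / nu in
    [local_estimate] turns the two error terms into t int |g_xi| th and
    t^-m |g|_1 y int th. Over a partition into slabs the former add up to the L^1 norm
    of g_xi, and the y int th add up to at most 2 t^n. *)
Lemma scalar_estimate k : exists2 C : R, 0 <= C &
  forall (g : multiindex m.+1 k -> 'rV[R]_m.+1 -> R) phi t,
  weak_solution g -> test_function phi -> 0 < t -> tang_energy phi <= t ^+ m.+1 ->
  `|\int[mu]_x (covector_sum tau g x * phi x)| <= C * total_mass g * t.
Proof.
case: k => [|k].
  exists 0 => // g phi t [ig wg] tphi _ _.
  rewrite !mul0r normr_le0; apply/eqP; rewrite -[RHS](wg phi tphi).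
  have [K K0 phK] := test_bounded tphi.
  rewrite (integral_covector_sum tau (conj ig wg) (test_measurable tphi) phK).
  apply: eq_bigr => a _; rewrite big1 ?mul1r; last first.
    by move=> i _; rewrite (ord1 (val a i)) expr0.
  apply: eq_Rintegral => x _; rewrite multi_partialE.
  by have /size0nil -> := size_mseq a.
have [C1 C10 C1P] := local_estimate k tau.
have [C2 C20 C2P] := integral_covector_sum_le k.+1.
exists (C1 * (C2 + 2)); first by rewrite mulr_ge0// addr_ge0.
move=> g phi t wg tphi t0 phit.
pose M s := \sum_(j < m) energy tau (tang tau j phi) s.
have /choice[L_ L_P] j : exists K : R, 0 <= K /\ forall s u,
    `|energy tau (tang tau j phi) s - energy tau (tang tau j phi) u| <= K * `|s - u|.
  by have [K K0 KP] := energy_lipschitz tau (test_tang tau j tphi); exists K.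
pose L := \sum_j L_ j.
have L0 : 0 <= L by apply: sumr_ge0 => j _; exact: (L_P j).1.
have ML s u : M s <= M u + L * `|s - u|.
  rewrite -lerBlDl /M -sumrB mulr_suml; apply: ler_sum => j _.
  exact: le_trans (ler_norm _) ((L_P j).2 _ _).
have iM : leb.-integrable setT (EFin \o M).
  by apply: integrable_EFin_sum => // j; exact: (integral_energy tau (test_tang tau j tphi)).1.
have IM : \int[leb]_s M s = tang_energy phi.
  rewrite /M Rintegral_sum//; last first.
    by move=> j; exact: (integral_energy tau (test_tang tau j tphi)).1.
  by apply: eq_bigr => j _; exact: (integral_energy tau (test_tang tau j tphi)).2.
have M0 s : 0 <= M s by apply: sumr_ge0 => j _; exact: energy_ge0.
have cM : continuous M.
  apply: (@lipschitz_continuous _ R^o _ L) => s u; rewrite ler_norml; apply/andP; split.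
    by rewrite lerNl opprB distrC lerBlDl ML.
  by rewrite lerBlDl ML.
have [B B0 phB] := bounded_support_dotr tau (test_bounded_support tphi).
have [K K0 phK] := test_bounded tphi.
pose T := B + 1; have T0 : 0 < T by rewrite /T ltr_wpDl.
have tn0 : 0 < t ^+ m.+1 by rewrite exprn_gt0.
(* The number J of slabs is so large that the errors of the Riemann sum, Z / J in
   total, are at most t^n, and that the slabs have width at most 1. *)
pose Z := 2 * T * (4 * L + 1) * (8 * T).
have Z0 : 0 <= Z by rewrite !mulr_ge0 ?addr_ge0 ?mulr_ge0 ?(ltW T0).
pose X := 2 * T + Z / t ^+ m.+1.
have X0 : 0 <= X by apply: addr_ge0; [rewrite mulr_ge0 ?(ltW T0)|rewrite divr_ge0 ?(ltW tn0)].
pose J := Num.bound X; have XJ : X < J%:R := archi_boundP X0.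
have J0 : 0 < (J%:R : R) by exact: le_lt_trans XJ.
pose dl := 2 * T / J%:R.
have dl0 : 0 < dl by rewrite divr_gt0// mulr_gt0.
have dl1 : dl <= 1.
  rewrite ler_pdivrMr// mul1r (le_trans _ (ltW XJ))// lerDl.
  by rewrite divr_ge0 ?(ltW tn0).
have JT : J%:R * dl = 2 * T by rewrite mulrC divfK// gt_eqF.
have dlZ : dl * (4 * L + 1) * (8 * T) <= t ^+ m.+1.
  have -> : dl * (4 * L + 1) * (8 * T) = Z / J%:R by rewrite /dl /Z; ring.
  rewrite ler_pdivrMr// mulrC -ler_pdivrMr// (le_trans _ (ltW XJ))// lerDr.
  by rewrite mulr_ge0 ?(ltW T0).
have [th [sth th0 sumth1 th1 [thsupp sumth]]] := exists_partition dl0 dl1 JT.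
have cth j := smooth1_continuous0 (sth j).
pose a (j : nat) : R := j%:R * dl - T.
have ith j := integrable_supported (cth j) (thsupp j).
pose I j := \int[leb]_s th j s.
have I0 j : 0 <= I j by apply: Rintegral_ge0 => s _; exact: th0.
have I4 j : I j <= 4 * dl.
  have -> : 4 * dl = 2 * (2 * dl) by ring.
  apply: (integral_supported_le (cth j) _ (thsupp j)); last by rewrite mulr_ge0 ?(ltW dl0).
  by move=> s; rewrite th0 th1.
(* An upper bound for the energy of all slices of the slab; the last summand keeps
   it positive where the energy vanishes. *)
pose y j := M (a j) + 2 * dl * L + dl.
have y0 j : 0 < y j.
  by rewrite ltr_wpDl// addr_ge0// !mulr_ge0// ltW.
have /choice[nu nuP] j : exists x : R, 0 < x /\ x ^+ m.+1 = y j.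
  by have [x x0 xy] := root_exists m (y0 j); exists x.
have Mloc j s : th j s != 0 -> M s <= M (a j) + 2 * dl * L.
  move=> /thsupp h; rewrite (le_trans (ML s (a j)))// lerD2l mulrC ler_wpM2r//.
have Mloc' j s : th j s != 0 -> M (a j) <= M s + 2 * dl * L.
  move=> /thsupp h; rewrite (le_trans (ML (a j) s))// lerD2l mulrC ler_wpM2r//.
  by rewrite distrC.
pose G := total_mass g; have G0 : 0 <= G by exact: total_mass_ge0.
have icg := integrable_covector_sum tau wg.
have mdot : measurable_fun setT (fun x => dotr xi x) by exact: measurable_dotr.
have mth j : measurable_fun setT (fun x => th j (dotr xi x)).
  by apply: continuous_measurable_rV; exact: (smooth_continuous (smooth_comp_dotr xi (sth j))).
have igth j : mu.-integrable setT (EFin \o (fun x => `|covector_sum tau g x| * th j (dotr xi x))).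
  apply: (@integrable_mul_bounded _ _ _ _ 1) => //; first exact: (integrable_norm icg).
  by move=> x; rewrite ger0_norm.
have loc j : `|\int[mu]_x (covector_sum tau g x * localize tau (th j) phi x)| <=
    C1 * (t * (\int[mu]_x (`|covector_sum tau g x| * th j (dotr xi x))) +
          G * (t ^- m * (y j * I j))).
  have [nu0 nuE] := nuP j.
  have om0 : 0 < t / nu j by rewrite divr_gt0.
  have := C1P g (t / nu j) (nu j) (I j) K (th j) phi wg (th1 j).
  rewrite divfK ?gt_eqF//.
  have -> : (t / nu j) ^- m * nu j * I j = t ^- m * (y j * I j).
    by rewrite -nuE exprMn exprVn invfM invrK exprSr !mulrA.
  apply => La x La0; split => //.
  - move=> i s ths; rewrite nuE; apply: (@le_trans _ _ (M s)).
      by rewrite /M (bigD1 i)//= lerDl sumr_ge0// => l _; exact: energy_ge0.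
    by rewrite (le_trans (Mloc _ _ ths))// lerDl ltW.
  - exact: integral_reflect_le.
have iphi j : mu.-integrable setT (EFin \o (fun x => covector_sum tau g x * localize tau (th j) phi x)).
  have [K' K'0 phK'] := test_bounded (test_localize tau (sth j) tphi).
  apply: (@integrable_mul_bounded _ _ _ _ K' icg); last exact: phK'.
  exact: test_measurable (test_localize tau (sth j) tphi).
have -> : \int[mu]_x (covector_sum tau g x * phi x) =
    \sum_(j < J) \int[mu]_x (covector_sum tau g x * localize tau (th j) phi x).
  rewrite -Rintegral_sum//; apply: eq_Rintegral => x _.
  rewrite -mulr_sumr -mulr_suml.
  have [->|phx] := eqVneq (phi x) 0; first by rewrite !mulr0.
  by rewrite sumth ?mul1r// /T addrK phB.
rewrite (le_trans (ler_norm_sum _ _ _))//.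
apply: (le_trans (ler_sum _ (fun (j : 'I_J) _ => loc j))).
rewrite -mulr_sumr -2!mulrA ler_wpM2l// big_split/= -!mulr_sumr.
have S1 : \sum_(j < J) \int[mu]_x (`|covector_sum tau g x| * th j (dotr xi x)) <= C2 * G.
  apply: le_trans (C2P g wg); rewrite -Rintegral_sum//.
  apply: le_Rintegral => //; last 2 first.
  - exact: (integrable_norm icg).
  - by move=> x _; rewrite -mulr_sumr ler_piMr.
  by apply: integrable_EFin_sum => // j; exact: igth.
have ithM j : leb.-integrable setT (EFin \o (fun s => th j s * M s)).
  apply: (@integrable_supported _ (fun s => th j s * M s) (a j) (2 * dl)).
    by move=> s; apply: continuousM; [exact: cth|exact: cM].
  by move=> s; rewrite mulf_eq0 => /norP[/thsupp].
have yI j : y j * I j <= \int[leb]_s (th j s * M s) + dl * (4 * L + 1) * I j.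
  have ic c : leb.-integrable setT (EFin \o (fun s => c * th j s)).
    exact: (integrable_EFinZl measurableT c (ith j)).
  have -> : y j * I j = M (a j) * I j + (2 * dl * L + dl) * I j by rewrite /y; ring.
  have : M (a j) * I j <= \int[leb]_s (th j s * M s) + 2 * dl * L * I j.
    rewrite /I -!RintegralZl// -RintegralD//; apply: le_Rintegral => //.
      exact: (integrable_EFinD measurableT (ithM j) (ic (2 * dl * L))).
    move=> s _; have [->|ths] := eqVneq (th j s) 0; first by rewrite !mulr0 mul0r addr0.
    by rewrite [th j s * _]mulrC -mulrDl ler_wpM2r// Mloc'.
  have -> : \int[leb]_s (th j s * M s) + dl * (4 * L + 1) * I j =
    \int[leb]_s (th j s * M s) + 2 * dl * L * I j + (2 * dl * L + dl) * I j by ring.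
  by rewrite lerD2r.
have S2 : \sum_(j < J) y j * I j <= 2 * t ^+ m.+1.
  apply: (le_trans (ler_sum _ (fun (j : 'I_J) _ => yI j))).
  have -> : 2 * t ^+ m.+1 = t ^+ m.+1 + t ^+ m.+1 by ring.
  rewrite big_split/=; apply: lerD; last first.
    apply: le_trans dlZ; rewrite -mulr_sumr ler_wpM2l//.
      by rewrite !mulr_ge0 ?addr_ge0 ?mulr_ge0 ?(ltW dl0).
    apply: (le_trans (ler_sum _ (fun (j : 'I_J) _ => I4 j))).
    rewrite sumr_const card_ord -[_ *+ J]mulr_natl mulrCA JT (_ : 4 * (2 * T) = 8 * T)//; ring.
  apply: le_trans phit; rewrite -IM -Rintegral_sum//; apply: le_Rintegral => //.
    by apply: integrable_EFin_sum => // j; exact: ithM.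
  by move=> s _; rewrite -mulr_suml ler_piMl.
have -> : (C2 + 2) * (G * t) = t * (C2 * G) + G * (t ^- m * (2 * t ^+ m.+1)).
  by rewrite exprS; field; rewrite expf_neq0// gt_eqF.
by apply: lerD; rewrite ler_wpM2l ?(ltW t0)// ler_wpM2l// invr_ge0 exprn_ge0// ltW.
Qed.

End scalar_estimate.

(** * Linear algebra *)

Section separating_functionals.
Variables (R : realType) (E : vectType R).
Local Notation b := (vbasis {:E}).

Lemma coord_expansion (e : E) : e = \sum_i coord b i e *: b`_i.
Proof. by rewrite -coord_vbasis ?memvf. Qed.

Lemma coord_sum (x : 'I_(\dim {:E}) -> R) j : coord b j (\sum_i x i *: b`_i) = x j.
Proof. by rewrite coord_sum_free// (basis_free (vbasisP _)). Qed.

(** An injective linear map between finite-dimensional spaces has a left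
    inverse. *)
Lemma separating_functionals (T : finType) (ell : T -> E -> R) :
  (forall c e, ell c e = \sum_i coord b i e * ell c b`_i) ->
  (forall e, (forall c, ell c e = 0) -> e = 0) ->
  exists B : T -> 'I_(\dim {:E}) -> R,
    forall e j, coord b j e = \sum_c B c j * ell c e.
Proof.
move=> lin inj.
pose M := \matrix_(i < \dim {:E}, c < #|T|) ell (enum_val c) b`_i.
have MP (x : 'rV_(\dim {:E})) c : (x *m M) ord0 c =
    ell (enum_val c) (\sum_i x ord0 i *: b`_i).
  rewrite mxE lin; apply: eq_bigr => i _; by rewrite mxE coord_sum.
have /row_freeP[B MB] : row_free M.
  apply/inj_row_free => x xM; apply/rowP => j; rewrite mxE.
  have x0 : \sum_i x ord0 i *: b`_i = 0.
    apply: inj => c; have := congr1 (fun y : 'rV_#|T| => y ord0 (enum_rank c)) xM.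
    by rewrite MP enum_rankK mxE.
  by rewrite -(coord_sum (x ord0) j) x0 linear0.
exists (fun c j => B (enum_rank c) j) => e j.
pose x : 'rV_(\dim {:E}) := \row_i coord b i e.
have xE : \sum_i x ord0 i *: b`_i = e.
  by rewrite [RHS]coord_expansion; apply: eq_bigr => i _; rewrite mxE.
have -> : coord b j e = (x *m (M *m B)) ord0 j by rewrite MB mulmx1 mxE.
rewrite mulmxA mxE (reindex_onto enum_rank enum_val) => [|c _]; last exact: enum_valK.
apply: eq_big => [c|c _]; first by rewrite enum_rankK eqxx.
by rewrite MP enum_rankK xE mulrC.
Qed.

End separating_functionals.

Section euclidean.
Variables (R : realType) (E : vectType R) (dotE : {dot E for idfun}).
Local Notation b := (vbasis {:E}).
Local Notation enorm := (enorm dotE).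

Lemma dotC (u v : E) : dotE u v = dotE v u.
Proof. by rewrite hermC expr0 mul1r. Qed.

Lemma dot_suml (I : Type) (r : seq I) (x : I -> R) (u : I -> E) v :
  dotE (\sum_(i <- r) x i *: u i) v = \sum_(i <- r) x i * dotE (u i) v.
Proof. by rewrite linear_sumlz; apply: eq_bigr => i _; rewrite linearZl_LR. Qed.

Lemma dotZl a (u v : E) : dotE (a *: u) v = a * dotE u v.
Proof. by rewrite linearZl_LR. Qed.

Lemma dotBl (u v w : E) : dotE (u - v) w = dotE u w - dotE v w.
Proof. by rewrite linearBl. Qed.

Lemma dot_coordl (e v : E) : dotE e v = \sum_i coord b i e * dotE b`_i v.
Proof. by rewrite {1}[e]coord_expansion dot_suml. Qed.

Lemma dot_coord (e v : E) :
  dotE e v = \sum_(i < \dim {:E}) \sum_(j < \dim {:E}) dotE b`_i b`_j * (coord b i e * coord b j v).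
Proof.
rewrite dot_coordl; apply: eq_bigr => i _.
rewrite dotC dot_coordl mulr_sumr; apply: eq_bigr => j _.
by rewrite dotC; ring.
Qed.

Lemma dot_ge0 (e : E) : 0 <= dotE e e.
Proof.
have [->|e0] := eqVneq e 0; first by rewrite linear0r.
exact: ltW (neq0_dnorm_gt0 _ e0).
Qed.

Lemma dot_eq0 (e : E) : dotE e e = 0 -> e = 0.
Proof.
move=> d0; apply/eqP; apply: contraT => e0.
have e1 : 0 < dotE e e by exact: (neq0_dnorm_gt0 _ e0).
by move: e1; rewrite d0 ltxx.
Qed.

Lemma enorm_ge0 e : 0 <= enorm e. Proof. exact: sqrtr_ge0. Qed.

Lemma sqr_enorm e : enorm e ^+ 2 = dotE e e.
Proof. by rewrite sqr_sqrtr// dot_ge0. Qed.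

Lemma cauchy_schwarz (u v : E) : `|dotE u v| <= enorm u * enorm v.
Proof.
rewrite -[leRHS]ger0_norm ?mulr_ge0 ?enorm_ge0//.
rewrite -ler_sqr ?nnegrE// -!normrX !ger0_norm ?sqr_ge0// exprMn !sqr_enorm.
have [v0|v0] := eqVneq (dotE v v) 0.
  by rewrite (dot_eq0 v0) linear0r expr0n mulr_ge0 ?dot_ge0.
have vv0 : 0 < dotE v v by rewrite lt_neqAle eq_sym v0 dot_ge0.
have := dot_ge0 (dotE v v *: u - dotE u v *: v).
rewrite dotBl !dotZl [dotE u (_ - _)]dotC [dotE v (_ - _)]dotC !dotBl !dotZl [dotE v u]dotC.
set p := dotE u u; set q := dotE v v; set w := dotE u v => h.
have {h} : 0 <= q * (p * q - w ^+ 2).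
  by rewrite (le_trans h)// le_eqVlt; apply/orP; left; apply/eqP; ring.
by rewrite pmulr_rge0// subr_ge0.
Qed.

(** The functionals e |-> e . b_i separate points because the form is definite; each
    is bounded by the Cauchy-Schwarz inequality. *)
Lemma coord_le_enorm : exists2 C : R, 0 <= C & forall j e, `|coord b j e| <= C * enorm e.
Proof.
have [||B BP] := @separating_functionals R E 'I_(\dim {:E}) (fun i e => dotE e b`_i).
- by move=> c e; exact: dot_coordl.
- by move=> e e0; apply: dot_eq0; rewrite dot_coordl big1// => i _; rewrite dotC e0 mulr0.
exists (\sum_j \sum_i `|B i j| * enorm b`_i).
  by apply: sumr_ge0 => j _; apply: sumr_ge0 => i _; rewrite mulr_ge0 ?enorm_ge0.
move=> j e; apply: (@le_trans _ _ ((\sum_i `|B i j| * enorm b`_i) * enorm e)); last first.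
  rewrite ler_wpM2r ?enorm_ge0// [leRHS](bigD1 j)//= lerDl; apply: sumr_ge0 => l _.
  by apply: sumr_ge0 => i _; rewrite mulr_ge0 ?enorm_ge0.
rewrite BP (le_trans (ler_norm_sum _ _ _))// mulr_suml; apply: ler_sum => i _.
by rewrite normrM -mulrA ler_wpM2l// mulrC cauchy_schwarz.
Qed.

Lemma enorm_le_coord : exists2 C : R, 0 <= C & forall e,
  enorm e <= C * \sum_j `|coord b j e|.
Proof.
pose K := \sum_(i < \dim {:E}) \sum_(j < \dim {:E}) `|dotE b`_i b`_j|.
have K0 : 0 <= K by apply: sumr_ge0 => i _; exact: sumr_ge0.
exists (Num.sqrt K); first exact: sqrtr_ge0.
move=> e; set S := \sum_j _; have S0 : 0 <= S by exact: sumr_ge0.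
have cS j : `|coord b j e| <= S by rewrite /S (bigD1 j)//= lerDl sumr_ge0.
rewrite -[S]ger0_norm// -sqrtr_sqr -sqrtrM// /enorm ler_sqrt ?mulr_ge0 ?sqr_ge0//.
rewrite dot_coord /K mulr_suml; apply: ler_sum => i _.
rewrite mulr_suml; apply: ler_sum => j _.
rewrite (le_trans (ler_norm _))// normrM ler_wpM2l// normrM expr2.
by apply: ler_pM.
Qed.

End euclidean.

Section kronecker.

(** Uniqueness of the expansion in base K. *)
Lemma digits_inj (K m : nat) (a a' : 'I_m -> nat) :
  (forall j, a j < K)%N -> (forall j, a' j < K)%N ->
  (\sum_(j < m) a j * K ^ j = \sum_(j < m) a' j * K ^ j)%N -> a =1 a'.
Proof.
elim: m a a' => [|m IH] a a' aK aK' E j; first by case: j.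
have K0 : (0 < K)%N by apply: leq_ltn_trans (aK ord0).
have rec (c : 'I_m.+1 -> nat) : (\sum_(j < m.+1) c j * K ^ j =
    c ord0 + (\sum_(j < m) c (lift ord0 j) * K ^ j) * K)%N.
  rewrite big_ord_recl muln1 big_distrl/=; congr addn; apply: eq_bigr => i _.
  by rewrite /bump add1n expnS mulnA mulnAC.
rewrite !rec in E.
have E0 : a ord0 = a' ord0.
  have := congr1 (modn^~ K) E.
  by rewrite ![(_ + _ * K)%N]addnC !modnMDl !modn_small.
have E1 : (\sum_(j < m) a (lift ord0 j) * K ^ j = \sum_(j < m) a' (lift ord0 j) * K ^ j)%N.
  have := congr1 (divn^~ K) E.
  by rewrite ![(_ + _ * K)%N]addnC !divnMDl// !divn_small// !addn0.
case: (unliftP ord0 j) => [i|] -> //.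
by apply: (IH (fun i => a (lift ord0 i)) (fun i => a' (lift ord0 i))).
Qed.

Variables (R : realType) (m k : nat).

(** The Kronecker substitution: as all entries of a multi-index are at most k, the
    monomial of the multi-index a at (1, kronecker_point r) is r to a power whose digits
    in base k + 1 are the entries of a other than the first, which the others determine. *)
Definition kronecker_point (r : nat) : 'rV[R]_m := \row_j r%:R ^+ (k.+1 ^ j).

Definition kronecker_exponent (a : multiindex m.+1 k) : nat :=
  (\sum_(j < m) val a (lift ord0 j) * k.+1 ^ j)%N.

Lemma kronecker_exponent_inj : injective kronecker_exponent.
Proof.
move=> a a' /digits_inj E.
have {}E j : val a (lift ord0 j) = val a' (lift ord0 j).
  by apply/val_inj/(E _ _ j) => i; exact: ltn_ord.
apply/val_inj/ffunP => i; case: (unliftP ord0 i) => [j|] -> //.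
have := etrans (eqP (valP a)) (esym (eqP (valP a'))); rewrite !big_ord_recl/=.
under eq_bigr do rewrite E.
by move/addIn/val_inj.
Qed.

Lemma prod_kronecker_point r (a : multiindex m.+1 k) :
  \prod_i covector (kronecker_point r) ord0 i ^+ val a i =
  r%:R ^+ kronecker_exponent a.
Proof.
rewrite big_ord_recl covector0 expr1n mul1r expr_sum.
by apply: eq_bigr => j _; rewrite covectorS mxE -exprM mulnC.
Qed.

Definition kronecker_size := (\max_(a : multiindex m.+1 k) kronecker_exponent a).+1.

Variables (E F : vectType R) (L : hom_diffop m.+1 k E F).

Lemma symbolE xi e : symbol L xi e =
  \sum_(a : multiindex m.+1 k) (\prod_i xi ord0 i ^+ val a i) *: L a e.
Proof. by rewrite /symbol sum_lfunE; apply: eq_bigr => a _; rewrite scale_lfunE. Qed.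

(** Each coordinate of the symbol along the Kronecker points is a polynomial in
    r with more roots than its degree, and its coefficients are the coordinates of
    the L a e, without overlap. *)
Lemma symbol_kronecker_eq0 e :
  (forall r : 'I_kronecker_size, symbol L (covector (kronecker_point r)) e = 0) ->
  forall a, L a e = 0.
Proof.
move=> Le a0; rewrite [LHS]coord_expansion big1// => l _.
pose c (a : multiindex m.+1 k) : R := coord (vbasis {:F}) l (L a e).
suff -> : coord (vbasis {:F}) l (L a0 e) = 0 by rewrite scale0r.
rewrite -/(c a0).
pose p : {poly R} := \sum_(a : multiindex m.+1 k) c a *: 'X^(kronecker_exponent a).
have sp : (size p <= kronecker_size)%N.
  apply: (leq_trans (size_sum _ _ _)); apply/bigmax_leqP => a _.
  rewrite (leq_trans (size_scale_leq _ _))// size_polyXn ltnS.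
  exact: leq_bigmax.
have rp r : (r < kronecker_size)%N -> root p r%:R.
  move=> rN; apply/eqP; rewrite horner_sum.
  have := congr1 (coord (vbasis {:F}) l) (Le (Ordinal rN)).
  rewrite symbolE linear_sum linear0 => H; rewrite -[RHS]H; apply: eq_bigr => a _.
  by rewrite !hornerE linearZ prod_kronecker_point mulrC.
have p0 : p = 0.
  apply/eqP; apply: contraT => pN0.
  have := @max_poly_roots _ p [seq r%:R | r <- iota 0 kronecker_size] pN0.
  rewrite size_map size_iota ltnNge sp; apply.
    by apply/allP => _ /mapP[r + ->]; rewrite mem_iota add0n => /andP[_]; exact: rp.
  rewrite map_inj_uniq ?iota_uniq// => r s /eqP; rewrite eqr_nat => /eqP//.
have := congr1 (fun q : {poly R} => q`_(kronecker_exponent a0)) p0.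
rewrite coef0 coef_sum (bigD1 a0)//= coefZ coefXn eqxx mulr1 big1 ?addr0//.
move=> a aa0; rewrite coefZ coefXn (inj_eq kronecker_exponent_inj) eq_sym.
by rewrite (negbTE aa0) mulr0.
Qed.

Lemma cocanceling_kronecker : cocanceling L -> forall e,
  (forall r : 'I_kronecker_size, symbol L (covector (kronecker_point r)) e = 0) -> e = 0.
Proof.
move=> cL e /symbol_kronecker_eq0 Le.
have : [set 0] e; last by [].
rewrite -cL => xi _ /=; rewrite memv_ker symbolE big1// => a _.
by rewrite Le scaler0.
Qed.

Lemma cancelingP (e : E) : (forall xi, xi != 0 -> symbol L xi e = 0) ->
  forall a, L a e = 0.
Proof.
move=> Le; apply: symbol_kronecker_eq0 => r; apply: Le.
apply/eqP => /(congr1 (fun y : 'rV_m.+1 => y ord0 ord0)).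
by rewrite covector0 mxE => /eqP; rewrite oner_eq0.
Qed.

End kronecker.

(** * Cocancellation implies the estimate *)

Section vector_fields.
Variables (R : realType) (n : nat) (E : vectType R) (dotE : {dot E for idfun}).
Local Notation mu := (lebesgue_rV R n).
Local Notation b := (vbasis {:E}).
Implicit Types (f phi : 'rV[R]_n -> E).

Lemma measurable_sqrt : measurable_fun setT (@Num.sqrt R).
Proof. by apply: continuous_measurable_fun; exact: sqrt_continuous. Qed.

Lemma vtest_coord phi j : vtest_function phi -> test_function (coordf phi j).
Proof.
move=> [sphi cphi]; split; first exact: sphi.
apply: (subclosed_compact _ cphi); first exact: closed_closure.
apply: closureS => x /=; apply: contra => /eqP phx.
by rewrite /coordf phx linear0.
Qed.

Lemma coordf_vpartial i phi j : coordf (vpartial i phi) j = partial i (coordf phi j).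
Proof. by apply/funext => x; rewrite /coordf coord_sum. Qed.

Lemma measurable_enorm f : (forall j, measurable_fun setT (coordf f j)) ->
  measurable_fun setT (fun x => enorm dotE (f x)).
Proof.
move=> mf; apply: (measurableT_comp measurable_sqrt).
rewrite (_ : (fun x => _) = fun x => \sum_(i < \dim {:E}) \sum_(j < \dim {:E})
    dotE b`_i b`_j * (coordf f i x * coordf f j x)); last first.
  by apply/funext => x; rewrite dot_coord.
apply: measurable_sum => i; apply: measurable_sum => j.
by apply: measurable_funM => //; exact: measurable_funM.
Qed.

Lemma measurable_Dnorm phi : vtest_function phi -> measurable_fun setT (Dnorm dotE phi).
Proof.
move=> tphi; apply: (measurableT_comp measurable_sqrt).
apply: measurable_sum => i; apply: measurable_funX; apply: measurable_enorm => j.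
rewrite coordf_vpartial; apply: test_measurable.
by apply: test_partial; exact: vtest_coord.
Qed.

Lemma Dnorm_ge0 phi x : 0 <= Dnorm dotE phi x. Proof. exact: sqrtr_ge0. Qed.

Lemma enorm_vpartial_le i phi x : enorm dotE (vpartial i phi x) <= Dnorm dotE phi x.
Proof.
rewrite -[leLHS]ger0_norm ?enorm_ge0// -sqrtr_sqr /Dnorm ler_sqrt; last first.
  by apply: sumr_ge0 => l _; exact: sqr_ge0.
by rewrite (bigD1 i)//= lerDl sumr_ge0// => l _; exact: sqr_ge0.
Qed.

Lemma Dnorm_le phi x : Dnorm dotE phi x <= \sum_i enorm dotE (vpartial i phi x).
Proof.
set S := \sum_i _.
have S0 : 0 <= S by apply: sumr_ge0 => i _; exact: enorm_ge0.
rewrite -[S]ger0_norm// -sqrtr_sqr /Dnorm ler_sqrt ?sqr_ge0// expr2 {1}/S mulr_suml.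
apply: ler_sum => i _; rewrite expr2 ler_wpM2l ?enorm_ge0// /S (bigD1 i)//= lerDl.
by apply: sumr_ge0 => l _; exact: enorm_ge0.
Qed.

Lemma partial_coordf_le : exists2 C : R, 0 <= C & forall phi i j x,
  `|partial i (coordf phi j) x| <= C * Dnorm dotE phi x.
Proof.
have [C C0 CP] := coord_le_enorm dotE; exists C => // phi i j x.
rewrite -coordf_vpartial (le_trans (CP _ _))// ler_wpM2l//.
exact: enorm_vpartial_le.
Qed.

Lemma Dnorm_bounded phi : vtest_function phi ->
  exists2 K : R, 0 <= K & forall x, Dnorm dotE phi x <= K.
Proof.
move=> tphi; have [C C0 CP] := enorm_le_coord dotE.
have /choice[K KP] (c : 'I_n * 'I_(\dim {:E})) : exists K : R, forall x,
    `|partial c.1 (coordf phi c.2) x| <= K.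
  by have [K _ KP] := test_bounded (test_partial c.1 (vtest_coord c.2 tphi)); exists K.
have K0 c : 0 <= K c by exact: le_trans (KP c 0).
exists (\sum_i C * \sum_j K (i, j)).
  by apply: sumr_ge0 => i _; rewrite mulr_ge0// sumr_ge0.
move=> x; rewrite (le_trans (Dnorm_le _ _))//; apply: ler_sum => i _.
rewrite (le_trans (CP _))// ler_wpM2l//; apply: ler_sum => j _.
rewrite -[coord _ _ _]/(coordf (vpartial i phi) j x) coordf_vpartial.
exact: KP (i, j) x.
Qed.

Lemma Dnorm_bounded_support phi : vtest_function phi -> bounded_support (Dnorm dotE phi).
Proof.
move=> tphi.
have /choice[B BP] (c : 'I_n * 'I_(\dim {:E})) : exists B : R, 0 <= B /\
    forall x, partial c.1 (coordf phi c.2) x != 0 -> `|x| <= B.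
  have [B B0 BP] := test_bounded_support (test_partial c.1 (vtest_coord c.2 tphi)).
  by exists B.
exists (\sum_c B c); first by apply: sumr_ge0 => c _; exact: (BP c).1.
move=> x; apply: contraR => xB.
have p0 c : partial c.1 (coordf phi c.2) x = 0.
  apply/eqP; apply: contraNT xB => /((BP c).2) xB; rewrite (le_trans xB)//.
  by rewrite (bigD1 c)//= lerDl sumr_ge0// => d _; exact: (BP d).1.
rewrite /Dnorm big1 ?sqrtr0// => i _; rewrite (_ : vpartial i phi x = 0).
  by rewrite /enorm linear0r sqrtr0 expr0n.
by rewrite /vpartial big1// => j _; rewrite (p0 (i, j)) scale0r.
Qed.

Lemma integrable_DnormX phi : (0 < n)%N -> vtest_function phi ->
  mu.-integrable setT (EFin \o (fun x => Dnorm dotE phi x ^+ n)).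
Proof.
move=> n0 tphi; apply: integrable_bounded_support.
- by apply: measurable_funX; exact: measurable_Dnorm.
- have [B B0 BP] := Dnorm_bounded_support tphi; exists B => // x.
  by rewrite expf_eq0 n0 => /BP.
- have [K K0 KP] := Dnorm_bounded tphi; exists (K ^+ n); first exact: exprn_ge0.
  move=> x; rewrite ger0_norm ?exprn_ge0 ?Dnorm_ge0// lerXn2r ?nnegrE//.
  exact: Dnorm_ge0.
Qed.

Lemma LnormD_EFin phi : (0 < n)%N -> vtest_function phi ->
  exists d : R, [/\ 0 <= d, LnormD dotE phi = d%:E &
    d ^+ n = \int[mu]_x (Dnorm dotE phi x ^+ n)].
Proof.
move=> n0 tphi; have iD := integrable_DnormX n0 tphi.
set D := \int[mu]_x _.
have D0 : 0 <= D by apply: Rintegral_ge0 => x _; rewrite exprn_ge0 ?Dnorm_ge0.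
exists (D `^ (n%:R^-1)); split; first exact: powR_ge0.
  rewrite /LnormD unlock /= (_ : integral _ _ _ = D%:E)// /D.
  rewrite /Rintegral fineK; last exact: (integrable_fin_num _ iD).
  apply: eq_integral => x _ /=.
  by rewrite ger0_norm ?Dnorm_ge0// powR_mulrn ?Dnorm_ge0.
by rewrite -powR_mulrn ?powR_ge0// -powRrM mulVf ?powRr1// pnatr_eq0 -lt0n.
Qed.

Lemma L1norm_EFin f : in_L1 dotE f ->
  mu.-integrable setT (EFin \o (fun x => enorm dotE (f x))) /\
  L1norm dotE f = (\int[mu]_x enorm dotE (f x))%:E.
Proof.
move=> [mf]; rewrite /L1norm Lnorm1 => foo.
have E0 : (\int[mu]_x `|(EFin \o (enorm dotE \o f)) x| =
    \int[mu]_x (enorm dotE (f x))%:E)%E.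
  by apply: eq_integral => x _; rewrite /= ger0_norm ?enorm_ge0.
have iE : mu.-integrable setT (EFin \o (fun x => enorm dotE (f x))).
  apply/integrableP; split; last exact: foo.
  by apply/measurable_EFinP; exact: measurable_enorm.
by split => //; rewrite E0 /Rintegral fineK//; exact: (integrable_fin_num _ iE).
Qed.

Lemma linear_le_enorm (ell : E -> R) :
  (forall e, ell e = \sum_i coord b i e * ell b`_i) ->
  exists2 K : R, 0 <= K & forall e, `|ell e| <= K * enorm dotE e.
Proof.
move=> lin; have [C C0 CP] := coord_le_enorm dotE.
exists (\sum_(i < \dim {:E}) C * `|ell b`_i|).
  by apply: sumr_ge0 => i _; exact: mulr_ge0.
move=> e; rewrite lin (le_trans (ler_norm_sum _ _ _))// mulr_suml.
by apply: ler_sum => i _; rewrite normrM mulrAC ler_wpM2r.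
Qed.

Lemma integrable_linear_L1 f (ell : E -> R) (K : R) : in_L1 dotE f ->
  (forall e, ell e = \sum_i coord b i e * ell b`_i) ->
  (forall e, `|ell e| <= K * enorm dotE e) ->
  mu.-integrable setT (EFin \o (fun x => ell (f x))) /\
  \int[mu]_x `|ell (f x)| <= K * \int[mu]_x enorm dotE (f x).
Proof.
move=> /[dup] lf [mf _] lin ellK; have [ie _] := L1norm_EFin lf.
have iK : mu.-integrable setT (EFin \o (fun x => K * enorm dotE (f x))).
  exact: (integrable_EFinZl measurableT K ie).
have il : mu.-integrable setT (EFin \o (fun x => ell (f x))).
  apply: (le_integrable measurableT _ _ iK) => [|x _].
    apply/measurable_EFinP; under eq_fun do rewrite lin.
    apply: measurable_sum => i; apply: measurable_funM; last exact: measurable_cst.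
    exact: mf.
  by rewrite lee_fin (le_trans (ellK _))// ler_norm.
split=> //; rewrite -RintegralZl//; apply: le_Rintegral => //.
exact: (integrable_norm il).
Qed.

Lemma coord_linear j e : coord b j e = \sum_i coord b i e * coord b j b`_i.
Proof.
by rewrite {1}[e]coord_expansion linear_sum; apply: eq_bigr => i _; rewrite linearZ.
Qed.

Lemma integrable_coordf f j : in_L1 dotE f -> mu.-integrable setT (EFin \o coordf f j).
Proof.
have [C _ CP] := coord_le_enorm dotE => lf.
exact: (integrable_linear_L1 lf (coord_linear j) (CP j)).1.
Qed.

End vector_fields.

Section cocanceling_estimate.
Variables (R : realType) (m k : nat) (E F : vectType R).
Variables (dotE : {dot E for idfun}) (L : hom_diffop m.+1 k E F).
Local Notation mu := (lebesgue_rV R m.+1).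
Local Notation bE := (vbasis {:E}).
Local Notation bF := (vbasis {:F}).
Implicit Types (f phi : 'rV[R]_m.+1 -> E).

Definition coef_density (l : 'I_(\dim {:F})) f (a : multiindex m.+1 k)
  (x : 'rV[R]_m.+1) : R := coord bF l (L a (f x)).

Lemma coord_lfun_expansion (A : 'Hom(E, F)) l e :
  coord bF l (A e) = \sum_i coord bE i e * coord bF l (A bE`_i).
Proof.
rewrite {1}[e]coord_expansion !linear_sum; apply: eq_bigr => i _.
by rewrite !linearZ.
Qed.

Lemma weak_solution_coef_density l f : in_L1 dotE f -> diffop_eq0 L f ->
  weak_solution (coef_density l f).
Proof.
move=> lf Lf; split=> [a|psi tpsi].
  have [K _ KP] := linear_le_enorm dotE (coord_lfun_expansion (L a) l).
  exact: (integrable_linear_L1 lf (coord_lfun_expansion (L a) l) KP).1.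
have tp (a : multiindex m.+1 k) : test_function (multi_partial a psi).
  rewrite (_ : multi_partial a psi = iter_partial (mseq a) psi).
    exact: test_iter_partial.
  exact: multi_partialE.
have ifp j (a : multiindex m.+1 k) : mu.-integrable setT (EFin \o (fun x => coordf f j x * multi_partial a psi x)).
  have [K _ KP] := test_bounded (tp a).
  exact: (integrable_mul_bounded (integrable_coordf j lf) (test_measurable (tp a)) KP).
have E0 : \sum_(a : multiindex m.+1 k) L a (vint (fun x => multi_partial a psi x *: f x)) = 0.
  have := Lf psi tpsi; rewrite /diffop_distribution.
  under eq_bigr do rewrite linearZ.
  by rewrite -scaler_sumr => /eqP; rewrite scaler_eq0 signr_eq0 => /eqP.
rewrite -[RHS](linear0 (coord bF l)) -[in RHS]E0 linear_sum; apply: eq_bigr => a _.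
rewrite /vint linear_sum linear_sum.
transitivity (\int[mu]_x (\sum_(j < \dim {:E}) coord bF l (L a bE`_j) * (coordf f j x * multi_partial a psi x))).
  apply: eq_Rintegral => x _; rewrite /coef_density coord_lfun_expansion mulr_suml.
  by apply: eq_bigr => j _; rewrite /coordf; ring.
rewrite Rintegral_sum//; last first.
  move=> j; exact: (integrable_EFinZl measurableT (coord bF l (L a bE`_j)) (ifp j a)).
apply: eq_bigr => j _; rewrite !linearZ RintegralZl//= mulrC; congr (_ * _).
by apply: eq_Rintegral => x _; rewrite /coordf linearZ/= mulrC.
Qed.

Lemma total_mass_coef_density : exists2 C : R, 0 <= C & forall l f,
  in_L1 dotE f -> total_mass (coef_density l f) <= C * \int[mu]_x enorm dotE (f x).
Proof.
have /choice[K KP] (c : 'I_(\dim {:F}) * multiindex m.+1 k) : exists K : R, 0 <= K /\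
    forall e, `|coord bF c.1 (L c.2 e)| <= K * enorm dotE e.
  have [K K0 KP] := linear_le_enorm dotE (coord_lfun_expansion (L c.2) c.1).
  by exists K.
exists (\sum_l \sum_a K (l, a)).
  by apply: sumr_ge0 => l _; apply: sumr_ge0 => a _; exact: (KP (l, a)).1.
move=> l f lf; have I0 : 0 <= \int[mu]_x enorm dotE (f x).
  by apply: Rintegral_ge0 => x _; exact: enorm_ge0.
apply: (@le_trans _ _ ((\sum_a K (l, a)) * \int[mu]_x enorm dotE (f x))); last first.
  rewrite ler_wpM2r// [leRHS](bigD1 l)//= lerDl; apply: sumr_ge0 => l' _.
  by apply: sumr_ge0 => a _; exact: (KP (l', a)).1.
rewrite mulr_suml; apply: ler_sum => a _.
exact: (integrable_linear_L1 lf (coord_lfun_expansion (L a) l) (KP (l, a)).2).2.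
Qed.

Lemma covector_sum_coef_density tau l f x :
  covector_sum tau (coef_density l f) x = coord bF l (symbol L (covector tau) (f x)).
Proof.
rewrite symbolE linear_sum; apply: eq_bigr => a _; by rewrite linearZ.
Qed.

(** A tangential derivative is a combination of two partial derivatives. *)
Lemma tang_energy_coordf_le (tau : 'rV[R]_m) : exists2 K : R, 0 <= K & forall phi j,
  vtest_function phi ->
  tang_energy tau (coordf phi j) <= K * \int[mu]_x (Dnorm dotE phi x ^+ m.+1).
Proof.
have [C C0 CP] := @partial_coordf_le R m.+1 E dotE.
pose K i : R := (C * (1 + `|tau ord0 i|)) ^+ m.+1.
exists (\sum_i K i).
  by apply: sumr_ge0 => i _; rewrite exprn_ge0// mulr_ge0// addr_ge0.
move=> phi j tphi; have iD := integrable_DnormX dotE (ltn0Sn m) tphi.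
rewrite mulr_suml; apply: ler_sum => i _.
have tj := test_tang tau i (vtest_coord j tphi).
rewrite -RintegralZl//; apply: le_Rintegral => //.
- apply: integrable_bounded_support.
  + by apply: measurable_funX; apply: measurableT_comp => //; exact: test_measurable.
  + have [B B0 BP] := test_bounded_support tj; exists B => // x.
    by rewrite expf_eq0/= normr_eq0 => /BP.
  + have [B B0 BP] := test_bounded tj; exists (B ^+ m.+1); first exact: exprn_ge0.
    by move=> x; rewrite ger0_norm ?exprn_ge0// lerXn2r ?nnegrE.
- exact: (integrable_EFinZl measurableT (K i) iD).
move=> x _; rewrite -exprMn lerXn2r ?nnegrE ?mulr_ge0 ?addr_ge0 ?Dnorm_ge0//.
rewrite /tang (le_trans (ler_normB _ _))// normrM.
have -> : C * (1 + `|tau ord0 i|) * Dnorm dotE phi x =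
  C * Dnorm dotE phi x + `|tau ord0 i| * (C * Dnorm dotE phi x) by ring.
by rewrite lerD// ler_wpM2l.
Qed.

(** The vectors L(xi_r) e at the Kronecker covectors determine e, so the coordinates
    of f are combinations of functions to which [scalar_estimate] applies. *)
Lemma coordf_pairing_estimate : cocanceling L -> exists2 C : R, 0 <= C &
  forall f phi d i j, in_L1 dotE f -> diffop_eq0 L f -> vtest_function phi ->
  0 <= d -> d ^+ m.+1 = \int[mu]_x (Dnorm dotE phi x ^+ m.+1) ->
  `|\int[mu]_x (coordf f i x * coordf phi j x)| <=
    C * (\int[mu]_x enorm dotE (f x)) * d.
Proof.
move=> cL.
pose T : finType := ('I_(kronecker_size m k) * 'I_(\dim {:F}))%type.
pose tau (c : T) : 'rV[R]_m := kronecker_point R m k c.1.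
have [||B BP] := @separating_functionals R E T
    (fun c e => coord bF c.2 (symbol L (covector (tau c)) e)).
- by move=> c e; exact: coord_lfun_expansion.
- move=> e Le; apply: (cocanceling_kronecker cL) => r.
  by rewrite [LHS]coord_expansion big1// => l _; rewrite (Le (r, l)) scale0r.
have /choice[C_ C_P] (c : T) : exists C : R, 0 <= C /\
    forall (g : multiindex m.+1 k -> 'rV[R]_m.+1 -> R) u t,
    weak_solution g -> test_function u -> 0 < t -> tang_energy (tau c) u <= t ^+ m.+1 ->
    `|\int[mu]_x (covector_sum (tau c) g x * u x)| <= C * total_mass g * t.
  by have [C C0 CP] := scalar_estimate (tau c) k; exists C.
have /choice[K_ K_P] (c : T) : exists K : R, 0 <= K /\ forall phi j,
    vtest_function phi ->
    tang_energy (tau c) (coordf phi j) <= K * \int[mu]_x (Dnorm dotE phi x ^+ m.+1).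
  by have [K K0 KP] := tang_energy_coordf_le (tau c); exists K.
have [G G0 GP] := total_mass_coef_density.
have K_0 c := (K_P c).1; have C_0 c := (C_P c).1.
(* The summand 1 makes K <= K ^ n. *)
pose K := 1 + \sum_c K_ c.
have K1 : 1 <= K by rewrite lerDl sumr_ge0.
have K0 : 0 <= K by exact: le_trans K1.
pose C := \sum_c \sum_i `|B c i| * (C_ c * G).
have C0 : 0 <= C by do 2 (apply: sumr_ge0 => ? _); rewrite !mulr_ge0.
exists (C * K); first exact: mulr_ge0.
move=> f phi d i j lf Lf tphi d0 dE.
set I := \int[mu]_x enorm dotE (f x).
have I0 : 0 <= I by apply: Rintegral_ge0 => x _; exact: enorm_ge0.
(* The scalar estimate asks for a positive bound, whereas d may be 0. *)
have key t : 0 < t -> K * d <= t ->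
    `|\int[mu]_x (coordf f i x * coordf phi j x)| <= C * I * t.
  move=> t0 Kdt.
  have tE c : tang_energy (tau c) (coordf phi j) <= t ^+ m.+1.
    rewrite (le_trans ((K_P c).2 _ _ tphi))// -dE.
    apply: (@le_trans _ _ ((K * d) ^+ m.+1)); last first.
      by rewrite lerXn2r ?nnegrE ?mulr_ge0 ?(ltW t0).
    rewrite exprMn ler_wpM2r ?exprn_ge0//.
    apply: (@le_trans _ _ K); last by rewrite ler_eXnr.
    by rewrite /K (bigD1 c)//= addrCA lerDl addr_ge0// sumr_ge0.
  have tphij := vtest_coord j tphi.
  have ws l := weak_solution_coef_density l lf Lf.
  have icp c : mu.-integrable setT (EFin \o (fun x =>
      covector_sum (tau c) (coef_density c.2 f) x * coordf phi j x)).
    have [Kp _ KpP] := test_bounded tphij.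
    apply: (integrable_mul_bounded _ (test_measurable tphij) KpP).
    exact: (integrable_covector_sum _ (ws c.2)).
  have -> : \int[mu]_x (coordf f i x * coordf phi j x) =
      \sum_c B c i * \int[mu]_x (covector_sum (tau c) (coef_density c.2 f) x * coordf phi j x).
    under [RHS]eq_bigr => c _ do rewrite -RintegralZl//.
    rewrite -Rintegral_sum//; last first.
      move=> c; exact: (integrable_EFinZl measurableT (B c i) (icp c)).
    apply: eq_Rintegral => x _; rewrite {1}/coordf BP mulr_suml.
    by apply: eq_bigr => c _; rewrite covector_sum_coef_density mulrA.
  rewrite (le_trans (ler_norm_sum _ _ _))// -mulrA mulr_suml; apply: ler_sum => c _.
  rewrite normrM.
  apply: (@le_trans _ _ (`|B c i| * (C_ c * G) * (I * t))); last first.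
    rewrite ler_wpM2r ?mulr_ge0 ?(ltW t0)// [leRHS](bigD1 i)//= lerDl.
    by apply: sumr_ge0 => l _; rewrite !mulr_ge0.
  rewrite -!mulrA ler_wpM2l//.
  rewrite (le_trans ((C_P c).2 _ _ _ (ws c.2) tphij t0 (tE c)))// -mulrA ler_wpM2l//.
  by rewrite mulrA ler_wpM2r ?(ltW t0)//; exact: GP.
apply/ler_addgt0Pr => e e0.
have CI0 : 0 <= C * I by rewrite mulr_ge0.
have t0 : 0 < K * d + e / (C * I + 1).
  by rewrite ltr_wpDl ?mulr_ge0// divr_gt0// ltr_wpDl.
apply: le_trans (key _ t0 _) _.
  by rewrite lerDl divr_ge0 ?(ltW e0)// addr_ge0.
rewrite mulrDr (_ : C * I * (K * d) = C * K * I * d); last by ring.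
rewrite lerD2l mulrCA ler_piMr ?(ltW e0)// ler_pdivrMr ?mul1r ?lerDl//.
by rewrite ltr_wpDl.
Qed.

Lemma cocanceling_estimate : cocanceling L -> exists C : R, 0 < C /\
  forall f phi, in_L1 dotE f -> diffop_eq0 L f -> vtest_function phi ->
    (\int[mu]_x (dotE (f x) (phi x))%:E
       <= C%:E * L1norm dotE f * LnormD dotE phi)%E.
Proof.
move=> /coordf_pairing_estimate[C C0 CP].
pose G : R := \sum_(i < \dim {:E}) \sum_(j < \dim {:E}) `|dotE bE`_i bE`_j|.
have G0 : 0 <= G by do 2 (apply: sumr_ge0 => ? _).
exists (G * C + 1); split; first by rewrite ltr_wpDl// mulr_ge0.
move=> f phi lf Lf tphi.
have [d [d0 -> dE]] := LnormD_EFin dotE (ltn0Sn m) tphi.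
have [ie ->] := L1norm_EFin lf; set I := \int[mu]_x enorm dotE (f x).
have I0 : 0 <= I by apply: Rintegral_ge0 => x _; exact: enorm_ge0.
have ifp i j : mu.-integrable setT (EFin \o (fun x => coordf f i x * coordf phi j x)).
  have tphij := vtest_coord j tphi.
  have [K _ KP] := test_bounded tphij.
  apply: (integrable_mul_bounded _ (test_measurable tphij) KP).
  exact: integrable_coordf lf.
have igp (i j : 'I_(\dim {:E})) : mu.-integrable setT (EFin \o
    (fun x => dotE bE`_i bE`_j * (coordf f i x * coordf phi j x))).
  exact: (integrable_EFinZl measurableT (dotE bE`_i bE`_j) (ifp i j)).
have igs (i : 'I_(\dim {:E})) : mu.-integrable setT (EFin \o (fun x => \sum_(j < \dim {:E})
    dotE bE`_i bE`_j * (coordf f i x * coordf phi j x))).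
  by apply: integrable_EFin_sum => // j; exact: igp.
have ig : mu.-integrable setT (EFin \o (fun x => dotE (f x) (phi x))).
  under eq_fun do rewrite dot_coord.
  by apply: integrable_EFin_sum => // i; exact: igs.
have -> : (\int[mu]_x (dotE (f x) (phi x))%:E = (\int[mu]_x dotE (f x) (phi x))%:E)%E.
  by rewrite /Rintegral fineK//; exact: (integrable_fin_num _ ig).
rewrite -!EFinM lee_fin.
apply: (@le_trans _ _ (G * C * I * d)); last first.
  by rewrite ler_wpM2r// ler_wpM2r// lerDl.
have -> : \int[mu]_x dotE (f x) (phi x) = \sum_(i < \dim {:E}) \sum_(j < \dim {:E})
    dotE bE`_i bE`_j * \int[mu]_x (coordf f i x * coordf phi j x).
  transitivity (\int[mu]_x \sum_(i < \dim {:E}) \sum_(j < \dim {:E})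
      dotE bE`_i bE`_j * (coordf f i x * coordf phi j x)).
    by apply: eq_Rintegral => x _; rewrite dot_coord.
  rewrite Rintegral_sum//; apply: eq_bigr => i _.
  by rewrite Rintegral_sum//; apply: eq_bigr => j _; rewrite RintegralZl.
rewrite -!mulrA mulr_suml; apply: ler_sum => i _.
rewrite mulr_suml; apply: ler_sum => j _.
rewrite (le_trans (ler_norm _))// normrM ler_wpM2l// mulrA.
exact: CP.
Qed.

End cocanceling_estimate.

(** * The two elementary implications *)

Section scaling.
Variables (R : realType) (n : nat).
Local Notation delta i := (delta_mx ord0 i : 'rV[R]_n).

Lemma is_derive_scale (w : 'rV[R]_n -> R) (c : R) i x : smooth w ->
  is_derive x (delta i) (fun x => w (c *: x)) (c * partial i w (c *: x)).
Proof.
move=> sw; have := C1_is_derive (c *: x) (c *: delta i) (smooth_C1 sw).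
rewrite (_ : \sum_j _ = c * partial i w (c *: x)); last first.
  rewrite (bigD1 i)//= !mxE !eqxx mulr1 big1 ?addr0// => j ji.
  by rewrite !mxE (negbTE ji) andbF mulr0 mul0r.
move=> /is_deriveP H; apply/is_deriveP; move: H.
apply: cvg_trans; apply: near_eq_cvg; near=> h.
by rewrite [c *: (_ + x)]scalerDr !scalerA [c * h]mulrC.
Unshelve. all: end_near. Qed.

Lemma smooth_scale (w : 'rV[R]_n -> R) (c : R) : smooth w -> smooth (fun x => w (c *: x)).
Proof.
move=> sw; apply: (@smooth_coind _ _ (fun g => exists (e : R) w, smooth w /\
    g = fun x => e * w (c *: x))); last first.
  by exists 1, w; split=> //; apply/funext => x; rewrite mul1r.
move=> _ [e [{sw}w [sw ->]]]; split.
  have cw : continuous (fun x : 'rV[R]_n => w (c *: x)).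
    move=> x; apply: (@continuous_comp 'rV[R]_n 'rV[R]_n R (fun x => c *: x)).
      by apply: (@cvgZr _ _ _ (nbhs x)); exact: cvg_id.
    exact: smooth_continuous sw _.
  by apply: continuous_rVM; [exact: cst_continuous|exact: cw].
move=> i; exists (fun x => (e * c) * partial i w (c *: x)).
  by exists (e * c), (partial i w); split; [exact: (smooth_partial i sw)|by []].
move=> x; rewrite -mulrA.
exact: (@is_deriveZ _ _ _ (fun x => w (c *: x)) e _ _ _ (is_derive_scale c i x sw)).
Qed.

Lemma test_scale (w : 'rV[R]_n -> R) (c : R) : c != 0 -> test_function w ->
  test_function (fun x => w (c *: x)).
Proof.
move=> c0 tw; apply/test_functionP; split.
  by apply: smooth_scale; exact: test_smooth.
have [B B0 wB] := test_bounded_support tw.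
exists (`|c|^-1 * B); first by rewrite mulr_ge0// invr_ge0.
by move=> x /wB; rewrite normrZ ler_pdivlMl// normr_gt0.
Qed.

Lemma partial_eq_cst (w : 'rV[R]_n -> R) (d : R) i x :
  (\forall y \near x, w y = d) -> partial i w x = 0.
Proof.
move=> wd; apply: partialE.
have H := @is_derive_cst R 'rV[R]_n R^o d x (delta i).
apply: (near_eq_is_derive _ H).
by near=> y; apply/esym; near: y.
Unshelve. all: end_near. Qed.

(** The function is locally constant off the shell between the two cubes. *)
Lemma partial_plateau (chi : 'rV[R]_n -> R) i x :
  (forall x, `|x| <= 1 -> chi x = 1) -> (forall x, chi x != 0 -> `|x| <= 2) ->
  partial i chi x != 0 -> 1 <= `|x| <= 2.
Proof.
move=> chi1 chi2; apply: contraR; rewrite negb_and -!ltNge => /orP[x1|x2]; apply/eqP.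
  apply: (@partial_eq_cst _ 1).
  have d0 : 0 < 1 - `|x| by rewrite subr_gt0.
  apply/nbhs_ballP; exists (1 - `|x|) => //= y; rewrite mx_norm_ball /ball_/= => xy.
  apply: chi1; rewrite -[y](subKr x) (le_trans (ler_normB _ _))//.
  by rewrite -lerBrDl ltW.
apply: (@partial_eq_cst _ 0).
have d0 : 0 < `|x| - 2 by rewrite subr_gt0.
apply/nbhs_ballP; exists (`|x| - 2) => //= y; rewrite mx_norm_ball /ball_/= => xy.
apply/eqP; apply: contraTT (xy) => /chi2 y2; rewrite -leNgt.
by rewrite (le_trans _ (lerB_dist _ _))// lerB.
Qed.

Lemma exprn_sum_single (I : finType) (a : I -> R) k :
  (forall i j, a i != 0 -> a j != 0 -> i = j) ->
  (\sum_i a i) ^+ k.+1 = \sum_i a i ^+ k.+1.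
Proof.
move=> single; case: (pickP (fun i => a i != 0)) => [i ai|a0]; last first.
  by rewrite !big1 ?expr0n//= => i _; move/negbFE/eqP: (a0 i) => ->; rewrite ?expr0n.
have aj j : j != i -> a j = 0.
  by move=> ji; apply/eqP; apply: contraNT ji => aj; rewrite (single _ _ aj ai).
rewrite (bigD1 i)//= big1 ?addr0 => [|j /aj//].
by rewrite (bigD1 i)//= big1 ?addr0// => j /aj ->; rewrite expr0n.
Qed.

End scaling.

Section slow_cutoffs.
Variables (R : realType) (m : nat).
Local Notation n := m.+1.
Local Notation mu := (lebesgue_rV R n).

(** The average of N + 1 dilates of one plateau. In dimension n the dilation leaves
    the L^n norm of the gradient unchanged, and the ratio 4 makes the supports of the
    gradients disjoint. Hence the n-th power of the norm is (N + 1) (N + 1)^-n A, which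
    tends to 0 because n >= 2. *)
Lemma exists_slow_cutoffs : (0 < m)%N -> exists2 A : R, 0 <= A &
  exists eta : nat -> 'rV[R]_n -> R, [/\ forall N, test_function (eta N),
    forall N x, 0 <= eta N x <= 1,
    forall x, \forall N \near \oo, eta N x = 1 &
    forall N, mu.-integrable setT (EFin \o
        (fun x => (\sum_i `|partial i (eta N) x|) ^+ n)) /\
      \int[mu]_x ((\sum_i `|partial i (eta N) x|) ^+ n) <= A / N.+1%:R].
Proof.
move=> m0; have [chi [tchi chi01 chi1 chi2]] := exists_plateau R n.
have schi := test_smooth tchi.
pose s (x : 'rV[R]_n) : R := \sum_i `|partial i chi x|.
have s0 x : 0 <= s x by apply: sumr_ge0.
have s12 x : s x != 0 -> 1 <= `|x| <= 2.
  apply: contraR => x12; apply/eqP; rewrite /s big1// => i _.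
  by apply/eqP; rewrite normr_eq0; apply: contraR x12; exact: partial_plateau.
have ms : measurable_fun setT s.
  apply: measurable_sum => i; apply: measurableT_comp => //.
  exact: test_measurable (test_partial i tchi).
have [Ks Ks0 sK] : exists2 K : R, 0 <= K & forall x, s x <= K.
  have /choice[K KP] i : exists K : R, forall x, `|partial i chi x| <= K.
    by have [K _ KP] := test_bounded (test_partial i tchi); exists K.
  exists (\sum_i K i); first by apply: sumr_ge0 => i _; exact: le_trans (KP i 0).
  by move=> x; apply: ler_sum => i _.
have isn : mu.-integrable setT (EFin \o (fun x => s x ^+ n)).
  apply: integrable_bounded_support; first exact: measurable_funX.
    by exists 2 => // x; rewrite expf_eq0/= => /s12/andP[].
  exists (Ks ^+ n); first exact: exprn_ge0.
  by move=> x; rewrite ger0_norm ?exprn_ge0// lerXn2r ?nnegrE.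
pose A := \int[mu]_x (s x ^+ n).
have A0 : 0 <= A by apply: Rintegral_ge0 => x _; exact: exprn_ge0.
exists A => //.
(* The dilations of the N-th cutoff start at scale 4^(N+1), so that the cutoffs
   converge to 1 pointwise. *)
pose c N j : R := 4 ^- (N.+1 + j).
have c0 N j : 0 < c N j by rewrite invr_gt0 exprn_gt0.
pose eta N (x : 'rV[R]_n) : R := N.+1%:R^-1 * \sum_(j < N.+1) chi (c N j *: x).
have N0 N : 0 < N.+1%:R^-1 :> R by rewrite invr_gt0.
have tsc N j : test_function (fun x => chi (c N j *: x)).
  by apply: test_scale => //; rewrite gt_eqF.
have tS N : test_function (fun x => \sum_(j < N.+1) chi (c N j *: x)).
  by apply: (test_sum (index_enum _) xpredT) => j; exact: tsc.
have teta N : test_function (eta N) by exact: testZ.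
have Deta N i x : `|partial i (eta N) x| <=
    N.+1%:R^-1 * \sum_(j < N.+1) (c N j * `|partial i chi (c N j *: x)|).
  rewrite (partialZ _ i x (test_smooth (tS N))).
  rewrite normrM gtr0_norm// ler_wpM2l ?(ltW (N0 N))//.
  rewrite partial_sum; last by move=> j; exact: (test_smooth (tsc N j)).
  rewrite (le_trans (ler_norm_sum _ _ _))//; apply: ler_sum => j _.
  rewrite (partialE (is_derive_scale (c N j) i x schi)) normrM.
  by rewrite gtr0_norm.
pose S N (x : 'rV[R]_n) : R := N.+1%:R^-1 * \sum_(j < N.+1) (c N j * s (c N j *: x)).
have SS N x : \sum_i `|partial i (eta N) x| <= S N x.
  apply: (le_trans (ler_sum _ (fun i _ => Deta N i x))).
  rewrite -mulr_sumr ler_wpM2l ?(ltW (N0 N))// exchange_big/=.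
  by apply: ler_sum => j _; rewrite -mulr_sumr.
have Sn N x : S N x ^+ n = N.+1%:R^-1 ^+ n * \sum_(j < N.+1) (c N j ^+ n * s (c N j *: x) ^+ n).
  rewrite /S exprMn; congr (_ * _); rewrite exprn_sum_single.
    by apply: eq_bigr => j _; rewrite exprMn.
  have sep (i j : 'I_N.+1) : (i < j)%N -> c N i * s (c N i *: x) != 0 ->
      c N j * s (c N j *: x) != 0 -> False.
    move=> ij; rewrite mulf_eq0 negb_or => /andP[_ /s12/andP[_ h2]].
    rewrite mulf_eq0 negb_or => /andP[_ /s12/andP[h1 _]].
    move: h1 h2; rewrite !normrZ !gtr0_norm// => h1 h2.
    have : c N j * 4 <= c N i.
      have -> : c N j = 4^-1 * c N i * 4 ^- (j - i.+1).
        rewrite /c -invfM -exprS -invfM -exprD; congr (_ ^- _); move: ij; lia.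
      set e := 4 ^- _; have e1 : e <= 1 by rewrite invf_le1 ?exprn_gt0// exprn_ege1// ler1n.
      have -> : 4^-1 * c N i * e * 4 = c N i * e by field.
      by rewrite ler_piMr// ltW.
    have x0 : 0 < `|x|.
      by rewrite lt_neqAle normr_ge0 andbT eq_sym; apply: contraTN h1 => /eqP ->; rewrite mulr0 -ltNge.
    move=> h; have := ler_wpM2r (ltW x0) h.
    by move: h1 h2; lra.
  move=> i j ai aj; case: (ltngtP i j) => [ij|ji|/val_inj//].
    by case: (sep _ _ ij ai aj).
  by case: (sep _ _ ji aj ai).
have isc N j : mu.-integrable setT (EFin \o (fun x => s (c N j *: x) ^+ n)) /\
    \int[mu]_x (s (c N j *: x) ^+ n) = c N j ^- n * A.
  have sn0 (y : 'rV[R]_n) : (0 <= (EFin \o (fun x : 'rV[R]_n => (s x ^+ n)%R)) y)%E by rewrite lee_fin exprn_ge0.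
  have := ge0_integral_affine 0 (lt0r_neq0 (c0 N j)) (measurable_int _ isn) sn0.
  rewrite gtr0_norm// => aff; split.
    apply: integrable_bounded_support.
    - apply: measurable_funX; apply: (measurableT_comp ms).
      by have := measurable_rV_affine (0 : 'rV[R]_n) (c N j); under eq_fun do rewrite add0r.
    - exists (2 / c N j); first by rewrite divr_ge0// ltW.
      move=> x; rewrite expf_eq0/= => /s12/andP[_].
      by rewrite normrZ gtr0_norm// ler_pdivlMr// mulrC.
    - exists (Ks ^+ n); first exact: exprn_ge0.
      by move=> x; rewrite ger0_norm ?exprn_ge0// lerXn2r ?nnegrE.
  have E : (\int[mu]_x (s (c N j *: x) ^+ n)%:E =
      (c N j ^- n)%:E * \int[mu]_x (s x ^+ n)%:E)%E.
    by rewrite -[RHS]aff; apply: eq_integral => x _; rewrite /= add0r.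
  by rewrite /Rintegral E fineM//; exact: (integrable_fin_num _ isn).
exists eta; split => //.
- move=> N x; apply/andP; split.
    by rewrite mulr_ge0 ?(ltW (N0 N))// sumr_ge0// => j _; have /andP[] := chi01 (c N j *: x).
  rewrite ler_pdivrMl// mulr1 (@le_trans _ _ (\sum_(j < N.+1) 1))//; last first.
    by rewrite sumr_const card_ord.
  by apply: ler_sum => j _; have /andP[] := chi01 (c N j *: x).
- move=> x; exists (Num.bound `|x|) => // N /= xN.
  rewrite /eta (eq_bigr (fun=> 1)); first by rewrite sumr_const card_ord mulVf.
  move=> j _; apply: chi1; rewrite normrZ gtr0_norm// ler_pdivrMl ?exprn_gt0// mulr1.
  apply: (@le_trans _ _ (Num.bound `|x|)%:R); first exact/ltW/archi_boundP.
  apply: (@le_trans _ _ (N.+1 + j)%:R); last first.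
    by rewrite -natrX ler_nat ltnW// ltn_expl.
  by rewrite ler_nat (leq_trans xN)// addSn leqW// leq_addr.
move=> N.
pose T N j x : R := c N j ^+ n * s (c N j *: x) ^+ n.
have iT j : mu.-integrable setT (EFin \o T N j).
  exact: (integrable_EFinZl measurableT (c N j ^+ n) (isc N j).1).
have iST : mu.-integrable setT (EFin \o (fun x => \sum_(j < N.+1) T N j x)).
  by apply: integrable_EFin_sum => // j; exact: iT.
have iS : mu.-integrable setT (EFin \o (fun x => S N x ^+ n)).
  have := integrableZl measurableT (N.+1%:R^-1 ^+ n) iST.
  by apply: eq_integrable => //= x _; rewrite Sn.
have le x : (\sum_i `|partial i (eta N) x|) ^+ n <= S N x ^+ n.
  have h0 : 0 <= \sum_i `|partial i (eta N) x| by apply: sumr_ge0.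
  by rewrite lerXn2r ?nnegrE// (le_trans h0).
have iD : mu.-integrable setT (EFin \o (fun x => (\sum_i `|partial i (eta N) x|) ^+ n)).
  apply: (le_integrable measurableT _ _ iS) => [|x _].
    apply/measurable_EFinP; apply: measurable_funX; apply: measurable_sum => i.
    apply: measurableT_comp => //; exact: test_measurable (test_partial i (teta N)).
  rewrite lee_fin ger0_norm ?exprn_ge0 ?sumr_ge0//.
  by rewrite (le_trans (le x))// ler_norm.
split => //; apply: (@le_trans _ _ (\int[mu]_x (S N x ^+ n))); first exact: le_Rintegral.
under eq_Rintegral do rewrite Sn.
rewrite RintegralZl// Rintegral_sum//; last by move=> j; exact: iT.
rewrite (eq_bigr (fun=> A)) => [|j _]; last first.
  rewrite /T RintegralZl ?(isc N j).1// (isc N j).2 mulrA divff ?mul1r//.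
  by rewrite expf_neq0// gt_eqF.
rewrite sumr_const card_ord -[A *+ _]mulr_natl mulrA mulrC ler_wpM2l//.
rewrite exprSr -mulrA mulVf// mulr1 -(prednK m0) exprS ler_piMr ?(ltW (N0 N))//.
by rewrite exprn_ile1 ?(ltW (N0 N))// invf_le1// ler1n.
Qed.

End slow_cutoffs.

Section implications.
Variables (R : realType) (m k : nat) (E F : vectType R).
Variables (dotE : {dot E for idfun}) (L : hom_diffop m.+1 k E F).
Local Notation mu := (lebesgue_rV R m.+1).
Local Notation bE := (vbasis {:E}).
Implicit Types (f phi : 'rV[R]_m.+1 -> E).

Lemma coordf_scale (h : 'rV[R]_m.+1 -> R) (e : E) j :
  coordf (fun x => h x *: e) j = fun x => h x * coord bE j e.
Proof. by apply/funext => x; rewrite /coordf linearZ. Qed.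

Lemma vint_scale (h : 'rV[R]_m.+1 -> R) (e : E) : mu.-integrable setT (EFin \o h) ->
  vint (fun x => h x *: e) = (\int[mu]_x h x) *: e.
Proof.
move=> ih; rewrite [e in RHS]coord_expansion scaler_sumr; apply: eq_bigr => j _.
by rewrite coordf_scale RintegralZr// scalerA.
Qed.

Lemma vtest_scale (h : 'rV[R]_m.+1 -> R) (e : E) : test_function h ->
  vtest_function (fun x => h x *: e).
Proof.
move=> [sh ch]; split.
  move=> j; rewrite coordf_scale.
  rewrite (_ : (fun x => _) = (fun x => coord bE j e * h x)); first exact: smoothZ.
  by apply/funext => x; rewrite mulrC.
apply: (subclosed_compact _ ch); first exact: closed_closure.
by apply: closureS => x /=; apply: contra => /eqP ->; rewrite scale0r.
Qed.

Lemma Dnorm_scale_le (h : 'rV[R]_m.+1 -> R) (e : E) x : test_function h ->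
  Dnorm dotE (fun x => h x *: e) x <= (\sum_i `|partial i h x|) * enorm dotE e.
Proof.
move=> th; rewrite (le_trans (Dnorm_le _ _ _))// mulr_suml; apply: ler_sum => i _.
have -> : vpartial i (fun x => h x *: e) x = partial i h x *: e.
  rewrite [e in RHS]coord_expansion scaler_sumr; apply: eq_bigr => j _.
  rewrite coordf_scale.
  rewrite (_ : (fun x => _) = (fun x => coord bE j e * h x)); last first.
    by apply/funext => y; rewrite mulrC.
  by rewrite (partialZ _ i x (test_smooth th)) scalerA mulrC.
by rewrite /enorm dotZl dotC dotZl mulrA -expr2 sqrtrM ?sqr_ge0// sqrtr_sqr.
Qed.

(** If all symbols kill e then so do all coefficients, and any scalar density times e
    is a solution; the indicator of a cube has nonzero integral. *)
Lemma vint_eq0_cocanceling :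
  (forall f, in_L1 dotE f -> diffop_eq0 L f -> vint f = 0) -> cocanceling L.
Proof.
move=> H; apply/seteqP; split=> [e Le|_ -> xi _ /=]; last exact: mem0v.
have Lae : forall a, L a e = 0.
  by apply: cancelingP => xi xi0; have := Le xi xi0; rewrite /= memv_ker => /eqP.
pose Q := [set x : 'rV[R]_m.+1 | `|x| <= 1].
have mQ : measurable Q by exact: measurable_cube.
have mQ1 : measurable_fun setT (\1_Q : 'rV[R]_m.+1 -> R) by exact: measurable_indic.
have Q1 (x : 'rV[R]_m.+1) : `|\1_Q x : R| <= 1.
  by rewrite indicE normr_nat lern1; case: (_ \in _).
have iQ : mu.-integrable setT (EFin \o (\1_Q : 'rV[R]_m.+1 -> R)).
  exact: integrable_indic_cube.
pose f (x : 'rV[R]_m.+1) : E := (\1_Q x : R) *: e.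
have mf j : measurable_fun setT (coordf f j).
  by rewrite /f coordf_scale; apply: measurable_funM.
have lf : in_L1 dotE f.
  split=> //; rewrite /L1norm Lnorm1.
  have iE : mu.-integrable setT (EFin \o (fun x => enorm dotE (f x))).
    have := integrableZr measurableT (enorm dotE e) iQ.
    apply: eq_integrable => //= x _; congr EFin.
    rewrite /f /enorm dotZl dotC dotZl mulrA -expr2 sqrtrM ?sqr_ge0// sqrtr_sqr.
    by rewrite ger0_norm// indicE.
  by have /integrableP[_] := iE.
have Lf : diffop_eq0 L f.
  move=> psi tpsi; apply: big1 => a _.
  have tp : test_function (multi_partial a psi).
    rewrite (_ : multi_partial a psi = iter_partial (mseq a) psi).
      exact: test_iter_partial.
    exact: multi_partialE.
  have ip := integrable_mul_bounded (test_integrable tp) mQ1 Q1.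
  rewrite linearZ/= (_ : (fun x => _) =
      (fun x => (multi_partial a psi x * \1_Q x) *: e)); last first.
    by apply/funext => x; rewrite scalerA.
  by rewrite vint_scale// linearZ/= Lae !scaler0.
have := H f lf Lf; rewrite vint_scale//.
rewrite (_ : \int[mu]_x \1_Q x = 2 ^+ m.+1); last first.
  rewrite /Rintegral integral_indic// setIT -[RHS]/(fine (2 ^+ m.+1)%:E).
  by congr fine; exact: measure_unit_cube.
by move/eqP; rewrite scaler_eq0 expf_eq0/= pnatr_eq0/= => /eqP.
Qed.

(** Test the estimate with eta_N v, where v is the integral of f and eta_N are the slow
    cutoffs: the left-hand side tends to v . v by dominated convergence, the right-hand
    side to 0. *)
Lemma estimate_vint_eq0 : (0 < m)%N ->
  (exists C : R, 0 < C /\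
     forall f phi, in_L1 dotE f -> diffop_eq0 L f -> vtest_function phi ->
       (\int[mu]_x (dotE (f x) (phi x))%:E
          <= C%:E * L1norm dotE f * LnormD dotE phi)%E) ->
  forall f, in_L1 dotE f -> diffop_eq0 L f -> vint f = 0.
Proof.
move=> m0 [C [C0 CP]] f lf Lf; set v := vint f.
have [A A0 [eta [teta eta01 eta1 etaD]]] := exists_slow_cutoffs R m0.
have [ie L1E] := L1norm_EFin lf; set I := \int[mu]_x enorm dotE (f x) in L1E.
have I0 : 0 <= I by apply: Rintegral_ge0 => x _; exact: enorm_ge0.
pose h x := dotE (f x) v.
have lin e : dotE e v = \sum_i coord bE i e * dotE bE`_i v by exact: dot_coordl.
have hv e : `|dotE e v| <= enorm dotE v * enorm dotE e.
  by rewrite mulrC; exact: cauchy_schwarz.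
have ih : mu.-integrable setT (EFin \o h) := (integrable_linear_L1 lf lin hv).1.
have hE : \int[mu]_x h x = dotE v v.
  have ifi (i : 'I_(\dim {:E})) : mu.-integrable setT (EFin \o (fun x => coordf f i x * dotE bE`_i v)).
    exact: (integrable_EFinZr measurableT (dotE bE`_i v) (integrable_coordf i lf)).
  rewrite {1}/v /vint dot_suml.
  transitivity (\int[mu]_x \sum_(i < \dim {:E}) coordf f i x * dotE bE`_i v).
    by apply: eq_Rintegral => x _; exact: lin.
  rewrite Rintegral_sum//; apply: eq_bigr => i _.
  by rewrite RintegralZr; [|exact: measurableT|exact: (integrable_coordf i lf)].
have ieh N : mu.-integrable setT (EFin \o (fun x => h x * eta N x)).
  apply: (@integrable_mul_bounded _ _ _ _ 1) => //.
    exact: test_measurable.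
  by move=> x; have /andP[a b] := eta01 N x; rewrite ger0_norm.
have dct : \int[mu]_x (h x * eta N x) @[N --> \oo] --> dotE v v.
  have eh : (\int[mu]_x (h x)%:E = (dotE v v)%:E)%E.
    by rewrite -hE /Rintegral fineK//; exact: (integrable_fin_num _ ih).
  have := @dominated_cvg _ _ _ mu setT measurableT (fun N x => (h x * eta N x)%:E)
    (fun x => (h x)%:E) (fun x => `|h x|%:E).
  rewrite eh => dc; apply: fine_cvg; apply: dc => //.
  - by move=> N; exact: measurable_int (ieh N).
  - move=> x _; apply: cvg_near_cst; have := eta1 x; apply: filterS => N ->.
    by rewrite mulr1.
  - exact: (integrable_norm ih).
  - move=> N x _; have /andP[a b] := eta01 N x.
    by rewrite lee_fin normrM (ger0_norm a) ler_piMr.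
(* Comparing the (m.+1)-th powers avoids roots of the integrals. *)
have bound N : \int[mu]_x (h x * eta N x) <= 0 \/
   (\int[mu]_x (h x * eta N x)) ^+ m.+1 <= (C * I * enorm dotE v) ^+ m.+1 * (A / N.+1%:R).
  have := CP f (fun x => eta N x *: v) lf Lf (vtest_scale v (teta N)).
  have [d [d0 -> dE]] := LnormD_EFin dotE (ltn0Sn m) (vtest_scale v (teta N)).
  rewrite L1E (_ : (\int[mu]_x _ = (\int[mu]_x (h x * eta N x))%:E)%E); last first.
    rewrite /Rintegral fineK ?(integrable_fin_num _ (ieh N))//.
    by apply: eq_integral => x _; rewrite dotC dotZl dotC mulrC.
  rewrite -!EFinM lee_fin; set J := \int[mu]_x _ => JCd.
  have [J0|J0] := leP J 0; [by left|right].
  apply: (@le_trans _ _ ((C * I * d) ^+ m.+1)).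
    by rewrite lerXn2r ?nnegrE ?(ltW J0) ?mulr_ge0 ?(ltW C0).
  rewrite !exprMn -!mulrA ler_wpM2l ?exprn_ge0 ?(ltW C0)// ler_wpM2l ?exprn_ge0// dE.
  have [iDe DeA] := etaD N.
  apply: (@le_trans _ _ (enorm dotE v ^+ m.+1 * \int[mu]_x ((\sum_i `|partial i (eta N) x|) ^+ m.+1))).
    rewrite -RintegralZl//; apply: le_Rintegral => //.
    - exact: (integrable_DnormX dotE (ltn0Sn m) (vtest_scale v (teta N))).
    - exact: (integrable_EFinZl measurableT (enorm dotE v ^+ m.+1) iDe).
    move=> x _; rewrite -exprMn lerXn2r ?nnegrE ?Dnorm_ge0//.
      by rewrite mulr_ge0 ?enorm_ge0// sumr_ge0.
    by rewrite mulrC; exact: Dnorm_scale_le.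
  by rewrite ler_wpM2l// exprn_ge0 ?enorm_ge0.
apply: (dot_eq0 (dotE := dotE)); apply/eqP; rewrite eq_le dot_ge0 andbT leNgt.
apply/negP => vv0; pose dl := dotE v v / 2.
have dl0 : 0 < dl by rewrite divr_gt0.
have dlv : dl < dotE v v by rewrite ltr_pdivrMr// ltr_pMr// ltr1n.
pose W := (C * I * enorm dotE v) ^+ m.+1 * A.
have W0 : 0 <= W by rewrite mulr_ge0// exprn_ge0// !mulr_ge0 ?(ltW C0) ?enorm_ge0.
have Wd : \forall N \near \oo, W / N.+1%:R < dl ^+ m.+1.
  exists (Num.bound (W / dl ^+ m.+1)) => // N /= bN.
  rewrite ltr_pdivrMr// mulrC -ltr_pdivrMr ?exprn_gt0//.
  apply: lt_le_trans (archi_boundP _) _; first by rewrite divr_ge0// exprn_ge0// ltW.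
  by rewrite ler_nat leqW.
near \oo => N.
have Jdl : dl < \int[mu]_x (h x * eta N x).
  by near: N; exact: (cvgr_gt _ dct _ dlv).
have WN : W / N.+1%:R < dl ^+ m.+1 by near: N.
have [J0|] := bound N.
  by have := lt_trans dl0 Jdl; rewrite ltNge J0.
apply/negP; rewrite -ltNge mulrA -/W (lt_trans WN)// ltrXn2r// ?nnegrE ?(ltW dl0)//.
Unshelve. all: end_near. Qed.

End implications.

Theorem theorem1p4 (R : realType) (n k : nat) (E F : vectType R)
    (dotE : {dot E for idfun}) (dotF : {dot F for idfun})
    (L : hom_diffop n k E F) :
  (2 <= n)%N ->
  [<-> (exists C : R, 0 < C /\
          forall f phi : 'rV[R]_n -> E,
            in_L1 dotE f -> diffop_eq0 L f -> vtest_function phi ->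
            (\int[lebesgue_rV R n]_x (dotE (f x) (phi x))%:E
              <= C%:E * L1norm dotE f * LnormD dotE phi)%E);
       (forall f : 'rV[R]_n -> E,
          in_L1 dotE f -> diffop_eq0 L f -> vint f = 0);
       cocanceling L].
Proof.
case: n L => [|[|m]]// L _; tfae.
- exact: estimate_vint_eq0.
- exact: vint_eq0_cocanceling.
- exact: cocanceling_estimate.
Qed.
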